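(* Let $K\subset\mathbb{E}^3$ be a compact convex set with volume $V$. Then $$\int L(K\cap E)^2\,dE=\int_{P\notin K}|\Omega(P)|^2\,dP+4\pi^2V ,$$ where the left-hand integral is over all affine planes $E$ in $\mathbb{E}^3$.
   Context: $\mathbb{E}^3$ is Euclidean 3-space and $dP$ is Lebesgue measure on it. $dE$ is the measure on affine planes in $\mathbb{E}^3$ invariant under rigid motions, normalized so that, writing a plane as $\{x:\langle x,u\rangle=t\}$ with $u\in S^2$, $t\in\mathbb{R}$ (each plane being represented twice), $dE=\frac12\,dt\,du$ with $du$ the surface measure of the unit sphere $S^2$. $L(K\cap E)$ is the length of the boundary (perimeter) of the planar compact convex set $K\cap E$ within $E$ (it is $0$ if $K\cap E=\emptyset$, and twice the length if $K\cap E$ is a segment). For $P\notin K$, the visual solid angle $\Omega(P)\subset S^2$ of $K$ from $P$ is the set of unit vectors $u$ such that the ray $\{P+tu:t\ge0\}$ meets $K$, and $|\Omega(P)|$ is its surface measure on $S^2$. *)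

(* Defs.v *)
From HB Require Import structures.
From mathcomp Require Import all_boot all_order all_algebra.
From mathcomp Require Import all_classical all_reals all_analysis.
From mathcomp Require Import measurable_realfun.

Set Implicit Arguments.
Unset Strict Implicit.
Unset Printing Implicit Defensive.
Import Order.TTheory GRing.Theory Num.Theory.
Import numFieldNormedType.Exports.

Local Open Scope classical_set_scope.
Local Open Scope ring_scope.

(* [measurableTypeR R] is R with its Borel sigma-algebra, the carrier of
   [lebesgue_measure].  As a normed space, this product carries the sup norm:
   the topology is the Euclidean one, but Euclidean lengths are given by
   [enorm] below. *)
Notation E3 R := (measurableTypeR R * measurableTypeR R * measurableTypeR R)%type.

Definition dot (R : realType) (x y : E3 R) : R :=
  x.1.1 * y.1.1 + x.1.2 * y.1.2 + x.2 * y.2.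

Definition enorm (R : realType) (x : E3 R) : R := Num.sqrt (dot x x).

Definition plane (R : realType) (u : E3 R) (t : R) : set (E3 R) :=
  [set x | dot x u = t].

Definition unit_sphere (R : realType) : set (E3 R) := [set u | enorm u = 1].

Lemma sigma_finite_product d1 d2 (T1 : measurableType d1)
    (T2 : measurableType d2) (R : realType)
    (m1 : {sigma_finite_measure set T1 -> \bar R})
    (m2 : {sigma_finite_measure set T2 -> \bar R}) :
  sigma_finite [set: T1 * T2] (m1 \x m2)%E.
Proof.
have /sigma_finiteP[F [TF ndF Foo]] := sigma_finiteT m1.
have /sigma_finiteP[G [TG ndG Goo]] := sigma_finiteT m2.
exists (fun n => F n `*` G n).
  rewrite -setXTT TF TG predeqE => -[x y]; split.
    move=> [/= [n _ Fnx] [k _ Gky]]; exists (maxn n k) => //; split.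
    - by move: x Fnx; exact/subsetPset/ndF/leq_maxl.
    - by move: y Gky; exact/subsetPset/ndG/leq_maxr.
  by move=> [n _ []/= ? ?]; split; exists n.
move=> k; have [? ?] := Foo k; have [? ?] := Goo k.
split; first exact: measurableX.
by rewrite product_measure1E// lte_mul_pinfty// ge0_fin_numE.
Qed.

Definition lebesgue2 (R : realType)
    : set (measurableTypeR R * measurableTypeR R) -> \bar R :=
  (@lebesgue_measure R \x @lebesgue_measure R)%E.

HB.instance Definition _ (R : realType) := Measure.on (@lebesgue2 R).

HB.instance Definition _ (R : realType) :=
  Measure_isSigmaFinite.Build _ _ _ (@lebesgue2 R)
    (sigma_finite_product (@lebesgue_measure R) (@lebesgue_measure R)).

Definition lebesgue3 (R : realType) : set (E3 R) -> \bar R :=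
  (@lebesgue2 R \x @lebesgue_measure R)%E.

HB.instance Definition _ (R : realType) := Measure.on (@lebesgue3 R).

HB.instance Definition _ (R : realType) :=
  Measure_isSigmaFinite.Build _ _ _ (@lebesgue3 R)
    (sigma_finite_product (@lebesgue2 R) (@lebesgue_measure R)).

Section sphere_measure.
Variable R : realType.
Local Notation M := (measurableTypeR R).

(* z = (longitude, colatitude) *)
Definition sph (z : M * M) : E3 R :=
  (sin z.2 * cos z.1, sin z.2 * sin z.1, cos z.2).

Definition sph_dom : set (M * M) := `[0, 2 * pi] `*` `[0, pi].

(* The surface measure of the unit sphere, as a measure on the ambient space
   that charges only the sphere: sin z.2 is the area element
   |d(sph)/d(z.1) x d(sph)/d(z.2)| of the parametrization [sph]. *)
Definition sphere_measure (A : set (E3 R)) : \bar R :=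
  \int[@lebesgue2 R]_(z in sph_dom `&` sph @^-1` A) (sin z.2)%:E.

Lemma measurable_sph : measurable_fun [set: M * M] sph.
Proof.
have m1 : measurable_fun [set: M * M] (fst : M * M -> M) by exact: measurable_fst.
have m2 : measurable_fun [set: M * M] (snd : M * M -> M) by exact: measurable_snd.
have ms : measurable_fun [set: M] (@sin R : M -> M).
  by apply: continuous_measurable_fun; exact: continuous_sin.
have mc : measurable_fun [set: M] (@cos R : M -> M).
  by apply: continuous_measurable_fun; exact: continuous_cos.
apply/measurable_fun_pair; last exact: (measurableT_comp mc m2).
apply/measurable_fun_pair; apply: measurable_funM.
- exact: (measurableT_comp ms m2).
- exact: (measurableT_comp mc m1).
- exact: (measurableT_comp ms m2).
- exact: (measurableT_comp ms m1).
Qed.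

Lemma measurable_sph_dom : measurable sph_dom.
Proof. by apply: measurableX; exact: measurable_itv. Qed.

Lemma measurable_sph_preimage (A : set (E3 R)) :
  measurable A -> measurable (sph_dom `&` sph @^-1` A).
Proof.
move=> mA; apply: measurableI; first exact: measurable_sph_dom.
by rewrite -[X in measurable X]setTI; exact: measurable_sph.
Qed.

Let sin_ge0_sph_dom (z : M * M) : sph_dom z -> (0 <= (sin z.2)%:E)%E.
Proof.
move=> [_ /=]; rewrite in_itv/= => z2.
by rewrite lee_fin sin_ge0_pi.
Qed.

Let sphere_measure0 : sphere_measure set0 = 0%E.
Proof. by rewrite /sphere_measure preimage_set0 setI0 integral_set0. Qed.

Let sphere_measure_ge0 A : (0 <= sphere_measure A)%E.
Proof. by apply: integral_ge0 => z [/sin_ge0_sph_dom]. Qed.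

Let sphere_measure_sigma_additive : semi_sigma_additive sphere_measure.
Proof.
move=> /= F mF tF mUF; rewrite /sphere_measure; apply: cvg_toP.
  apply: ereal_nondecreasing_is_cvgn => m n mn.
  by apply: lee_sum_nneg_natr => // k _ _; exact: sphere_measure_ge0.
rewrite preimage_bigcup setI_bigcupr ge0_integral_bigcup//.
- by move=> k; exact: measurable_sph_preimage.
- apply: measurable_funTS; apply/measurable_EFinP.
  apply: measurableT_comp; last exact: measurable_snd.
  by apply: continuous_measurable_fun; exact: continuous_sin.
- by move=> z [k _] [/sin_ge0_sph_dom].
- apply/trivIsetP => /= i j _ _ ij.
  by rewrite setIACA -preimage_setI; move/trivIsetP : tF => ->//;
    rewrite preimage_set0 setI0.
Qed.

HB.instance Definition _ := isMeasure.Build _ _ _ sphere_measure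
  sphere_measure0 sphere_measure_ge0 sphere_measure_sigma_additive.

End sphere_measure.

(* The measure dE = dt du / 2 on pairs (u, t): each plane is represented by
   the two pairs (u, t) and (- u, - t). *)
Definition plane_measure (R : realType) : set (E3 R * measurableTypeR R) -> \bar R :=
  mscale (2^-1)%:nng (@sphere_measure R \x @lebesgue_measure R)%E.

HB.instance Definition _ (R : realType) := Measure.on (@plane_measure R).

Definition polygon_length (R : realType) (f : R -> E3 R) (a : R) (s : seq R) : R :=
  \sum_(0 <= i < size s)
    enorm (f (nth a (a :: s) i.+1) - f (nth a (a :: s) i)).

Definition curve_length (R : realType) (f : R -> E3 R) (a b : R) : \bar R :=
  ereal_sup [set (polygon_length f a s)%:E | s in itv_partition a b].

Definition segment (R : realType) (a b : E3 R) : set (E3 R) :=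
  [set (1 - t) *: a + t *: b | t in `[0, 1]].

(* The boundary of C relatively to a plane E containing it.  As E is closed,
   closures in E and in the ambient space coincide. *)
Definition rel_boundary (R : realType) (E C : set (E3 R)) : set (E3 R) :=
  closure C `&` closure (E `\` C).

Definition boundary_param (R : realType) (E C : set (E3 R)) : set (R -> E3 R) :=
  [set f : R -> E3 R |
    [/\ {within `[0%R, 1%R], continuous f}, f 0 = f 1,
        {in `[0, 1[ &, injective f} &
        f @` `[0, 1] = rel_boundary E C]].

(* Length of the boundary of a compact convex subset C of a plane E: 0 for the
   empty set, twice the length for a (possibly degenerate) segment, and
   otherwise the length of the simple closed curve bounding C in E.  In the last
   two cases the set under [ereal_inf] has a single element, since the length
   depends neither on the endpoints nor on the parametrization chosen. *)
Definition perimeter (R : realType) (E C : set (E3 R)) : \bar R :=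
  if pselect (C = set0) then 0%E
  else if pselect (exists a b, C = segment a b) then
    ereal_inf [set (2 * enorm (ab.2 - ab.1))%:E | ab in
                 [set ab | C = segment ab.1 ab.2]]
  else ereal_inf [set curve_length f 0 1 | f in boundary_param E C].

Definition solid_angle (R : realType) (K : set (E3 R)) (P : E3 R) : set (E3 R) :=
  [set u | unit_sphere u /\ exists2 t : R, 0 <= t & K (P + t *: u)].

(* Main.v *)
From HB Require Import structures.
Require Import Defs.
From mathcomp Require Import all_boot all_order all_algebra.
From mathcomp Require Import all_classical all_reals all_analysis.
From mathcomp Require Import measurable_realfun.
From mathcomp Require Import ring lra.
From mathcomp Require finmap.

Set Implicit Arguments.
Unset Strict Implicit.
Unset Printing Implicit Defensive.
Import Order.TTheory GRing.Theory Num.Theory.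
Import numFieldNormedType.Exports.

Local Open Scope classical_set_scope.
Local Open Scope ring_scope.

(** Both sides count pairs of coplanar lines that meet K, organized by plane on
   the left and by common point on the right.

   In a plane E, Cauchy's formula turns L(K `&` E) into the measure of the set
   of lines of E that meet K, so that L ^ 2 measures ordered pairs of such
   lines. Two lines of a plane almost always meet in a point P. When pairs are
   sorted by P instead, those through P contribute m(P) ^ 2, where m(P) is the
   measure of the set of lines through P that meet K. If P lies in K every
   line through P meets K and m(P) is half the area of the sphere, 2 * pi,
   whence the term 4 * pi ^ 2 * V. If P lies outside K, a line through P meets
   K on one side of P only, by convexity, and m(P) is the solid angle.

   The classical identity between the two measures on pairs of lines becomes
   linear in suitable charts. Planes are x + b * y + c * z = t, directions are
   (p, 1, n), and the lines of direction (p, 1, n) in a plane, where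
   p = - b - c * n, are told apart by their height k = z - n * y. Central
   projection of the sphere on a plane (integral_gnomonic_x and
   integral_gnomonic_y) gives the normal (1, b, c) the density
   (1 + b ^ 2 + c ^ 2) ^ (- 3 / 2), and the direction (p, 1, n) the density
   (1 + p ^ 2 + n ^ 2) ^ (- 3 / 2). The measure dE
   becomes (1 + b ^ 2 + c ^ 2) ^ (- 2) db dc dt, and Cauchy's formula
   (perimeterE) has a factor 1 + b ^ 2 + c ^ 2 in front of an integral over n
   and k, which compensates exactly once the perimeter is squared. For two
   slopes n1 and n2, the linear maps from P = (x, y, z) to (t, k1, k2) and from
   (b, c) to (p1, p2) both have Jacobian |n1 - n2|, whence
   db dc dt dk1 dk2 = dp1 dp2 dP (integral_line_pairs).

   Cauchy's formula is proved for the length defined by inscribed polygons.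
   A single segment is an explicit integral over n of its extent in height
   (integral_chord). For a fixed n, an inscribed polygon moves up and down by
   at most twice the extent of C in height, since a level line crosses the
   boundary of a convex set at most twice (polygon_height_le), and by at least
   that much up to a small error when the polygon is fine (polygon_height_ge).
   That the boundary has a parametrization at all, so that the infimum in the
   definition of the perimeter is not over the empty set, comes from polar
   coordinates around an inner point (exists_boundary_param). *)

(** * Measurability of real functions *)

Section measurable_utils.
Context {R : realType}.
Local Notation M := (measurableTypeR R).

Lemma measurable_invr : measurable_fun [set: M] (fun x : M => x^-1 : M).
Proof.
have m0 : measurable ([set 0] : set M) by exact: measurable_set1.
rewrite -(setvU [set 0]); apply/measurable_funU => //; first exact: measurableC.
split; last first.
  exact: measurable_fun_set1.
apply: (@open_continuous_measurable_fun R _ (fun x : R => x^-1)).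
  by apply: closed_openC; exact: closed_eq.
by move=> x /[!inE] /eqP x0; exact: inv_continuous.
Qed.

Lemma measurable_sqrtr : measurable_fun [set: M] (Num.sqrt : M -> M).
Proof. by apply: continuous_measurable_fun; exact: sqrt_continuous. Qed.

Context d (T : measurableType d) (D : set T).
Implicit Types f g : T -> M.

Lemma measurable_fun_inv f : measurable_fun D f ->
  measurable_fun D (fun x => (f x)^-1 : M).
Proof. exact: (measurableT_comp measurable_invr). Qed.

Lemma measurable_fun_sqrt f : measurable_fun D f ->
  measurable_fun D (fun x => Num.sqrt (f x) : M).
Proof. exact: (measurableT_comp measurable_sqrtr). Qed.

Lemma measurable_fun_sin f : measurable_fun D f ->
  measurable_fun D (fun x => sin (f x) : M).
Proof.
apply: measurableT_comp.
by apply: continuous_measurable_fun; exact: continuous_sin.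
Qed.

Lemma measurable_fun_cos f : measurable_fun D f ->
  measurable_fun D (fun x => cos (f x) : M).
Proof.
apply: measurableT_comp.
by apply: continuous_measurable_fun; exact: continuous_cos.
Qed.

Lemma measurable_fun_atan f : measurable_fun D f ->
  measurable_fun D (fun x => atan (f x) : M).
Proof.
apply: measurableT_comp.
by apply: continuous_measurable_fun => x; exact: continuous_atan.
Qed.

Lemma measurable_fun_norm f : measurable_fun D f ->
  measurable_fun D (fun x => `|f x| : M).
Proof. by apply: measurableT_comp; exact: normr_measurable. Qed.

Lemma measurable_fun_fst d1 d2 (T1 : measurableType d1) (T2 : measurableType d2)
  (f : T -> T1 * T2) : measurable_fun D f -> measurable_fun D (fun x => (f x).1).
Proof. exact: (measurableT_comp measurable_fst). Qed.

Lemma measurable_fun_snd d1 d2 (T1 : measurableType d1) (T2 : measurableType d2)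
  (f : T -> T1 * T2) : measurable_fun D f -> measurable_fun D (fun x => (f x).2).
Proof. exact: (measurableT_comp measurable_snd). Qed.

End measurable_utils.

(** Measurability of an explicit formula, by recursion on its head symbol. The
   operands are named because unification alone would have to guess them. *)
Ltac mfun1 :=
  lazymatch goal with
  | |- measurable_fun _ (fun x => x) => exact: measurable_id
  | |- measurable_fun _ (fun _ => ?c) => exact: measurable_cst
  | |- measurable_fun _ (fun x => (@?f x, @?g x)) =>
      apply: (@measurable_fun_pair _ _ _ _ _ _ f g)
  | |- measurable_fun _ (fun x => GRing.add (@?f x) (GRing.opp (@?g x))) =>
      apply: (@measurable_funB _ _ _ _ f g)
  | |- measurable_fun _ (fun x => GRing.add (@?f x) (@?g x)) =>
      apply: (@measurable_funD _ _ _ _ f g)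
  | |- measurable_fun _ (fun x => GRing.opp (@?f x)) =>
      apply: (@measurable_funN _ _ _ _ f)
  | |- measurable_fun _ (fun x => GRing.mul (@?f x) (@?g x)) =>
      apply: (@measurable_funM _ _ _ _ f g)
  | |- measurable_fun _ (fun x => GRing.exp (@?f x) ?n) =>
      apply: (@measurable_funX _ _ _ _ f n)
  | |- measurable_fun _ (fun x => GRing.inv (@?f x)) =>
      apply: (@measurable_fun_inv _ _ _ _ f)
  | |- measurable_fun _ (fun x => Num.sqrt (@?f x)) =>
      apply: (@measurable_fun_sqrt _ _ _ _ f)
  | |- measurable_fun _ (fun x => sin (@?f x)) =>
      apply: (@measurable_fun_sin _ _ _ _ f)
  | |- measurable_fun _ (fun x => cos (@?f x)) =>
      apply: (@measurable_fun_cos _ _ _ _ f)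
  | |- measurable_fun _ (fun x => atan (@?f x)) =>
      apply: (@measurable_fun_atan _ _ _ _ f)
  | |- measurable_fun _ (fun x => Num.norm (@?f x)) =>
      apply: (@measurable_fun_norm _ _ _ _ f)
  | |- measurable_fun _ (fun x => EFin (@?f x)) =>
      apply/measurable_EFinP
  | |- measurable_fun _ (fun x => mule (@?f x) (@?g x)) =>
      apply: (@emeasurable_funM _ _ _ _ f g)
  | |- measurable_fun _ (fun x => fst (@?f x)) =>
      apply: (@measurable_fun_fst _ _ _ _ _ _ _ f)
  | |- measurable_fun _ (fun x => snd (@?f x)) =>
      apply: (@measurable_fun_snd _ _ _ _ _ _ _ f)
  end.
Ltac mfun := cbv beta; repeat (mfun1; cbv beta); try assumption.

(** * Change of variables for non-negative functions *)

Section density.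
Local Open Scope ereal_scope.
Context d1 d2 (X : measurableType d1) (Y : measurableType d2) (R : realType).
Variables (mu : {measure set X -> \bar R}).
Variables (D : set X) (phi : X -> Y) (w : X -> R).
Hypotheses (mD : measurable D) (mphi : measurable_fun D phi).
Hypotheses (mw : measurable_fun D w) (w0 : forall x, D x -> (0 <= w x)%R).

Import HBNNSimple.

(** By linearity and monotone convergence, a density with respect to an image
   measure only has to be checked on sets. *)
Lemma ge0_integral_density (nu : {measure set Y -> \bar R}) (g : Y -> \bar R) :
  (forall A, measurable A ->
    nu A = \int[mu]_(x in D `&` phi @^-1` A) (w x)%:E) ->
  measurable_fun setT g -> (forall y, 0 <= g y) ->
  \int[nu]_y g y = \int[mu]_(x in D) ((w x)%:E * g (phi x)).
Proof.
move=> nuE mg g0; pose g_ := nnsfun_approx measurableT mg.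
have mgphi n : measurable_fun D (fun x => (g_ n (phi x))%:E).
  by apply/measurable_EFinP; exact: measurableT_comp.
have mwE : measurable_fun D (fun x => (w x)%:E) by exact/measurable_EFinP.
transitivity (limn (fun n => \int[nu]_y (g_ n y)%:E)).
  rewrite -monotone_convergence//.
  - by apply: eq_integral => y _; apply/esym/cvg_lim => //; exact: cvg_nnsfun_approx.
  - by move=> n; exact/measurable_EFinP.
  - by move=> n y _; rewrite lee_fin.
  - by move=> y _ m n mn; rewrite lee_fin; exact/lefP/nd_nnsfun_approx.
transitivity (limn (fun n => \int[mu]_(x in D) ((w x)%:E * (g_ n (phi x))%:E))); last first.
  rewrite -monotone_convergence//.
  - apply: eq_integral => x /[!inE] Dx; apply/cvg_lim => //.
    by apply: cvgeZl => //; exact: cvg_nnsfun_approx.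
  - by move=> n; exact: emeasurable_funM.
  - by move=> n x Dx; rewrite mule_ge0 ?lee_fin ?w0.
  - move=> x Dx m n mn; rewrite lee_wpmul2l ?lee_fin ?w0//.
    exact/lefP/nd_nnsfun_approx.
apply/congr_lim/funext => n.
have mA r : measurable (g_ n @^-1` [set r]) by exact: measurable_sfunP.
have mphiA r : measurable (D `&` phi @^-1` (g_ n @^-1` [set r])) by exact: mphi.
under eq_integral do rewrite fimfunE -fsumEFin//.
rewrite ge0_integral_fsum//; last 2 first.
- by move=> r; exact/measurable_EFinP/measurable_funM.
- by move=> r x _; rewrite nnfun_muleindic_ge0.
transitivity (\int[mu]_(x in D) \sum_(k \in range (g_ n))
    ((w x)%:E * (k * \1_(g_ n @^-1` [set k]) (phi x))%:E)); last first.
  apply: eq_integral => x /[!inE] Dx.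
  rewrite -ge0_mule_fsumr; last by move=> r; rewrite EFinM nnfun_muleindic_ge0.
  by rewrite [in RHS]fimfunE -fsumEFin.
rewrite ge0_integral_fsum//; last 2 first.
- move=> r; apply: emeasurable_funM => //; apply/measurable_EFinP.
  apply: measurable_funM => //.
  by apply: measurableT_comp mphi => //; exact: measurable_indic.
- move=> r x Dx; apply: mule_ge0; first by rewrite lee_fin w0.
  by rewrite EFinM nnfun_muleindic_ge0.
apply: eq_fsbigr => r _; rewrite integralZl_indic_nnsfun//.
rewrite integral_indic// setIT nuE//.
have [r0|r0] := ltP r 0%R.
  have A0 : g_ n @^-1` [set r] = set0 by exact: preimage_nnfun0.
  rewrite A0 preimage_set0 setI0 integral_set0 mule0 integral0_eq// => x _.
  by rewrite indic0 mulr0 mule0.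
transitivity (r%:E * \int[mu]_(x in D)
    ((w x)%:E * (\1_(g_ n @^-1` [set r]) (phi x))%:E)).
  congr (_ * _); rewrite integral_mkcondr; apply: eq_integral => x _.
  rewrite patchE indicE/=.
  have -> : (x \in phi @^-1` (g_ n @^-1` [set r])) = (phi x \in g_ n @^-1` [set r]).
    by apply/idP/idP => /[!inE].
  by case: ifPn => h; rewrite ?mule1 ?mule0.
rewrite -ge0_integralZl//.
- by apply: eq_integral => x _; rewrite EFinM muleCA.
- apply: emeasurable_funM => //; apply/measurable_EFinP.
  by apply: measurableT_comp mphi => //; exact: measurable_indic.
- by move=> x Dx; rewrite mule_ge0 ?lee_fin ?w0.
Qed.

End density.

(** A change of variables on the line only has to be checked on intervals. *)
Lemma ge0_integral_substitution d (X : measurableType d) (R : realType)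
    (mu : {measure set X -> \bar R}) (D : set X)
    (phi : X -> measurableTypeR R) (w : X -> R) :
  measurable D -> measurable_fun D phi -> measurable_fun D w ->
  (forall x, D x -> 0 <= w x) ->
  (forall a b : R, a < b ->
    (\int[mu]_(x in D `&` phi @^-1` `]a, b]) (w x)%:E = (b - a)%:E)%E) ->
  forall g : measurableTypeR R -> \bar R,
  measurable_fun setT g -> (forall y, (0 <= g y)%E) ->
  (\int[lebesgue_measure]_y g y =
   \int[mu]_(x in D) ((w x)%:E * g (phi x)))%E.
Proof.
move=> mD mphi mw w0 wE g mg g0.
pose nu A := (\int[mu]_(x in D `&` phi @^-1` A) (w x)%:E)%E.
have mwE : measurable_fun D (fun x => (w x)%:E) by exact/measurable_EFinP.
have nu0 : nu set0 = 0%E by rewrite /nu preimage_set0 setI0 integral_set0.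
have nu_ge0 A : (0 <= nu A)%E.
  by apply: integral_ge0 => x [Dx _]; rewrite lee_fin w0.
have nu_sa : semi_sigma_additive nu.
  move=> /= F mF tF mUF; rewrite /nu; apply: cvg_toP.
    apply: ereal_nondecreasing_is_cvgn => m n mn.
    by apply: lee_sum_nneg_natr => // k _ _; exact: nu_ge0.
  rewrite preimage_bigcup setI_bigcupr ge0_integral_bigcup//.
  - by move=> k; exact: mphi.
  - apply: measurable_funS mwE => //.
    by move=> x [k _ []].
  - by move=> x [k _] [Dx _]; rewrite lee_fin w0.
  - apply/trivIsetP => /= i j _ _ ij.
    by rewrite setIACA -preimage_setI; move/trivIsetP : tF => ->//;
      rewrite preimage_set0 setI0.
pose m : {measure set (measurableTypeR R) -> \bar R} :=
  HB.pack nu (isMeasure.Build _ _ _ nu nu0 nu_ge0 nu_sa).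
rewrite -(@ge0_integral_density _ _ _ _ _ mu D phi w mD mphi mw w0 m)//.
apply: eq_measure_integral => A mA _.
apply: lebesgue_measure_unique => // _ [[a b] _ <-]/=.
have [ab|ba] := ltP a b.
  by rewrite /nu wE// lebesgue_measure_itv/= lte_fin ab EFinB.
by rewrite set_itv_ge ?bnd_simp -?leNgt// nu0 measure0.
Qed.

(** * Substitutions on the line *)

Section substitutions.
Local Open Scope ereal_scope.
Context {R : realType}.
Local Notation M := (measurableTypeR R).
Local Notation mu := (@lebesgue_measure R).

Lemma ge0_integral_affine (a s : R) (f : M -> \bar R) : s != 0%R ->
  measurable_fun setT f -> (forall x, 0 <= f x) ->
  \int[mu]_x f x = `|s|%:E * \int[mu]_x f (a + s * x)%R.
Proof.
move=> s0 mf f0.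
have mphi : measurable_fun [set: M] (fun x : M => (a + s * x)%R : M).
  by apply: measurable_funD => //; exact: mulrl_measurable.
have mfphi : measurable_fun [set: M] (fun x : M => f (a + s * x)%R).
  exact: (measurableT_comp mf mphi).
rewrite (@ge0_integral_substitution _ M R mu setT (fun x => a + s * x)%R
  (fun=> `|s|%R))//; last first.
- move=> c d cd; rewrite setTI integral_cst//; last first.
    by rewrite -[X in measurable X]setTI; exact: mphi.
  have [sgt|] := ltP 0%R s.
    have -> : (fun x : M => a + s * x)%R @^-1` `]c, d] =
        `](c - a) / s, (d - a) / s]%classic%R.
      apply/seteqP; split => x /=; rewrite !in_itv/= ltr_pdivrMr// ler_pdivlMr//.
        by move=> /andP[? ?]; apply/andP; split; lra.
      by move=> /andP[? ?]; apply/andP; split; lra.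
    transitivity (`|s|%:E * mu `](c - a) / s, (d - a) / s]%classic%R); first by [].
  rewrite lebesgue_measure_itv/= lte_fin ltr_pM2r ?invr_gt0// ltrD2r cd.
    by rewrite -EFinB -EFinM gtr0_norm//; congr EFin; field.
  rewrite le_eqVlt (negbTE s0)/= => slt.
  have -> : (fun x : M => a + s * x)%R @^-1` `]c, d] =
      `[(d - a) / s, (c - a) / s[%classic%R.
    apply/seteqP; split => x /=; rewrite !in_itv/= ltr_ndivlMr// ler_ndivrMr//.
      by move=> /andP[? ?]; apply/andP; split; lra.
    by move=> /andP[? ?]; apply/andP; split; lra.
  transitivity (`|s|%:E * mu `[(d - a) / s, (c - a) / s[%classic%R); first by [].
  rewrite lebesgue_measure_itv/= lte_fin ltr_nM2r ?invr_lt0// ltrD2r cd.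
  by rewrite -EFinB -EFinM ltr0_norm//; congr EFin; field.
by rewrite ge0_integralZl.
Qed.

Lemma ge0_integral_shift (a : R) (f : M -> \bar R) :
  measurable_fun setT f -> (forall x, 0 <= f x) ->
  \int[mu]_x f (x + a)%R = \int[mu]_x f x.
Proof.
move=> mf f0; rewrite (@ge0_integral_affine a 1%R f)// ?oner_neq0//.
rewrite normr1 mul1e; apply: eq_integral => x _.
by rewrite mul1r addrC.
Qed.

Lemma ge0_integral_opp (a : R) (f : M -> \bar R) :
  measurable_fun setT f -> (forall x, 0 <= f x) ->
  \int[mu]_x f (a - x)%R = \int[mu]_x f x.
Proof.
move=> mf f0; rewrite (@ge0_integral_affine a (-1)%R f)// ?oppr_eq0 ?oner_neq0//.
rewrite normrN normr1 mul1e; apply: eq_integral => x _.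
by rewrite mulN1r.
Qed.

Let I : set M := `](- (pi / 2))%R, (pi / 2)%R[.

Let cosI_gt0 x : I x -> (0 < cos x)%R.
Proof. by rewrite /I/= in_itv/= => h; exact: cos_gt0_pihalf. Qed.

Lemma continuous_cosV2 (x : R) : cos x != 0%R ->
  {for x, continuous (fun x : R => cos x ^- 2)}.
Proof.
move=> cx; apply: continuousV; first by rewrite expf_neq0.
exact: (continuous_comp (@continuous_cos R x) (@exprn_continuous R 2 _)).
Qed.

(** On each interval the fundamental theorem of calculus applies, the weight
   being the derivative of the tangent. *)
Lemma ge0_integral_tan (g : M -> \bar R) :
  measurable_fun setT g -> (forall x, 0 <= g x) ->
  \int[mu]_x g x =
  \int[mu]_(x in `](- (pi / 2))%R, (pi / 2)%R[) ((cos x ^- 2)%:E * g (tan x)).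
Proof.
move=> mg g0; apply: ge0_integral_substitution => //.
- apply: open_continuous_measurable_fun; first exact: interval_open.
  by move=> x /[!inE] /cosI_gt0 cx; apply: continuous_tan; rewrite gt_eqF.
- apply: open_continuous_measurable_fun; first exact: interval_open.
  by move=> x /[!inE] /cosI_gt0 cx; apply: continuous_cosV2; rewrite gt_eqF.
- by move=> x _; rewrite invr_ge0 sqr_ge0.
move=> a b ab.
have subI x : x \in `[(atan a), (atan b)] -> I x.
  rewrite /I/= !in_itv/= => /andP[ax xb]; rewrite (lt_le_trans _ ax)//=.
    by rewrite (le_lt_trans xb) ?atan_ltpi2.
  exact: atan_gtNpi2.
have cos0 x : x \in `[(atan a), (atan b)] -> cos x != 0%R.
  by move=> /subI/cosI_gt0 cx; rewrite gt_eqF.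
have -> : `](- (pi / 2))%R, (pi / 2)%R[ `&` (@tan R) @^-1` `]a, b] =
    `](atan a), (atan b)]%classic :> set M.
  apply/seteqP; split => x /=; rewrite !in_itv/=.
    move=> [xI /andP[ax xb]]; apply/andP; split.
      by rewrite -ltr_tan ?atanK// in_itv/= ?atan_gtNpi2 ?atan_ltpi2.
    by rewrite leNgt -ltr_tan ?atanK -?leNgt// in_itv/= ?atan_gtNpi2 ?atan_ltpi2.
  move=> /andP[ax xb].
  have xI : I x by apply: subI; rewrite in_itv/= (ltW ax).
  split => //; apply/andP; split.
    by rewrite -[a]atanK ltr_tan ?in_itv/= ?atan_gtNpi2 ?atan_ltpi2.
  by rewrite -[b]atanK leNgt ltr_tan -?leNgt ?in_itv/= ?atan_gtNpi2 ?atan_ltpi2.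
have cf : {within `[(atan a), (atan b)], continuous (fun x : R => cos x ^- 2)%R}.
  apply: continuous_in_subspaceT => x /[!inE] xab.
  by apply: continuous_cosV2; exact: cos0.
rewrite integral_itv_obnd_cbnd; last first.
  apply/measurable_EFinP.
  apply: measurable_funS (subspace_continuous_measurable_fun _ cf) => //.
  by apply: subset_itvr; rewrite bnd_simp.
rewrite (@continuous_FTC2 _ _ (@tan R))//.
- by rewrite !atanK EFinB.
- by apply: lt_atan.
- split.
  + move=> x xab; apply: ex_derive; apply: is_derive_tan; apply: cos0.
    exact: subset_itv_oo_cc xab.
  + apply: cvg_at_right_filter; apply: continuous_tan; apply: cos0.
    by rewrite in_itv/= lexx ltW// lt_atan.
  + apply: cvg_at_left_filter; apply: continuous_tan; apply: cos0.
    by rewrite in_itv/= lexx ltW// lt_atan.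
- move=> x xab; rewrite derive1E; apply: derive_val; apply: is_derive_tan.
  by apply: cos0; exact: subset_itv_oo_cc xab.
Qed.

Lemma ge0_integral_atan (h : M -> \bar R) :
  measurable_fun setT h -> (forall x, 0 <= h x) ->
  \int[mu]_(x in `](- (pi / 2))%R, (pi / 2)%R[) h x =
  \int[mu]_x (((1 + x ^+ 2)^-1)%:E * h (atan x)).
Proof.
move=> mh h0.
have matan : measurable_fun [set: M] (@atan R : M -> M).
  by apply: continuous_measurable_fun => x; exact: continuous_atan.
have minv : measurable_fun [set: M] (fun x : M => (1 + x ^+ 2)^-1 : M)%R.
  apply: (@continuous_measurable_fun R (fun x : R => (1 + x ^+ 2)^-1)%R) => x.
  apply: (@continuousV _ _ (fun x : R => 1 + x ^+ 2)%R).
    by rewrite gt_eqF// ltr_pwDl// sqr_ge0.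
  by apply: continuousD; [exact: cst_continuous|exact: exprn_continuous].
rewrite (ge0_integral_tan (g := fun x => ((1 + x ^+ 2)^-1)%:E * h (atan x))).
- apply: eq_integral => x; rewrite inE => xI.
  rewrite tanK; last exact: xI.
  rewrite -cos2_tan2; last by rewrite gt_eqF// cosI_gt0.
  rewrite invrK muleA -EFinM mulVf ?mul1e//.
  by rewrite expf_neq0// gt_eqF// cosI_gt0.
- apply: emeasurable_funM; first exact/measurable_EFinP.
  exact: measurableT_comp.
- by move=> x; rewrite mule_ge0// lee_fin invr_ge0 addr_ge0// sqr_ge0.
Qed.

End substitutions.

(** * Integrals over rectangles and intervals *)

Section iterated.
Local Open Scope ereal_scope.
Context d1 d2 (T1 : measurableType d1) (T2 : measurableType d2) (R : realType).
Variable m1 : {sigma_finite_measure set T1 -> \bar R}.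
Variable m2 : {sigma_finite_measure set T2 -> \bar R}.
Variables (A : set T1) (B : set T2) (f : T1 * T2 -> \bar R).
Hypotheses (mA : measurable A) (mB : measurable B).
Hypotheses (mf : measurable_fun setT f) (f0 : forall z, 0 <= f z).

Lemma measurable_fun_integral_section :
  measurable_fun setT (fun x => \int[m2]_(y in B) f (x, y)).
Proof.
have := @measurable_fun_fubini_tonelli_F _ _ _ _ R m2 (f \_ (setT `*` B)).
rewrite /fubini_F.
have -> : (fun x => \int[m2]_y (f \_ (setT `*` B)) (x, y)) =
    (fun x => \int[m2]_(y in B) f (x, y)).
  apply/funext => x; rewrite [RHS]integral_mkcond; apply: eq_integral => y _.
  by rewrite !patchE in_setX in_setT.
apply; first by apply/(measurable_restrictT _ (measurableX _ _)); [exact: measurableT|exact: mB|exact: measurable_funTS].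
by move=> z; rewrite patchE; case: ifP.
Qed.

Lemma integral_setX :
  \int[m1 \x m2]_(z in A `*` B) f z = \int[m1]_(x in A) \int[m2]_(y in B) f (x, y).
Proof.
rewrite integral_mkcond fubini_tonelli1; last 2 first.
- by apply/(measurable_restrictT _ (measurableX mA mB)); exact: measurable_funTS.
- by move=> z; rewrite patchE; case: ifP.
rewrite [RHS]integral_mkcond; apply: eq_integral => x _.
rewrite /fubini_F [in RHS]patchE; case: ifPn => xA.
  rewrite [RHS]integral_mkcond; apply: eq_integral => y _.
  by rewrite !patchE in_setX xA.
by rewrite integral0_eq// => y _; rewrite patchE in_setX (negbTE xA).
Qed.

End iterated.

Lemma set_itvcc_congr (R : realType) (a b c d : R) : a = c -> b = d ->
  `[a, b]%classic = `[c, d]%classic.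
Proof. by move=> -> ->. Qed.

Section interval_substitutions.
Local Open Scope ereal_scope.
Context {R : realType}.
Local Notation M := (measurableTypeR R).
Local Notation mu := (@lebesgue_measure R).
Variable f : M -> \bar R.
Hypotheses (mf : measurable_fun setT f) (f0 : forall z, 0 <= f z).

Let mpatch (D : set M) : measurable D -> measurable_fun setT (f \_ D).
Proof. by move=> mD; apply/(measurable_restrictT _ mD); exact: measurable_funTS. Qed.

Let patch0 (D : set M) x : 0 <= (f \_ D) x.
Proof. by rewrite patchE; case: ifP. Qed.

Lemma ge0_integral_shift_in (D : set M) (a : R) : measurable D ->
  \int[mu]_(x in (fun x => x + a)%R @^-1` D) f (x + a)%R = \int[mu]_(x in D) f x.
Proof.
move=> mD; rewrite [RHS]integral_mkcond -(@ge0_integral_shift _ a)//; last exact: mpatch.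
by rewrite integral_mkcond.
Qed.

Lemma ge0_integral_opp_in (D : set M) (a : R) : measurable D ->
  \int[mu]_(x in (fun x => a - x)%R @^-1` D) f (a - x)%R = \int[mu]_(x in D) f x.
Proof.
move=> mD; rewrite [RHS]integral_mkcond -(@ge0_integral_opp _ a)//; last exact: mpatch.
by rewrite integral_mkcond.
Qed.

Lemma ge0_integral_oo_cc (a b : R) :
  \int[mu]_(x in `]a, b[) f x = \int[mu]_(x in `[a, b]) f x.
Proof. by apply/esym/integral_itv_bndoo; exact: measurable_funTS. Qed.

Lemma ge0_integral_oc_cc (a b : R) :
  \int[mu]_(x in `]a, b]) f x = \int[mu]_(x in `[a, b]) f x.
Proof. by apply: integral_itv_obnd_cbnd; exact: measurable_funTS. Qed.

Lemma ge0_integral_cat (a b c : R) : (a <= b)%R -> (b <= c)%R ->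
  \int[mu]_(x in `[a, c]) f x =
  \int[mu]_(x in `[a, b]) f x + \int[mu]_(x in `[b, c]) f x.
Proof.
move=> ab bc; rewrite -(ge0_integral_oc_cc b c) -ge0_integral_setU//.
- congr (integral _ _ _); apply/seteqP; split => x /=; rewrite !in_itv/=.
    by move=> /andP[-> ->]; rewrite andbT; have [] := leP x b; [left|right].
  move=> [/andP[-> xb]|/andP[bx ->]]; first by rewrite (le_trans xb).
  by rewrite (le_trans ab)// ltW.
- exact: measurable_funTS.
- apply/disj_setPS => x /=; rewrite !in_itv/= => -[/andP[_ xb] /andP[bx _]].
  by move: (lt_le_trans bx xb); rewrite ltxx.
Qed.

Lemma ge0_integral_shift_cc (a b c : R) :
  \int[mu]_(x in `[a, b]) f (x + c)%R = \int[mu]_(x in `[(a + c)%R, (b + c)%R]) f x.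
Proof.
rewrite -(@ge0_integral_shift_in _ c)//; congr (integral _ _ _).
by apply/seteqP; split => x /=; rewrite !in_itv/= !lerD2r.
Qed.

Lemma ge0_integral_opp_cc (a b c : R) :
  \int[mu]_(x in `[a, b]) f (c - x)%R = \int[mu]_(x in `[(c - b)%R, (c - a)%R]) f x.
Proof.
rewrite -(@ge0_integral_opp_in _ c)//; congr (integral _ _ _).
by apply/seteqP; split => x /=; rewrite !in_itv/= !lerD2l !lerN2 andbC.
Qed.

End interval_substitutions.

(** * The surface measure in longitude and latitude *)

Section sphere_integral.
Local Open Scope ereal_scope.
Context {R : realType}.
Local Notation M := (measurableTypeR R).
Local Notation mu := (@lebesgue_measure R).

(** Unit vector of longitude f and latitude p. The latitude, rather than the
   colatitude, makes the central projections below symmetric around 0. *)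
Definition lonlat (f p : R) : E3 R := (cos p * cos f, cos p * sin f, sin p)%R.

Definition antipodal_sum (g : E3 R -> \bar R) u := g u + g (- u)%R.

Lemma measurable_lonlat d (T : measurableType d) (f p : T -> M) :
  measurable_fun setT f -> measurable_fun setT p ->
  measurable_fun setT (fun x => lonlat (f x) (p x)).
Proof. move=> mf mp; rewrite /lonlat; mfun. Qed.

Lemma measurable_oppE3 : measurable_fun setT (fun u : E3 R => (- u)%R).
Proof.
have -> : (fun u : E3 R => (- u)%R) =
    (fun u : E3 R => ((- u.1.1)%R, (- u.1.2)%R, (- u.2)%R)) by [].
by mfun.
Qed.

Lemma integral_lebesgue2E (D : set (M * M)) (f : M * M -> \bar R) :
  \int[@lebesgue2 R]_(z in D) f z = \int[(mu \x mu)]_(z in D) f z.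
Proof. by []. Qed.

Lemma integral_lebesgue3E (D : set (E3 R)) (f : E3 R -> \bar R) :
  \int[@lebesgue3 R]_(z in D) f z = \int[(@lebesgue2 R \x mu)]_(z in D) f z.
Proof. by []. Qed.

Variable g : E3 R -> \bar R.
Hypotheses (mg : measurable_fun setT g) (g0 : forall z, 0 <= g z).

Lemma measurable_antipodal_sum : measurable_fun setT (antipodal_sum g).
Proof.
by apply: emeasurable_funD => //; exact: measurableT_comp measurable_oppE3.
Qed.

Lemma antipodal_sum_ge0 u : 0 <= antipodal_sum g u.
Proof. exact: adde_ge0. Qed.

Let J (f : M) : \bar R :=
  \int[mu]_(p in `[(- (pi / 2))%R, (pi / 2)%R]) ((`|cos p|)%:E * g (lonlat f p)).

Let mJ0 : measurable_fun setT
  (fun z : M * M => (`|cos z.2|)%:E * g (lonlat z.1 z.2)).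
Proof.
apply: emeasurable_funM; first by mfun.
by apply: (measurableT_comp mg); apply: measurable_lonlat; mfun.
Qed.

Let mJ : measurable_fun setT J.
Proof.
apply: (@measurable_fun_integral_section _ _ _ _ _ mu _ _ _ mJ0) => //.
by move=> z; rewrite mule_ge0.
Qed.

Let J0 f : 0 <= J f.
Proof. by apply: integral_ge0 => p _; rewrite mule_ge0. Qed.

Lemma integral_sphere_measure :
  \int[@sphere_measure R]_u g u = \int[mu]_(f in `[0%R, (2 * pi)%R]) J f.
Proof.
rewrite (@ge0_integral_density _ _ _ _ _ (@lebesgue2 R) (@sph_dom R) (@sph R)
  (fun z => `|sin z.2|)%R)//; last 4 first.
- exact: measurable_sph_dom.
- by apply: measurable_funTS; exact: measurable_sph.
- by apply: measurable_funTS; mfun.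
- move=> A mA; apply: eq_integral => z /[!inE] -[[_ /=]] + _.
  by rewrite in_itv/= => z2; rewrite ger0_norm// sin_ge0_pi.
rewrite integral_lebesgue2E /sph_dom.
rewrite (@integral_setX _ _ _ _ _ mu mu _ _
    (fun z => (`|sin z.2|)%:E * g (sph z))); last 4 first.
- exact: measurable_itv.
- exact: measurable_itv.
- apply: emeasurable_funM; first by mfun.
  by apply: (measurableT_comp mg); exact: measurable_sph.
- by move=> z; rewrite mule_ge0.
apply: eq_integral => f _; rewrite /J.
pose k (p : R) : \bar R := (`|sin p|)%:E * g (sph ((f : M), (p : M))).
have mk : measurable_fun [set: M] k.
  apply: emeasurable_funM; first by mfun.
  by apply: (measurableT_comp mg); rewrite /sph/=; mfun.
have k0 p : 0 <= k p by exact: mule_ge0.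
have -> : `[0%R, pi]%classic = `[pi / 2 - pi / 2, pi / 2 - - (pi / 2)]%classic%R :> set R.
  by apply: set_itvcc_congr; field.
rewrite -(@ge0_integral_opp_cc _ k mk k0).
apply: eq_integral => p _; rewrite /k /sph/= /lonlat.
have -> : sin (pi / 2 - p)%R = cos p by rewrite -cosBpihalf -[RHS]cosN; congr cos; ring.
by rewrite -[cos (_ - _)]cosN opprB cosBpihalf.
Qed.

Let Je (f : M) : \bar R :=
  \int[mu]_(p in `[(- (pi / 2))%R, (pi / 2)%R])
    ((`|cos p|)%:E * antipodal_sum g (lonlat f p)).

Let JDpi f : J f + J (f + pi)%R = Je f.
Proof.
pose k (p : R) : \bar R := (`|cos p|)%:E * g (lonlat (f + pi)%R p).
have mk : measurable_fun [set: M] k.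
  apply: emeasurable_funM; first by mfun.
  by apply: (measurableT_comp mg); apply: measurable_lonlat; mfun.
have k0 p : 0 <= k p by exact: mule_ge0.
have -> : J (f + pi)%R = \int[mu]_(p in `[(- (pi / 2))%R, (pi / 2)%R])
    ((`|cos p|)%:E * g (- lonlat f p)%R).
  rewrite /J.
  have itvE : `[(- (pi / 2))%R, (pi / 2)%R]%classic =
      `[0 - pi / 2, 0 - - (pi / 2)]%classic%R :> set R.
    by apply: set_itvcc_congr; ring.
  rewrite [in LHS]itvE.
  rewrite -(@ge0_integral_opp_cc _ k mk k0).
  apply: eq_integral => p _; rewrite /k sub0r cosN /lonlat cosN sinN.
  by rewrite (cosDpi f) (sinDpi f) !mulrN.
rewrite -ge0_integralD//.
- by apply: eq_integral => p _; rewrite -ge0_muleDr.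
- by move=> p _; rewrite mule_ge0.
- apply: measurable_funTS; apply: emeasurable_funM; first by mfun.
  by apply: (measurableT_comp mg); apply: measurable_lonlat; mfun.
- by move=> p _; rewrite mule_ge0.
- apply: measurable_funTS; apply: emeasurable_funM; first by mfun.
  apply: (measurableT_comp mg); apply: (measurableT_comp measurable_oppE3).
  by apply: measurable_lonlat; mfun.
Qed.

Let mJe0 : measurable_fun setT
  (fun z : M * M => (`|cos z.2|)%:E * antipodal_sum g (lonlat z.1 z.2)).
Proof.
apply: emeasurable_funM; first by mfun.
by apply: (measurableT_comp measurable_antipodal_sum); apply: measurable_lonlat; mfun.
Qed.

Let mJe : measurable_fun setT Je.
Proof.
apply: (@measurable_fun_integral_section _ _ _ _ _ mu _ _ _ mJe0) => //.
by move=> z; rewrite mule_ge0// antipodal_sum_ge0.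
Qed.

Let Je0 f : 0 <= Je f.
Proof. by apply: integral_ge0 => p _; rewrite mule_ge0// antipodal_sum_ge0. Qed.

Let JeDpi f : Je (f + pi)%R = Je f.
Proof.
rewrite -!JDpi addeC; congr (_ + _); apply: eq_integral => p _.
rewrite /lonlat; congr (_ * g _).
by rewrite (cosDpi (f + pi)%R) (sinDpi (f + pi)%R) (cosDpi f) (sinDpi f) !opprK.
Qed.

Let sphere0pi : \int[@sphere_measure R]_u g u = \int[mu]_(f in `[0%R, pi]) Je f.
Proof.
rewrite integral_sphere_measure (@ge0_integral_cat _ _ mJ J0 _ pi).
- rewrite -[X in `[X, (2 * pi)%R] ]add0r mulr_natl mulr2n -ge0_integral_shift_cc//.
  rewrite -ge0_integralD//.
  + by apply: eq_integral => f _; exact: JDpi.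
  + exact: measurable_funTS.
  + apply: measurable_funTS; apply: measurableT_comp => //.
    by mfun.
- exact: pi_ge0.
- by rewrite ler_peMl// ?pi_ge0// ler1n.
Qed.

(** The antipode of a point adds pi to the longitude and changes the sign of
   the latitude: half of the longitudes suffice when antipodes are grouped. *)
Lemma integral_sphere_halfturn :
  \int[@sphere_measure R]_u g u =
  \int[mu]_(f in `](- (pi / 2))%R, (pi / 2)%R[)
  \int[mu]_(p in `](- (pi / 2))%R, (pi / 2)%R[)
    ((`|cos p|)%:E * antipodal_sum g (lonlat f p)).
Proof.
rewrite sphere0pi.
transitivity (\int[mu]_(f in `](- (pi / 2))%R, (pi / 2)%R[) Je f); last first.
  apply: eq_integral => f _; rewrite ge0_integral_oo_cc//.
  - apply: emeasurable_funM; first by mfun.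
    by apply: (measurableT_comp measurable_antipodal_sum); apply: measurable_lonlat; mfun.
have pi0 := @pi_ge0 R.
rewrite ge0_integral_oo_cc// (@ge0_integral_cat _ _ mJe Je0 _ 0%R); [|lra|lra].
rewrite (@ge0_integral_cat _ _ mJe Je0 0%R (pi / 2)%R pi); [|lra|lra].
rewrite [RHS]addeC; congr (_ + _).
have -> : `[(pi / 2)%R, pi]%classic = `[- (pi / 2) + pi, 0 + pi]%classic%R :> set R.
  by apply: set_itvcc_congr; field.
rewrite -(@ge0_integral_shift_cc _ Je mJe Je0).
by apply: eq_integral => f _; rewrite JeDpi.
Qed.

(** The reflection exchanging x and y replaces the longitude f by pi / 2 - f. *)
Lemma integral_sphere_halfturn_swap :
  \int[@sphere_measure R]_u g u =
  \int[mu]_(f in `](- (pi / 2))%R, (pi / 2)%R[)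
  \int[mu]_(p in `](- (pi / 2))%R, (pi / 2)%R[)
    ((`|cos p|)%:E * antipodal_sum g (cos p * sin f, cos p * cos f, sin p)%R).
Proof.
rewrite sphere0pi.
have -> : `[0%R, pi]%classic = `[pi / 2 - pi / 2, pi / 2 - - (pi / 2)]%classic%R :> set R.
  by apply: set_itvcc_congr; field.
rewrite -(@ge0_integral_opp_cc _ Je mJe Je0) -(@ge0_integral_oo_cc _ (fun f => Je (pi / 2 - f)%R)); last first.
  by apply: (measurableT_comp mJe); mfun.
apply: eq_integral => f _; rewrite /Je -ge0_integral_oo_cc; last first.
  apply: emeasurable_funM; first by mfun.
  by apply: (measurableT_comp measurable_antipodal_sum); apply: measurable_lonlat; mfun.
apply: eq_integral => p _; rewrite /lonlat.
have -> : sin (pi / 2 - f)%R = cos f by rewrite -cosBpihalf -[RHS]cosN; congr cos; ring.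
by rewrite -[cos (_ - _)]cosN opprB cosBpihalf.
Qed.

End sphere_integral.

(** * Central projections of the sphere *)

Section gnomonic.
Local Open Scope ereal_scope.
Context {R : realType}.
Local Notation M := (measurableTypeR R).
Local Notation mu := (@lebesgue_measure R).

(** Length of the vectors (1, p, n) and (p, 1, n). *)
Definition hyp3 (p n : R) : R := Num.sqrt (1 + p ^+ 2 + n ^+ 2).

(** Jacobian of the central projection of the unit sphere on a plane at
   distance 1 from the centre. *)
Definition gnomonic_weight (p n : R) : R := (hyp3 p n ^- 3)%R.

Lemma hyp3_gt0 p n : (0 < hyp3 p n)%R.
Proof. by rewrite sqrtr_gt0 -addrA ltr_pwDl// addr_ge0// sqr_ge0. Qed.

Lemma hyp3_neq0 p n : hyp3 p n != 0%R.
Proof. by rewrite gt_eqF// hyp3_gt0. Qed.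

Lemma hyp3_sqr p n : (hyp3 p n ^+ 2 = 1 + p ^+ 2 + n ^+ 2)%R.
Proof. by rewrite sqr_sqrtr// !addr_ge0// sqr_ge0. Qed.

Lemma gnomonic_weight_ge0 p n : (0 <= gnomonic_weight p n)%R.
Proof. by rewrite invr_ge0 exprn_ge0// ltW// hyp3_gt0. Qed.

Lemma measurable_gnomonic_weight d (T : measurableType d) (p n : T -> M) :
  measurable_fun setT p -> measurable_fun setT n ->
  measurable_fun setT (fun x => gnomonic_weight (p x) (n x) : M).
Proof. by move=> mp mn; rewrite /gnomonic_weight /hyp3; mfun. Qed.

Definition gnomonic_x (p n : R) : E3 R :=
  ((hyp3 p n)^-1, (hyp3 p n)^-1 * p, (hyp3 p n)^-1 * n)%R.

Definition gnomonic_y (p n : R) : E3 R :=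
  ((hyp3 p n)^-1 * p, (hyp3 p n)^-1, (hyp3 p n)^-1 * n)%R.

Lemma sin_atan (x : R) : sin (atan x) = (cos (atan x) * x)%R.
Proof.
have c0 : cos (atan x) != 0%R.
  by rewrite gt_eqF// cos_gt0_pihalf// atan_gtNpi2 atan_ltpi2.
by rewrite -[X in (_ * X)%R](atanK x) /tan mulrC divfK.
Qed.

Lemma cos_atan_div (p n : R) :
  (cos (atan ((Num.sqrt (1 + p ^+ 2))^-1 * n)) =
   Num.sqrt (1 + p ^+ 2) / hyp3 p n)%R.
Proof.
set r := Num.sqrt _.
have r0 : (0 < r)%R by rewrite sqrtr_gt0 ltr_pwDl// sqr_ge0.
have r2 : (r ^+ 2 = 1 + p ^+ 2)%R by rewrite sqr_sqrtr// addr_ge0// sqr_ge0.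
have rN0 : r != 0%R by rewrite gt_eqF.
rewrite cos_atan.
have -> : (1 + (r^-1 * n) ^+ 2 = (hyp3 p n / r) ^+ 2)%R.
  rewrite [RHS]exprMn hyp3_sqr -r2; field.
  by rewrite rN0.
by rewrite sqrtr_sqr ger0_norm ?divr_ge0 ?ltW ?hyp3_gt0// invf_div.
Qed.

(** The point of longitude f and latitude q projects to (1, p, n) with
   p = tan f and n = tan q / cos f, so each coordinate is in turn a tangent, up
   to a factor. *)
Lemma integral_lonlat (G : E3 R -> \bar R) :
  measurable_fun setT G -> (forall z, 0 <= G z) ->
  \int[mu]_(f in `](- (pi / 2))%R, (pi / 2)%R[)
  \int[mu]_(p in `](- (pi / 2))%R, (pi / 2)%R[)
    ((`|cos p|)%:E * G (lonlat f p)) =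
  \int[mu]_p \int[mu]_n ((gnomonic_weight p n)%:E * G (gnomonic_x p n)).
Proof.
move=> mG G0.
pose H (z : M * M) : \bar R := ((1 + z.2 ^+ 2)^-1)%:E *
  ((`|cos (atan z.2)|)%:E * G (lonlat z.1 (atan z.2))).
have H0 z : 0 <= H z.
  by rewrite !mule_ge0// lee_fin invr_ge0 addr_ge0// sqr_ge0.
have mH : measurable_fun setT H.
  apply: emeasurable_funM; first by mfun.
  apply: emeasurable_funM; first by mfun.
  by apply: (measurableT_comp mG); apply: measurable_lonlat; mfun.
pose h (f : M) := \int[mu]_q H (f, q).
have mh : measurable_fun setT h.
  exact: (@measurable_fun_integral_section _ _ _ _ _ mu _ _ measurableT mH H0).
transitivity (\int[mu]_(f in `](- (pi / 2))%R, (pi / 2)%R[) h f).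
  apply: eq_integral => f _; rewrite ge0_integral_atan//.
  - apply: emeasurable_funM; first by mfun.
    by apply: (measurableT_comp mG); apply: measurable_lonlat; mfun.
  - by move=> x; rewrite mule_ge0.
rewrite ge0_integral_atan//; last by move=> x; apply: integral_ge0.
apply: eq_integral => p _; rewrite /h.
set r := Num.sqrt (1 + p ^+ 2)%R.
have r0 : (0 < r)%R by rewrite sqrtr_gt0 ltr_pwDl// sqr_ge0.
have r2 : (r ^+ 2 = 1 + p ^+ 2)%R by rewrite sqr_sqrtr// addr_ge0// sqr_ge0.
have rN0 : r != 0%R by rewrite gt_eqF.
have mHp : measurable_fun setT (fun q : M => H (atan p : M, q)).
  by apply: (measurableT_comp mH); mfun.
rewrite (@ge0_integral_affine _ 0%R r^-1%R) ?invr_eq0//.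
have mHa : measurable_fun setT (fun n : M => H (atan p : M, (0 + r^-1 * n)%R : M)).
  by apply: (measurableT_comp mH); mfun.
rewrite -ge0_integralZl ?lee_fin ?invr_ge0//.
rewrite -ge0_integralZl ?lee_fin ?invr_ge0 ?addr_ge0 ?sqr_ge0//; last 2 first.
- by apply: emeasurable_funM => //; mfun.
- by move=> n _; rewrite mule_ge0.
apply: eq_integral => n _; rewrite /H/= add0r cos_atan_div -/r.
rewrite !muleA -!EFinM; congr (_%:E * G _).
  rewrite ger0_norm ?invr_ge0 ?ltW// ger0_norm ?divr_ge0 ?ltW ?hyp3_gt0//.
  rewrite -r2 /gnomonic_weight.
  have -> : (1 + (r^-1 * n) ^+ 2 = (hyp3 p n / r) ^+ 2)%R.
    rewrite [RHS]exprMn hyp3_sqr -r2; field.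
    by rewrite rN0.
  by field; rewrite hyp3_neq0 rN0.
rewrite /lonlat /gnomonic_x !sin_atan cos_atan_div cos_atan -/r.
by congr (_, _, _); field; rewrite hyp3_neq0 rN0.
Qed.

Variable g : E3 R -> \bar R.
Hypotheses (mg : measurable_fun setT g) (g0 : forall z, 0 <= g z).

(** Central projection on the plane x = 1. The circle x = 0, which it misses, is
   a null set. *)
Lemma integral_gnomonic_x : \int[@sphere_measure R]_u g u =
  \int[mu]_p \int[mu]_n ((gnomonic_weight p n)%:E *
    (g (gnomonic_x p n) + g (- gnomonic_x p n)%R)).
Proof.
rewrite (integral_sphere_halfturn mg g0).
exact: (integral_lonlat (measurable_antipodal_sum mg) (antipodal_sum_ge0 g0)).
Qed.

(** Central projection on the plane y = 1. The normals of planes and the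
   directions of lines need different charts: a line of direction (p, 1, n)
   lies in a plane of normal (1, b, c) when p is an affine function of n. *)
Lemma integral_gnomonic_y : \int[@sphere_measure R]_u g u =
  \int[mu]_p \int[mu]_n ((gnomonic_weight p n)%:E *
    (g (gnomonic_y p n) + g (- gnomonic_y p n)%R)).
Proof.
rewrite (integral_sphere_halfturn_swap mg g0).
have mG : measurable_fun setT (fun u : E3 R => antipodal_sum g (u.1.2, u.1.1, u.2)).
  by apply: (measurableT_comp (measurable_antipodal_sum mg)); mfun.
exact: (integral_lonlat mG (fun u => antipodal_sum_ge0 g0 _)).
Qed.

End gnomonic.

(** * Linear changes of variables in the plane and in space *)

Section tonelli_curried.
Local Open Scope ereal_scope.
Context d1 d2 (T1 : measurableType d1) (T2 : measurableType d2) (R : realType).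
Variable m1 : {sigma_finite_measure set T1 -> \bar R}.
Variable m2 : {sigma_finite_measure set T2 -> \bar R}.
Variable f : T1 -> T2 -> \bar R.
Hypotheses (mf : measurable_fun setT (fun z : T1 * T2 => f z.1 z.2)).
Hypotheses (f0 : forall x y, 0 <= f x y).

Lemma measurable_fun_integral : measurable_fun setT (fun x => \int[m2]_y f x y).
Proof.
exact: (@measurable_fun_fubini_tonelli_F _ _ _ _ _ m2 _ mf (fun z => f0 z.1 z.2)).
Qed.

Lemma tonelli : \int[m1]_x \int[m2]_y f x y = \int[m2]_y \int[m1]_x f x y.
Proof.
exact: (@fubini_tonelli _ _ _ _ _ m1 m2 _ mf (fun z => f0 z.1 z.2)).
Qed.

Lemma tonelli_prod :
  \int[(m1 \x m2)]_z f z.1 z.2 = \int[m1]_x \int[m2]_y f x y.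
Proof.
exact: (@fubini_tonelli1 _ _ _ _ _ m1 m2 _ mf (fun z => f0 z.1 z.2)).
Qed.

End tonelli_curried.

Section integral_product.
Local Open Scope ereal_scope.
Context d1 d2 (T1 : measurableType d1) (T2 : measurableType d2) (R : realType).
Variable m1 : {measure set T1 -> \bar R}.
Variable m2 : {measure set T2 -> \bar R}.

Lemma integral_mul (f1 : T1 -> \bar R) (f2 : T2 -> \bar R) :
  measurable_fun setT f1 -> (forall x, 0 <= f1 x) ->
  measurable_fun setT f2 -> (forall x, 0 <= f2 x) ->
  (\int[m1]_x f1 x) * (\int[m2]_y f2 y) =
  \int[m1]_x \int[m2]_y (f1 x * f2 y).
Proof.
move=> mf1 f10 mf2 f20.
have I20 : 0 <= \int[m2]_y f2 y by exact: integral_ge0.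
rewrite -(@ge0_integralZr _ _ _ m1 _ measurableT _ mf1)//.
apply: eq_integral => x _.
by rewrite -(@ge0_integralZl _ _ _ m2 _ measurableT _ mf2).
Qed.

End integral_product.

Section shear.
Local Open Scope ereal_scope.
Context {R : realType}.
Local Notation M := (measurableTypeR R).
Local Notation mu := (@lebesgue_measure R).
Local Notation mu2 := (@lebesgue2 R).
Local Notation mu3 := (@lebesgue3 R).

Lemma tonelli_lebesgue2 (f : M -> M -> \bar R) :
  measurable_fun setT (fun z : M * M => f z.1 z.2) -> (forall x y, 0 <= f x y) ->
  \int[mu2]_z f z.1 z.2 = \int[mu]_x \int[mu]_y f x y.
Proof. by move=> mf f0; rewrite integral_lebesgue2E; apply: tonelli_prod. Qed.

Lemma tonelli_lebesgue3 (f : M -> M -> M -> \bar R) :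
  measurable_fun setT (fun z : E3 R => f z.1.1 z.1.2 z.2) ->
  (forall x y z, 0 <= f x y z) ->
  \int[mu3]_P f P.1.1 P.1.2 P.2 = \int[mu]_x \int[mu2]_w f x w.1 w.2.
Proof.
move=> mf f0; rewrite integral_lebesgue3E.
rewrite (@tonelli_prod _ _ _ _ _ mu2 mu (fun w z => f w.1 w.2 z))//.
rewrite (@tonelli_lebesgue2 (fun x y => \int[mu]_z f x y z)); last 2 first.
- apply: (@measurable_fun_integral _ _ _ _ _ mu (fun w : M * M => f w.1 w.2)) => //.
- by move=> x y; exact: integral_ge0.
apply: eq_integral => x _; rewrite (@tonelli_lebesgue2 (f x))//.
have mx : measurable_fun setT (fun w : M * M => (x, w.1, w.2) : E3 R) by mfun.
exact: (measurableT_comp mf mx).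
Qed.

Section shear_F.
Variable F : M * M -> \bar R.
Hypotheses (mF : measurable_fun setT F) (F0 : forall z, 0 <= F z).
Variables n1 n2 : R.
Hypothesis n12 : n1 != n2.

(** The substitution l = k + (n1 - n2) * y in one coordinate produces the
   Jacobian, and then k = z - n1 * y is a translation in the other one. *)
Lemma integral_shear : \int[mu2]_q F q =
  `|n1 - n2|%:E * \int[mu2]_w F (w.2 - n1 * w.1, w.2 - n2 * w.1)%R.
Proof.
transitivity (\int[mu]_k \int[mu]_l F (k, l)).
  rewrite -(@tonelli_lebesgue2 (fun k l => F (k, l)))//.
  - by apply: eq_integral => -[].
  - by apply: (measurableT_comp mF); mfun.
transitivity (\int[mu]_k (`|n1 - n2|%:E *
    \int[mu]_y F (k, (k + (n1 - n2) * y)%R))).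
  apply: eq_integral => k _.
  rewrite (@ge0_integral_affine _ k (n1 - n2)%R (fun l => F (k, l))) ?subr_eq0//.
  by apply: (measurableT_comp mF); mfun.
rewrite ge0_integralZl; last 4 first.
- exact: measurableT.
- apply: (@measurable_fun_integral _ _ _ _ _ mu
    (fun k y : M => F (k, (k + (n1 - n2) * y)%R : M))) => //.
  by apply: (measurableT_comp mF); mfun.
- by move=> k _; exact: integral_ge0.
- by [].
congr (_ * _).
rewrite (@tonelli_lebesgue2 (fun y z : M => F ((z - n1 * y)%R : M, (z - n2 * y)%R : M)))//;
  last by apply: (measurableT_comp mF); mfun.
rewrite (@tonelli _ _ _ _ _ mu mu (fun k y : M => F (k, (k + (n1 - n2) * y)%R : M)))//;
  last by apply: (measurableT_comp mF); mfun.
apply: eq_integral => y _.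
rewrite -(@ge0_integral_shift _ (- n1 * y)%R (fun k : M => F (k, (k + (n1 - n2) * y)%R : M)))//;
  last by apply: (measurableT_comp mF); mfun.
apply: eq_integral => z _; congr (F (_, _)); ring.
Qed.

Lemma integral_shear_opp : \int[mu2]_q F q =
  `|n1 - n2|%:E * \int[mu2]_b F (- b.1 - b.2 * n1, - b.1 - b.2 * n2)%R.
Proof.
rewrite integral_shear; congr (_ * _).
rewrite (@tonelli_lebesgue2 (fun y z : M => F ((z - n1 * y)%R : M, (z - n2 * y)%R : M)))//;
  last by apply: (measurableT_comp mF); mfun.
rewrite (@tonelli_lebesgue2 (fun b c : M => F ((- b - c * n1)%R : M, (- b - c * n2)%R : M)))//;
  last by apply: (measurableT_comp mF); mfun.
rewrite [RHS](@tonelli _ _ _ _ _ mu mu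
    (fun b c : M => F ((- b - c * n1)%R : M, (- b - c * n2)%R : M)))//;
  last by apply: (measurableT_comp mF); mfun.
apply: eq_integral => y _.
rewrite -(@ge0_integral_opp _ 0%R (fun z : M => F ((z - n1 * y)%R : M, (z - n2 * y)%R : M)))//;
  last by apply: (measurableT_comp mF); mfun.
by apply: eq_integral => z _; congr (F (_, _)); ring.
Qed.

End shear_F.

(** A plane and two lines in it, of slopes n1 and n2, are replaced by the common
   point P of the lines. *)
Lemma integral_shear3 (g1 g2 : M * M -> \bar R) (b c n1 n2 : R) :
  measurable_fun setT g1 -> (forall z, 0 <= g1 z) ->
  measurable_fun setT g2 -> (forall z, 0 <= g2 z) -> n1 != n2 ->
  \int[mu]_t ((\int[mu]_k g1 (t, k)) * (\int[mu]_k g2 (t, k))) =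
  `|n1 - n2|%:E * \int[mu3]_P
    (g1 (P.1.1 + b * P.1.2 + c * P.2, P.2 - n1 * P.1.2)%R *
     g2 (P.1.1 + b * P.1.2 + c * P.2, P.2 - n2 * P.1.2)%R).
Proof.
move=> mg1 g10 mg2 g20 n12.
have h0 u v : 0 <= g1 u * g2 v by exact: mule_ge0.
rewrite (@tonelli_lebesgue3 (fun x y z : M =>
  g1 ((x + b * y + c * z)%R : M, (z - n1 * y)%R : M) *
  g2 ((x + b * y + c * z)%R : M, (z - n2 * y)%R : M)))//; last first.
  by apply: emeasurable_funM;
    [apply: (measurableT_comp mg1)|apply: (measurableT_comp mg2)]; mfun.
transitivity (\int[mu]_t (`|n1 - n2|%:E * \int[mu2]_w
    (g1 (t, w.2 - n1 * w.1)%R * g2 (t, w.2 - n2 * w.1)%R))).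
  apply: eq_integral => t _.
  have m1 : measurable_fun setT (fun k : M => g1 (t, k)).
    by apply: (measurableT_comp mg1); mfun.
  have m2 : measurable_fun setT (fun k : M => g2 (t, k)).
    by apply: (measurableT_comp mg2); mfun.
  have mm : measurable_fun setT (fun q : M * M => g1 (t, q.1) * g2 (t, q.2)).
    by apply: emeasurable_funM;
      [apply: (measurableT_comp mg1)|apply: (measurableT_comp mg2)]; mfun.
  rewrite (integral_mul _ _ m1 _ m2)//.
  rewrite -(@tonelli_lebesgue2 (fun k l => g1 (t, k) * g2 (t, l)))//.
  by rewrite (@integral_shear (fun q => g1 (t, q.1) * g2 (t, q.2)) mm _ n1 n2).
have mtw : measurable_fun setT (fun z : M * (M * M) =>
    (g1 (z.1, z.2.2 - n1 * z.2.1)%R * g2 (z.1, z.2.2 - n2 * z.2.1)%R)).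
  by apply: emeasurable_funM;
    [apply: (measurableT_comp mg1)|apply: (measurableT_comp mg2)]; mfun.
rewrite ge0_integralZl; last 4 first.
- exact: measurableT.
- by apply: (@measurable_fun_integral _ _ _ _ _ mu2 (fun t w =>
    (g1 (t, w.2 - n1 * w.1)%R * g2 (t, w.2 - n2 * w.1)%R))).
- by move=> t _; exact: integral_ge0.
- by [].
apply: (congr1 (fun u => `|n1 - n2|%:E * u)).
rewrite (@tonelli _ _ _ _ _ mu mu2 (fun t w =>
    (g1 (t, w.2 - n1 * w.1)%R * g2 (t, w.2 - n2 * w.1)%R)) mtw (fun _ _ => h0 _ _)).
have mxw : measurable_fun setT (fun z : M * (M * M) =>
    g1 ((z.1 + b * z.2.1 + c * z.2.2)%R : M, (z.2.2 - n1 * z.2.1)%R : M) *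
    g2 ((z.1 + b * z.2.1 + c * z.2.2)%R : M, (z.2.2 - n2 * z.2.1)%R : M)).
  by apply: emeasurable_funM;
    [apply: (measurableT_comp mg1)|apply: (measurableT_comp mg2)]; mfun.
rewrite (@tonelli _ _ _ _ _ mu mu2 (fun x w =>
  g1 ((x + b * w.1 + c * w.2)%R : M, (w.2 - n1 * w.1)%R : M) *
  g2 ((x + b * w.1 + c * w.2)%R : M, (w.2 - n2 * w.1)%R : M)) mxw
  (fun _ _ => h0 _ _)).
apply: eq_integral => w _.
rewrite -(@ge0_integral_shift _ (b * w.1 + c * w.2)%R (fun t : M =>
    (g1 (t, w.2 - n1 * w.1)%R * g2 (t, w.2 - n2 * w.1)%R))); last 2 first.
- by apply: emeasurable_funM;
    [apply: (measurableT_comp mg1)|apply: (measurableT_comp mg2)]; mfun.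
- by move=> t; exact: h0.
by apply: eq_integral => x _; rewrite addrA.
Qed.

End shear.

(** * Pairs of lines sorted by plane and by common point *)

Section line_pairs.
Local Open Scope ereal_scope.
Context {R : realType}.
Local Notation M := (measurableTypeR R).
Local Notation mu := (@lebesgue_measure R).
Local Notation mu2 := (@lebesgue2 R).
Local Notation mu3 := (@lebesgue3 R).

Variable X : E3 R * (M * M) -> \bar R.
Hypotheses (mX : measurable_fun setT X) (X0 : forall z, 0 <= X z).
(** X (P, (p, n)) is a function of the line through P of direction (p, 1, n): P
   may be moved along it to the plane y = 0. *)
Hypothesis Xinv : forall x y z p n : R,
  X ((x - y * p, 0, z - y * n)%R, (p, n)) = X ((x, y, z), (p, n)).

(** Value of X on the line of height k and slope n of the plane
   x + b.1 * y + b.2 * z = c. *)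
Let L (b : M * M) (c n k : M) : \bar R :=
  X ((c - b.2 * k, 0, k)%R, ((- b.1 - b.2 * n)%R, n)).

Let Y (b : M * M) (c n : M) : \bar R := \int[mu]_k L b c n k.

Let A (t1 t2 : M * M) : \bar R := \int[mu3]_P (X (P, t1) * X (P, t2)).

Let L0 b c n k : 0 <= L b c n k. Proof. exact: X0. Qed.
Let Y0 b c n : 0 <= Y b c n. Proof. exact: integral_ge0. Qed.
Let XX0 P t1 t2 : 0 <= X (P, t1) * X (P, t2). Proof. exact: mule_ge0. Qed.
Let A0 t1 t2 : 0 <= A t1 t2. Proof. exact: integral_ge0. Qed.
Let YY0 b c n1 n2 : 0 <= Y b c n1 * Y b c n2. Proof. exact: mule_ge0. Qed.

Let mL d (T : measurableType d) (b : T -> M * M) (c n k : T -> M) :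
  measurable_fun setT b -> measurable_fun setT c -> measurable_fun setT n ->
  measurable_fun setT k -> measurable_fun setT (fun z => L (b z) (c z) (n z) (k z)).
Proof. by move=> mb mc mn mk; apply: (measurableT_comp mX); mfun. Qed.

Let mY d (T : measurableType d) (b : T -> M * M) (c n : T -> M) :
  measurable_fun setT b -> measurable_fun setT c -> measurable_fun setT n ->
  measurable_fun setT (fun z => Y (b z) (c z) (n z)).
Proof.
move=> mb mc mn.
apply: (@measurable_fun_integral _ _ _ _ _ mu (fun z k => L (b z) (c z) (n z) k)).
- by apply: mL; [apply: (measurableT_comp mb)|apply: (measurableT_comp mc)
    |apply: (measurableT_comp mn)|]; mfun.
- by move=> z k; exact: L0.
Qed.

Let mYY d (T : measurableType d) (b : T -> M * M) (c n1 n2 : T -> M) :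
  measurable_fun setT b -> measurable_fun setT c -> measurable_fun setT n1 ->
  measurable_fun setT n2 ->
  measurable_fun setT (fun z => Y (b z) (c z) (n1 z) * Y (b z) (c z) (n2 z)).
Proof. by move=> mb mc m1 m2; apply: emeasurable_funM; exact: mY. Qed.

Let mXX d (T : measurableType d) (P : T -> E3 R) (t1 t2 : T -> M * M) :
  measurable_fun setT P -> measurable_fun setT t1 -> measurable_fun setT t2 ->
  measurable_fun setT (fun z => X (P z, t1 z) * X (P z, t2 z)).
Proof.
by move=> mP m1 m2; apply: emeasurable_funM; apply: (measurableT_comp mX); mfun.
Qed.

Let mA d (T : measurableType d) (t1 t2 : T -> M * M) :
  measurable_fun setT t1 -> measurable_fun setT t2 ->
  measurable_fun setT (fun z => A (t1 z) (t2 z)).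
Proof.
move=> m1 m2.
apply: (@measurable_fun_integral _ _ _ _ _ mu3 (fun z P => X (P, t1 z) * X (P, t2 z))).
- by apply: mXX; [|apply: (measurableT_comp m1)|apply: (measurableT_comp m2)]; mfun.
- by move=> z P; exact: XX0.
Qed.

(** For given slopes of the plane and of two lines in it, the level of the plane
   and the heights of the lines are linear coordinates of the common point. *)
Let integral_LL (b : M * M) (n1 n2 : R) : n1 != n2 ->
  \int[mu]_c (Y b c n1 * Y b c n2) =
  `|n1 - n2|%:E * A ((- b.1 - b.2 * n1)%R, n1) ((- b.1 - b.2 * n2)%R, n2).
Proof.
move=> n12; pose g n (z : M * M) := L b z.1 n z.2.
have mg n : measurable_fun setT (g n) by apply: mL; mfun.
have g0 n z : 0 <= g n z by exact: L0.
rewrite [LHS](@integral_shear3 _ (g n1) (g n2) b.1 b.2 n1 n2 (mg n1) (g0 n1) (mg n2)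
  (g0 n2) n12).
apply: (congr1 (fun u => `|n1 - n2|%:E * u)).
apply: eq_integral => -[[x y] z] _; rewrite /g/= /L.
by congr (_ * _); rewrite -[RHS]Xinv; congr (X ((_, _, _), _)); ring.
Qed.

(** The Jacobian of the previous change of variables is that of the passage from
   the slopes of the plane to the directions of the lines. *)
Let integral_bLL (n1 n2 : R) : n1 != n2 ->
  \int[mu2]_b \int[mu]_c (Y b c n1 * Y b c n2) =
  \int[mu2]_q A (q.1, n1) (q.2, n2).
Proof.
move=> n12.
transitivity (\int[mu2]_b (`|n1 - n2|%:E *
    A ((- b.1 - b.2 * n1)%R, n1) ((- b.1 - b.2 * n2)%R, n2))).
  by apply: eq_integral => b _; exact: integral_LL.
rewrite (@integral_shear_opp _ (fun q => A (q.1, n1) (q.2, n2)) _ _ n1 n2)//.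
- rewrite ge0_integralZl//.
  by apply: mA; mfun.
- by apply: mA; mfun.
Qed.

Let lhs_pairs :
  \int[mu2]_b \int[mu]_c (\int[mu]_n Y b c n) ^+ 2 =
  \int[mu]_n1 \int[mu]_n2 \int[mu2]_q A (q.1, n1) (q.2, n2).
Proof.
transitivity (\int[mu2]_b \int[mu]_c \int[mu2]_a (Y b c a.1 * Y b c a.2)).
  apply: eq_integral => b _; apply: eq_integral => c _.
  have mYn : measurable_fun setT (fun n => Y b c n) by apply: mY; mfun.
  rewrite expe2 (@integral_mul _ _ _ _ _ mu mu _ _ mYn (Y0 b c) mYn (Y0 b c)).
  rewrite (@tonelli_lebesgue2 _ (fun n1 n2 => Y b c n1 * Y b c n2))//.
  by apply: mYY; mfun.
transitivity (\int[mu2]_b \int[mu2]_a \int[mu]_c (Y b c a.1 * Y b c a.2)).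
  apply: eq_integral => b _.
  by apply: tonelli => [|c a]; [apply: mYY; mfun|exact: YY0].
have mYYc : measurable_fun setT
    (fun z : (M * M) * (M * M) => \int[mu]_c (Y z.1 c z.2.1 * Y z.1 c z.2.2)).
  apply: (@measurable_fun_integral _ _ _ _ _ mu
    (fun (z : (M * M) * (M * M)) c => Y z.1 c z.2.1 * Y z.1 c z.2.2)).
    by apply: mYY; mfun.
  by move=> z c; exact: YY0.
have YYc0 b a1 a2 : 0 <= \int[mu]_c (Y b c a1 * Y b c a2).
  by apply: integral_ge0 => c _; exact: YY0.
transitivity (\int[mu2]_a \int[mu2]_b \int[mu]_c (Y b c a.1 * Y b c a.2)).
  by apply: (@tonelli _ _ _ _ _ mu2 mu2 (fun b a =>
    \int[mu]_c (Y b c a.1 * Y b c a.2)) mYYc (fun b a => YYc0 b a.1 a.2)).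
have mB : measurable_fun setT (fun a : M * M =>
    \int[mu2]_b \int[mu]_c (Y b c a.1 * Y b c a.2)).
  apply: (@measurable_fun_integral _ _ _ _ _ mu2 (fun a b =>
    \int[mu]_c (Y b c a.1 * Y b c a.2))).
    apply: (@measurable_fun_integral _ _ _ _ _ mu
      (fun (z : (M * M) * (M * M)) c => Y z.2 c z.1.1 * Y z.2 c z.1.2)).
      by apply: mYY; mfun.
    by move=> z c; exact: YY0.
  by move=> a b; exact: YYc0.
have mA3 : measurable_fun setT
    (fun z : M * M => \int[mu2]_q A (q.1, z.1) (q.2, z.2)).
  apply: (@measurable_fun_integral _ _ _ _ _ mu2 (fun (z : M * M) q =>
    A (q.1, z.1) (q.2, z.2))) => //.
  by apply: mA; mfun.
rewrite (@tonelli_lebesgue2 _ (fun n1 n2 =>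
  \int[mu2]_b \int[mu]_c (Y b c n1 * Y b c n2))); last 2 first.
- exact: mB.
- by move=> n1 n2; apply: integral_ge0 => b _; exact: YYc0.
apply: eq_integral => n1 _.
have mp : measurable_fun setT (fun n2 : M => (n1, n2) : M * M) by mfun.
(* parallel lines, n2 = n1, form a null set *)
rewrite -[LHS](@integral_setD1 R _ n1); last 2 first.
- by apply: measurableD; [exact: measurableT|exact: measurable_set1].
- by apply: measurable_funTS; exact: (measurableT_comp mB mp).
rewrite -[RHS](@integral_setD1 R _ n1); last 2 first.
- by apply: measurableD; [exact: measurableT|exact: measurable_set1].
- by apply: measurable_funTS; exact: (measurableT_comp mA3 mp).
apply: eq_integral => n2 /[!inE] -[_ /eqP n21].
by apply: integral_bLL; rewrite eq_sym.
Qed.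

Let rhs_pairs :
  \int[mu3]_P (\int[mu]_p \int[mu]_n X (P, (p, n))) ^+ 2 =
  \int[mu]_n1 \int[mu]_n2 \int[mu2]_q A (q.1, n1) (q.2, n2).
Proof.
transitivity (\int[mu3]_P \int[mu2]_t1 \int[mu2]_t2 (X (P, t1) * X (P, t2))).
  apply: eq_integral => P _.
  have mXP : measurable_fun setT (fun t => X (P, t)).
    by apply: (measurableT_comp mX); mfun.
  rewrite -(@tonelli_lebesgue2 _ (fun p n => X (P, (p, n)))); last 2 first.
  - by apply: (measurableT_comp mX); mfun.
  - by move=> p n; exact: X0.
  transitivity ((\int[mu2]_t X (P, t)) ^+ 2).
    by congr (_ ^+ 2); apply: eq_integral => -[].
  by rewrite expe2 integral_mul.
have mXXt : measurable_fun setT (fun z : E3 R * (M * M) =>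
    \int[mu2]_t2 (X (z.1, z.2) * X (z.1, t2))).
  apply: (@measurable_fun_integral _ _ _ _ _ mu2
    (fun (z : E3 R * (M * M)) t2 => X (z.1, z.2) * X (z.1, t2))).
    by apply: mXX; mfun.
  by move=> z t2; exact: XX0.
transitivity (\int[mu2]_t1 \int[mu2]_t2 A t1 t2).
  rewrite (@tonelli _ _ _ _ _ mu3 mu2 (fun P t1 =>
    \int[mu2]_t2 (X (P, t1) * X (P, t2))) mXXt); last first.
    by move=> P t1; apply: integral_ge0 => t2 _; exact: XX0.
  apply: eq_integral => t1 _.
  rewrite (@tonelli _ _ _ _ _ mu3 mu2 (fun P t2 => X (P, t1) * X (P, t2))) => [//||].
    by apply: mXX; mfun.
  by move=> P t2; exact: XX0.
have mAt : measurable_fun setT (fun z : M * M => \int[mu2]_t2 A (z.1, z.2) t2).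
  apply: (@measurable_fun_integral _ _ _ _ _ mu2
    (fun (z : M * M) t2 => A (z.1, z.2) t2)) => [|z t2]; last exact: A0.
  by apply: mA; mfun.
have At0 t : 0 <= \int[mu2]_t2 A t t2 by apply: integral_ge0 => t2 _; exact: A0.
transitivity (\int[mu]_p1 \int[mu]_n1 \int[mu2]_t2 A (p1, n1) t2).
  rewrite -(@tonelli_lebesgue2 _ (fun p1 n1 => \int[mu2]_t2 A (p1, n1) t2) mAt (fun _ _ => At0 _)).
  by apply: eq_integral => -[].
rewrite [LHS](@tonelli _ _ _ _ _ mu mu (fun p1 n1 => \int[mu2]_t2 A (p1, n1) t2) mAt
  (fun _ _ => At0 _)).
apply: eq_integral => n1 _.
have mAp : measurable_fun setT
    (fun z : M * M => \int[mu]_p2 A (z.1, n1 : M) (p2, z.2)).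
  apply: (@measurable_fun_integral _ _ _ _ _ mu
    (fun (z : M * M) p2 => A (z.1, n1 : M) (p2, z.2))) => [|z p2]; last exact: A0.
  by apply: mA; mfun.
transitivity (\int[mu]_p1 \int[mu]_n2 \int[mu]_p2 A (p1, n1) (p2, n2)).
  apply: eq_integral => p1 _.
  rewrite -(@tonelli _ _ _ _ _ mu mu (fun p2 n2 => A (p1, n1) (p2, n2)));
    last 2 first.
  - by apply: mA; mfun.
  - by move=> p2 n2; exact: A0.
  rewrite -(@tonelli_lebesgue2 _ (fun p2 n2 => A (p1, n1) (p2, n2))); last 2 first.
  - by apply: mA; mfun.
  - by move=> p2 n2; exact: A0.
  by apply: eq_integral => -[].
rewrite [LHS](@tonelli _ _ _ _ _ mu mu (fun p1 n2 =>
  \int[mu]_p2 A (p1, n1) (p2, n2)) mAp); last first.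
  by move=> p1 n2; apply: integral_ge0 => p2 _; exact: A0.
apply: eq_integral => n2 _.
apply/esym; apply: (@tonelli_lebesgue2 _ (fun p1 p2 => A (p1, n1) (p2, n2))).
  by apply: mA; mfun.
by move=> p1 p2; exact: A0.
Qed.

(** Both sides are the same integral over n1, n2 and the directions p1, p2. *)
Lemma integral_line_pairs :
  \int[mu2]_b \int[mu]_c (\int[mu]_n \int[mu]_k
    X ((c - b.2 * k, 0, k)%R, ((- b.1 - b.2 * n)%R, n))) ^+ 2 =
  \int[mu3]_P (\int[mu]_p \int[mu]_n X (P, (p, n))) ^+ 2.
Proof. by rewrite rhs_pairs -lhs_pairs. Qed.

End line_pairs.

(** * Parameters for which a curve meets a closed set *)

Lemma continuous_E3 (R : realType) (T : topologicalType) (x : T) (f g h : T -> R) :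
  {for x, continuous f} -> {for x, continuous g} -> {for x, continuous h} ->
  {for x, continuous ((fun y => (f y, g y, h y)) : T -> E3 R)}.
Proof.
move=> cf cg ch.
have cfg : {for x, continuous (fun y => (f y, g y))} by exact: cvg_pair cf cg.
exact: (cvg_pair cfg ch).
Qed.

Section measurable_meets.
Context {R : realType}.
Local Notation M := (measurableTypeR R).

Lemma ball_E3 (x y : E3 R) (e : R) : ball x e y =
  (`|x.1.1 - y.1.1| < e /\ `|x.1.2 - y.1.2| < e /\ `|x.2 - y.2| < e).
Proof.
by apply/propext; split => [[[? ?] ?]|[? [? ?]]].
Qed.

Lemma measurable_ball_E3 (x : E3 R) (e : R) : measurable (ball x e).
Proof.
have -> : ball x e = (ball x.1.1 e `*` ball x.1.2 e) `*` ball x.2 e.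
  by apply/seteqP; split => [y|y] [[? ?] ?].
by apply: measurableX; [apply: measurableX|]; exact: measurable_ball.
Qed.

(** An open set is a countable union of rational cubes. *)
Lemma open_measurable_E3 (U : set (E3 R)) : open U -> measurable U.
Proof.
move=> oU.
pose b4 (r a b c : rat) : set (E3 R) :=
  ball ((ratr a, ratr b, ratr c) : E3 R) (ratr r : R).
pose B (r a b c : rat) := [set x | b4 r a b c x /\ b4 r a b c `<=` U].
have -> : U = \bigcup_r \bigcup_a \bigcup_b \bigcup_c B r a b c.
  apply/seteqP; split => [x Ux|x [r _ [a _ [b _ [c _ [Bx BU]]]]]]; last exact: BU.
  have /nbhs_ballP[e /= e0 eU] : nbhs x U by exact: open_nbhs_nbhs.
  have /rat_in_itvoo[r /[!in_itv]/= /andP[r0 re]] : 0 < e / 2 by rewrite divr_gt0.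
  have rat_near (y : R) : exists a, `|ratr a - y| < ratr r.
    have /rat_in_itvoo[a /[!in_itv]/= /andP[ya ay]] : y < y + ratr r by rewrite ltrDl.
    by exists a; rewrite ger0_norm ?subr_ge0 ?ltW//; lra.
  have [a ha] := rat_near x.1.1; have [b hb] := rat_near x.1.2.
  have [c hc] := rat_near x.2.
  exists r => //; exists a => //; exists b => //; exists c => //.
  have xB : b4 r a b c x by rewrite /b4 ball_E3.
  split=> // y yB; apply: eU.
  have := ball_triangle (ball_sym xB) yB; apply: le_ball.
  lra.
apply: bigcupT_measurable_rat => r; apply: bigcupT_measurable_rat => a.
apply: bigcupT_measurable_rat => b; apply: bigcupT_measurable_rat => c.
have [BU|BU] := pselect (b4 r a b c `<=` U).
  rewrite (_ : B _ _ _ _ = b4 r a b c); first exact: measurable_ball_E3.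
  by apply/seteqP; split => [y []//|y yB]; split.
rewrite (_ : B _ _ _ _ = set0); first exact: measurable0.
by apply/seteqP; split => [y []//|y yB].
Qed.

Lemma closed_measurable_E3 (K : set (E3 R)) : closed K -> measurable K.
Proof.
move=> cK; rewrite -(setCK K); apply: measurableC; apply: open_measurable_E3.
exact: closed_openC.
Qed.

(** Clamping the rational times keeps them in [a, b] without losing its ends. *)
Let clamp (a b y : R) : R := Num.max a (Num.min b y).

(** On a compact interval, a path meets K if and only if for every n it comes
   within 1 / n.+1 of K, and by continuity it does so at a rational time: this
   makes the set of parameters a countable combination of measurable ones. *)
Lemma measurable_meets_itv d (T : measurableType d) (K : set (E3 R))
    (q : T -> R -> E3 R) (a b : R) : closed K -> a <= b ->
  (forall y, measurable_fun setT (q^~ y)) -> (forall t, continuous (q t)) ->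
  measurable [set t | exists y, a <= y <= b /\ K (q t y)].
Proof.
move=> cK ab mq cq.
pose U n := \bigcup_(k in K) ball k (n.+1%:R^-1 : R).
have oU n : open (U n).
  by apply: bigcup_open => k _; apply: ball_open; rewrite invr_gt0.
have clampE y : a <= y <= b -> clamp a b y = y.
  by move=> /andP[ay yb]; rewrite /clamp min_r// max_r.
have clamp_itv y : a <= clamp a b y <= b.
  by rewrite /clamp le_max lexx/= ge_max ab ge_min lexx.
have cclamp : continuous (clamp a b).
  move=> y; apply: (@continuous_max _ _ (cst a) (fun y => Num.min b y)).
    exact: cst_continuous.
  by apply: (@continuous_min _ _ (cst b) id); [exact: cst_continuous|].
rewrite (_ : [set _ | _] =
    \bigcap_n \bigcup_r [set t | U n (q t (clamp a b (ratr r)))]).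
  apply: bigcapT_measurable => n; apply: bigcupT_measurable_rat => r.
  by rewrite -[X in measurable X]setTI; apply: mq => //; exact: open_measurable_E3.
apply/seteqP; split => t /=.
  move=> [y [yab Ky]] n _.
  have cc : continuous (q t \o clamp a b).
    by move=> z; apply: continuous_comp; [exact: cclamp|exact: cq].
  have oV : open ((q t \o clamp a b) @^-1` U n).
    by apply: open_comp => // z _; exact: cc.
  have Vy : ((q t \o clamp a b) @^-1` U n) y.
    by exists (q t y) => //=; rewrite clampE//; apply: ballxx; rewrite invr_gt0.
  have [z [Vz [r _ rz]]] := @dense_rat R _ (ex_intro _ y Vy) oV.
  by exists r => //=; rewrite rz.
move=> h.
have {}h n : exists y, a <= y <= b /\ U n (q t y).
  by have [r _ Ur] := h n I; exists (clamp a b (ratr r)); split.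
have /choice[y_ y_h] := h.
have cab := @segment_compact R a b.
have [y [yab cy]] : exists y, `[a, b]%classic y /\ cluster (y_ @ \oo) y.
  have [] := cab (y_ @ \oo) _.
    by exists 0%N => // n _ /=; rewrite in_itv/=; exact: (y_h n).1.
  by move=> y [? ?]; exists y.
exists y; split; first by move: yab; rewrite /= in_itv.
apply: contrapT => nK.
have /nbhs_ballP[e /= e0 eK] : nbhs (q t y) (~` K).
  by apply: open_nbhs_nbhs; split => //; exact: closed_openC.
have e20 : 0 < e / 2 by rewrite divr_gt0.
have Vy : nbhs y (q t @^-1` ball (q t y) (e / 2)) by apply: cq; exact: nbhsx_ballx.
have [N _ NE] : \forall n \near \oo, (n.+1%:R^-1 : R) < e / 2.
  exact: near_infty_natSinv_lt (PosNum e20).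
have tail : (y_ @ \oo) (y_ @` [set n | (N <= n)%N]).
  by exists N => // n Nn; exists n.
have [_ [[n Nn <-] Vn]] := cy _ _ tail Vy.
have [_ [k Kk kq]] := y_h n.
apply: (eK k) => //.
have := ball_triangle Vn (ball_sym kq); apply: le_ball.
by have := NE n Nn => /=; set v := _^-1; lra.
Qed.

Lemma measurable_meets d (T : measurableType d) (K : set (E3 R))
    (q : T -> R -> E3 R) : closed K ->
  (forall y, measurable_fun setT (q^~ y)) -> (forall t, continuous (q t)) ->
  measurable [set t | exists y, K (q t y)].
Proof.
move=> cK mq cq.
rewrite (_ : [set _ | _] =
  \bigcup_n [set t | exists y, (- n%:R) <= y <= n%:R /\ K (q t y)]).
  apply: bigcupT_measurable => n; apply: measurable_meets_itv => //.
  by rewrite -subr_ge0 opprK addr_ge0.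
apply/seteqP; split => t /= => [[y Ky]|[n _ [y [_ Ky]]]]; last by exists y.
exists (Num.truncn `|y|).+1 => //; exists y; split => //.
rewrite -ler_norml ltW// truncnS_gt//.
Qed.

Lemma measurable_meets_ray d (T : measurableType d) (K : set (E3 R))
    (q : T -> R -> E3 R) : closed K ->
  (forall y, measurable_fun setT (q^~ y)) -> (forall t, continuous (q t)) ->
  measurable [set t | exists2 y, 0 <= y & K (q t y)].
Proof.
move=> cK mq cq.
rewrite (_ : [set _ | _] =
  \bigcup_n [set t | exists y, 0 <= y <= n%:R /\ K (q t y)]).
  by apply: bigcupT_measurable => n; exact: measurable_meets_itv.
apply/seteqP; split => t /= => [[y y0 Ky]|[n _ [y [/andP[y0 _] Ky]]]].
  exists (Num.truncn `|y|).+1 => //; exists y; split => //.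
  by rewrite y0/= (le_trans (ler_norm _))// ltW// truncnS_gt.
by exists y.
Qed.

End measurable_meets.

(** * The length of a segment as an integral over directions *)

Section segment_integral.
Context {R : realType}.
Local Notation M := (measurableTypeR R).
Local Notation mu := (@lebesgue_measure R).

(** Orthogonal projection of the vector (e1, e2, e3) on the direction (p, 1, n),
   both in the vector plane x + b * y + c * z = 0. Turning the direction by an
   angle changes this projection at a rate equal to the distance of the vector
   to the direction, so Phi is a primitive of the integrand below; Lim is its
   limit when n tends to infinity. *)
Let Phi (b c e2 e3 n : R) : R :=
  (((- b - c * n) * (- b * e2 - c * e3) + e2 + n * e3) / hyp3 (- b - c * n) n).

Let Lim (b c e2 e3 : R) : R :=
  (- c * (- b * e2 - c * e3) + e3) / Num.sqrt (1 + c ^+ 2).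

(** The angle of the direction (- b - c * n, 1, n) in the plane has density
   s / W ^ 2 in n, where W is the length of this vector and s that of
   (1, b, c), and lines of this direction whose heights differ by h are at
   distance h * s / W. The product s ^ 2 / W ^ 3 is the density in n and k of
   the invariant measure on the lines of the plane. *)
Definition chord_density (b c n : R) : R :=
  (1 + b ^+ 2 + c ^+ 2) * gnomonic_weight (- b - c * n) n.

Lemma chord_density_ge0 b c n : 0 <= chord_density b c n.
Proof.
by rewrite mulr_ge0 ?gnomonic_weight_ge0// !addr_ge0// sqr_ge0.
Qed.

Let is_derive_Phi (b c e2 e3 n : R) : is_derive n 1 (Phi b c e2 e3)
  (chord_density b c n * (e3 - n * e2)).
Proof.
have Q0 := hyp3_gt0 (- b - c * n) n.
pose Q (n : R) : R := 1 + (- b - c * n) ^+ 2 + n ^+ 2.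
have Qn : 0 < Q n by move: Q0; rewrite sqrtr_gt0.
have dp : is_derive n (1 : R) (fun n => - b - c * n) (- c).
  by apply: is_derive_eq; rewrite /GRing.scale/=; ring.
have dQ : is_derive n (1 : R) Q (2 * (c * (b + c * n) + n)).
  rewrite /Q; apply: is_derive_eq; rewrite /GRing.scale/=; ring.
have dS : is_derive n (1 : R) (fun n => Num.sqrt (Q n))
    ((2 * Num.sqrt (Q n))^-1 * (2 * (c * (b + c * n) + n))).
  exact: (@is_derive1_comp _ Num.sqrt Q n _ _ (is_derive1_sqrt Qn) dQ).
have SN0 : Num.sqrt (Q n) != 0 by rewrite gt_eqF.
have dSV := @is_deriveV _ (fun n => Num.sqrt (Q n)) n _ 1 SN0 dS.
have dN : is_derive n (1 : R) (fun n => (- b - c * n) * (- b * e2 - c * e3) + e2 + n * e3)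
    (- c * (- b * e2 - c * e3) + e3).
  apply: is_derive_eq; rewrite /GRing.scale/=; ring.
have H := is_deriveM dN dSV. refine (is_derive_eq (f := Phi b c e2 e3) H _).
rewrite /GRing.scale/= /chord_density /gnomonic_weight.
have S2 : hyp3 (- b - c * n) n ^+ 2 = Q n by rewrite hyp3_sqr.
have -> : Num.sqrt (Q n) = hyp3 (- b - c * n) n by [].
set S := hyp3 _ _ in S2 SN0 *.
have SN : S != 0 by rewrite gt_eqF.
pose N := (- b - c * n) * (- b * e2 - c * e3) + e2 + n * e3.
pose N' := - c * (- b * e2 - c * e3) + e3.
transitivity (S ^- 3 * (S ^+ 2 * N' - N * (c * (b + c * n) + n))).
  by rewrite /N /N'; field.
by rewrite S2 /N /N' /Q; ring.
Qed.

Let cvgy_Phi (b c e2 e3 : R) : Phi b c e2 e3 x @[x --> +oo] --> Lim b c e2 e3.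
Proof.
pose g (t : R) : R := ((- b * t - c) * (- b * e2 - c * e3) + e2 * t + e3) /
  Num.sqrt (t ^+ 2 + (b * t + c) ^+ 2 + 1).
have g0 : g 0 = Lim b c e2 e3.
  by rewrite /g /Lim !mulr0 !add0r addr0 expr0n/= add0r [_ + 1]addrC.
have cg : {for 0, continuous g}.
  have s0 : Num.sqrt (0 ^+ 2 + (b * 0 + c) ^+ 2 + 1) != 0 :> R.
    by rewrite gt_eqF// sqrtr_gt0 ltr_wpDl// addr_ge0// sqr_ge0.
  have cs : {for 0, continuous (fun t : R => Num.sqrt (t ^+ 2 + (b * t + c) ^+ 2 + 1))}.
    apply: continuous_comp; last exact: sqrt_continuous.
    apply: differentiable_continuous; apply/derivable1_diffP.
    by apply: ex_derive.
  have cn : {for 0, continuous (fun t : R =>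
      (- b * t - c) * (- b * e2 - c * e3) + e2 * t + e3)}.
    by apply: differentiable_continuous; apply/derivable1_diffP; apply: ex_derive.
  apply: continuousM; first exact: cn.
  apply: continuousV; [exact: s0|exact: cs].
have invy : (x^-1 : R) @[x --> +oo] --> (0 : R).
  apply/(@gtr0_cvgV0 R R (pinfty_nbhs R) _ id); last by [].
  exact: nbhs_pinfty_gt.
rewrite -g0.
have gV : g x^-1 @[x --> +oo] --> g 0 by apply: cvg_comp invy _; exact: cg.
apply: cvg_trans gV; apply: near_eq_cvg; near=> x.
have x0 : 0 < x by near: x; exact: nbhs_pinfty_gt.
have xN0 : x != 0 by rewrite gt_eqF.
rewrite /g /Phi.
have -> : x^-1 ^+ 2 + (b * x^-1 + c) ^+ 2 + 1 = (hyp3 (- b - c * x) x / x) ^+ 2.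
  by rewrite [RHS]exprMn hyp3_sqr; field.
rewrite sqrtr_sqr ger0_norm ?divr_ge0 ?ltW ?hyp3_gt0//.
by field; rewrite hyp3_neq0 xN0.
Unshelve. all: by end_near. Qed.

Let continuous_chord_density (b c : R) : continuous (chord_density b c).
Proof.
move=> n.
apply: (@continuousM _ _ (fun=> 1 + b ^+ 2 + c ^+ 2)
  (fun n => gnomonic_weight (- b - c * n) n)); first exact: cst_continuous.
apply: (@continuousV _ _ (fun n => hyp3 (- b - c * n) n ^+ 3)).
  by rewrite expf_neq0// hyp3_neq0.
apply: (@continuous_comp _ _ _ (fun n => hyp3 (- b - c * n) n) (fun x => x ^+ 3)).
  apply: (@continuous_comp _ _ _ (fun n => 1 + (- b - c * n) ^+ 2 + n ^+ 2) Num.sqrt).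
    by apply: differentiable_continuous; apply/derivable1_diffP; apply: ex_derive.
  exact: sqrt_continuous.
exact: exprn_continuous.
Qed.

Let continuous_integrand (b c e2 e3 : R) :
  continuous (fun n => chord_density b c n * (e3 - n * e2)).
Proof.
move=> n; apply: (@continuousM _ _ (chord_density b c) (fun n => e3 - n * e2)).
  exact: continuous_chord_density.
by apply: differentiable_continuous; apply/derivable1_diffP; apply: ex_derive.
Qed.

Let integral_halfline (b c e2 e3 a : R) :
  (forall n, a <= n -> 0 <= e3 - n * e2) ->
  (\int[mu]_(n in `[a, +oo[) (chord_density b c n * (e3 - n * e2))%:E =
   (Lim b c e2 e3 - Phi b c e2 e3 a)%:E)%E.
Proof.
move=> l0.
have dPhi n : derivable (Phi b c e2 e3) n 1.
  by case: (is_derive_Phi b c e2 e3 n).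
rewrite (@ge0_continuous_FTC2y _ _ (Phi b c e2 e3) a (Lim b c e2 e3)).
- by rewrite EFinB.
- by move=> x ax; rewrite mulr_ge0 ?chord_density_ge0// l0.
- by apply: continuous_subspaceT; exact: continuous_integrand.
- exact: cvgy_Phi.
- by move=> x _; exact: dPhi.
- apply: cvg_at_right_filter; apply: differentiable_continuous.
  exact/derivable1_diffP.
- by move=> x _; rewrite derive1E; case: (is_derive_Phi b c e2 e3 x).
Qed.

Let measurable_integrand (b c e2 e3 : R) :
  measurable_fun setT (fun n : M => (chord_density b c n * `|e3 - n * e2|)%:E).
Proof.
rewrite /chord_density; apply/measurable_EFinP; apply: measurable_funM.
  apply: measurable_funM; first exact: measurable_cst.
  by apply: measurable_gnomonic_weight; mfun.
by mfun.
Qed.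

Let integral_halfline_opp (b c e2 e3 a : R) :
  (forall n, n <= a -> 0 <= e3 - n * e2) ->
  (\int[mu]_(n in `]-oo, a]) (chord_density b c n * `|e3 - n * e2|)%:E =
   (Lim b c e2 e3 + Phi b c e2 e3 a)%:E)%E.
Proof.
move=> l0.
rewrite -(@ge0_integral_opp_in _ (fun n : M => (chord_density b c n * `|e3 - n * e2|)%:E)
  (measurable_integrand b c e2 e3) _ `]-oo, a]%classic 0); last 2 first.
- by move=> n; rewrite lee_fin mulr_ge0 ?chord_density_ge0.
- exact: measurable_itv.
have -> : (fun x : M => 0 - x) @^-1` `]-oo, a]%classic = `[- a, +oo[%classic.
  by apply/seteqP; split => x /=; rewrite !in_itv/= andbT sub0r lerNl.
transitivity (\int[mu]_(n in `[(- a)%R, +oo[)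
    (chord_density b (- c) n * (e3 - n * (- e2)))%:E)%E.
  apply: eq_integral => n /[!inE]/=; rewrite in_itv/= andbT => an.
  rewrite sub0r; congr EFin; congr (_ * _).
    rewrite /chord_density sqrrN; congr (_ * _).
    rewrite /gnomonic_weight /hyp3 sqrrN.
    by congr ((Num.sqrt (1 + _ ^+ 2 + _)) ^- 3); ring.
  by rewrite ger0_norm ?l0//; [ring|rewrite lerNl].
rewrite integral_halfline; last first.
  by move=> n an; have := l0 (- n); rewrite lerNl => /(_ an); lra.
congr EFin; rewrite /Lim /Phi sqrrN.
have -> : hyp3 (- b - - c * - a) (- a) = hyp3 (- b - c * a) a.
  by rewrite /hyp3 sqrrN; congr (Num.sqrt (1 + _ ^+ 2 + _)); ring.
by field; rewrite hyp3_neq0 gt_eqF// sqrtr_gt0 ltr_pwDl// sqr_ge0.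
Qed.

Let integral_chord_split (b c e2 e3 a : R) :
  (\int[mu]_n (chord_density b c n * `|e3 - n * e2|)%:E =
   \int[mu]_(n in `]-oo, a]) (chord_density b c n * `|e3 - n * e2|)%:E +
   \int[mu]_(n in `[a, +oo[) (chord_density b c n * `|e3 - n * e2|)%:E)%E.
Proof.
have mi := measurable_integrand b c e2 e3.
rewrite -(@integral_itv_obnd_cbnd R a); last exact: measurable_funTS.
rewrite -ge0_integral_setU; last 5 first.
- exact: measurable_itv.
- exact: measurable_itv.
- exact: measurable_funTS.
- by move=> n _; rewrite lee_fin mulr_ge0 ?chord_density_ge0.
- apply/disj_setPS => x /=; rewrite !in_itv/= andbT => -[xa ax].
  by move: (lt_le_trans ax xa); rewrite ltxx.
congr (integral _ _ _); apply/seteqP; split => x //= _.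
by rewrite !in_itv/= andbT; have [] := leP x a; [left|right].
Qed.

(** The factor e3 - n * e2 changes sign at n = e3 / e2, or never if e2 = 0; under
   this hypothesis it is non-negative on the right. *)
Let integral_chord_neg (b c e2 e3 : R) : e2 < 0 \/ e2 = 0 /\ 0 <= e3 ->
  (\int[mu]_n (chord_density b c n * `|e3 - n * e2|)%:E =
   (2 * Num.sqrt ((b * e2 + c * e3) ^+ 2 + e2 ^+ 2 + e3 ^+ 2))%:E)%E.
Proof.
move=> [e20|[-> e30]]; set S := Num.sqrt _.
- have e2N0 : e2 != 0 by rewrite lt_eqF.
  have S2 : S ^+ 2 = (b * e2 + c * e3) ^+ 2 + e2 ^+ 2 + e3 ^+ 2.
    by rewrite sqr_sqrtr// !addr_ge0// sqr_ge0.
  have S0 : 0 < S by rewrite sqrtr_gt0 ltr_wpDr ?sqr_ge0// ltr_wpDl ?sqr_ge0// exprn_even_gt0.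
  rewrite (integral_chord_split _ _ _ _ (e3 / e2)).
  transitivity (\int[mu]_(n in `]-oo, (e3 / e2)%R])
      (chord_density b c n * `|- e3 - n * - e2|)%:E +
    \int[mu]_(n in `[(e3 / e2)%R, +oo[)
      (chord_density b c n * (e3 - n * e2))%:E)%E.
    congr (_ + _)%E; apply: eq_integral => n /[!inE]/=.
      by move=> _; rewrite -normrN; congr (_ * `|_|)%:E; ring.
    rewrite in_itv/= andbT ler_ndivrMr// => h.
    by rewrite ger0_norm ?subr_ge0.
  rewrite integral_halfline_opp; last first.
    by move=> n; rewrite ler_ndivlMr// => h; lra.
  rewrite integral_halfline; last first.
    by move=> n; rewrite ler_ndivrMr// => h; lra.
  rewrite -EFinD; congr EFin.
  have -> : Lim b c (- e2) (- e3) = - Lim b c e2 e3.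
    by rewrite /Lim; field; rewrite gt_eqF// sqrtr_gt0 ltr_pwDl// sqr_ge0.
  have -> : Phi b c (- e2) (- e3) (e3 / e2) = - Phi b c e2 e3 (e3 / e2).
    by rewrite /Phi; field; rewrite hyp3_neq0 e2N0.
  suff -> : Phi b c e2 e3 (e3 / e2) = - S by ring.
  rewrite /Phi.
  have -> : hyp3 (- b - c * (e3 / e2)) (e3 / e2) = - (S / e2).
    rewrite /hyp3.
    have -> : 1 + (- b - c * (e3 / e2)) ^+ 2 + (e3 / e2) ^+ 2 = (- (S / e2)) ^+ 2.
      by rewrite sqrrN [RHS]expr_div_n S2; field.
    by rewrite sqrtr_sqr ger0_norm// oppr_ge0 ltW// pmulr_rlt0// invr_lt0.
  have -> : (- b - c * (e3 / e2)) * (- b * e2 - c * e3) + e2 + e3 / e2 * e3 =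
      S ^+ 2 / e2 by rewrite S2; field.
  by field; rewrite e2N0 gt_eqF.
- rewrite (integral_chord_split _ _ _ _ 0).
  transitivity (\int[mu]_(n in `]-oo, 0%R])
      (chord_density b c n * `|e3 - n * 0|)%:E +
    \int[mu]_(n in `[0%R, +oo[)
      (chord_density b c n * (e3 - n * 0))%:E)%E.
    congr (_ + _)%E; apply: eq_integral => n _.
    by rewrite mulr0 subr0 ger0_norm.
  rewrite integral_halfline_opp; last by move=> n _; rewrite mulr0 subr0.
  rewrite integral_halfline; last by move=> n _; rewrite mulr0 subr0.
  rewrite -EFinD; congr EFin; rewrite /S.
  have s0 : 0 < Num.sqrt (1 + c ^+ 2) by rewrite sqrtr_gt0 ltr_pwDl// sqr_ge0.
  have s2 : Num.sqrt (1 + c ^+ 2) ^+ 2 = 1 + c ^+ 2.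
    by rewrite sqr_sqrtr// addr_ge0// sqr_ge0.
  have -> : (b * 0 + c * e3) ^+ 2 + 0 ^+ 2 + e3 ^+ 2 =
      (Num.sqrt (1 + c ^+ 2) * e3) ^+ 2.
    by rewrite [RHS]exprMn s2; ring.
  rewrite sqrtr_sqr ger0_norm; last by apply: mulr_ge0 => //; exact: ltW.
  have -> : Lim b c 0 e3 = Num.sqrt (1 + c ^+ 2) * e3.
    apply: (mulIf (lt0r_neq0 s0)); rewrite /Lim divfK ?lt0r_neq0//.
    by rewrite mulrAC -expr2 s2; ring.
  ring.
Qed.

(** Cauchy's formula for a segment: the integral of |sin| over a half-turn
   is 2. *)
Lemma integral_chord (b c e2 e3 : R) :
  (\int[mu]_n (chord_density b c n * `|e3 - n * e2|)%:E =
   (2 * Num.sqrt ((b * e2 + c * e3) ^+ 2 + e2 ^+ 2 + e3 ^+ 2))%:E)%E.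
Proof.
have [e20|e20|e20] := ltgtP e2 0.
- by apply: integral_chord_neg; left.
- have := @integral_chord_neg b c (- e2) (- e3) (or_introl _).
  rewrite oppr_lt0 => /(_ e20) h; rewrite -[RHS]/(_%:E).
  transitivity (\int[mu]_n (chord_density b c n * `|- e3 - n * - e2|)%:E)%E.
    by apply: eq_integral => n _; rewrite -normrN; congr (_ * `|_|)%:E; ring.
  by rewrite h; congr (2 * Num.sqrt _)%:E; ring.
- have [e30|e30] := leP 0 e3; first by apply: integral_chord_neg; right.
  have := @integral_chord_neg b c (- e2) (- e3) (or_intror _).
  rewrite oppr_ge0 => /(_ (conj _ (ltW e30))) h.
  transitivity (\int[mu]_n (chord_density b c n * `|- e3 - n * - e2|)%:E)%E.
    by apply: eq_integral => n _; rewrite -normrN; congr (_ * `|_|)%:E; ring.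
  by rewrite h; [congr (2 * Num.sqrt _)%:E; ring|rewrite e20 oppr0].
Qed.

End segment_integral.

(** * Convex sets in a plane *)

Definition slope_plane (R : realType) (b c t : R) : set (E3 R) :=
  [set x | x.1.1 + b * x.1.2 + c * x.2 = t].

(** The lines of direction (- b - c * n, 1, n) of a plane are the level sets of
   the height. *)
Definition height (R : realType) (n : R) (x : E3 R) : R := x.2 - n * x.1.2.

Lemma same_sign_ratio (R : realFieldType) (x y : R) : x != 0 -> y != 0 ->
  x != y -> 0 <= x * y -> 0 <= x / y < 1 \/ 0 <= y / x < 1.
Proof.
move=> x0 y0 xy xy0.
have r0 : 0 <= x / y.
  have -> : x / y = x * y / y ^+ 2 by field.
  by rewrite divr_ge0// sqr_ge0.
have [r1|r1] := ltP (x / y) 1; first by left; rewrite r0.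
right; rewrite -[y / x]invf_div invr_ge0 r0/= invf_lt1//.
  rewrite lt_neqAle r1 andbT eq_sym; apply: contra xy => /eqP e.
  by rewrite -[x](divfK y0) e mul1r.
exact: lt_le_trans ltr01 r1.
Qed.

Lemma between_ratio (R : realFieldType) (o k q : R) :
  o < k /\ k < q \/ q < k /\ k < o -> 0 <= (o - k) / (o - q) < 1 /\ o - q != 0.
Proof.
move=> [[ok kq]|[qk ko]].
  have oq : 0 < q - o by rewrite subr_gt0 (lt_trans ok).
  have -> : (o - k) / (o - q) = (k - o) / (q - o) by rewrite -divrNN !opprB.
  rewrite ltr_pdivrMr// ler_pdivlMr//; split; last by rewrite subr_eq0 lt_eqF// (lt_trans ok).
  by apply/andP; split; lra.
have oq : 0 < o - q by rewrite subr_gt0 (lt_trans qk).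
rewrite ltr_pdivrMr// ler_pdivlMr//; split; last by rewrite gt_eqF.
by apply/andP; split; lra.
Qed.

Section planar_convex.
Context {R : realType}.
Variables (b c t : R) (C : set (E3 R)).
Local Notation E := (slope_plane b c t).
Hypotheses (CE : C `<=` E) (cC : compact C).
Hypothesis convC : forall x y s, C x -> C y -> 0 <= s <= 1 ->
  C ((1 - s) *: x + s *: y).

Lemma slope_plane_inj x y : E x -> E y -> x.1.2 = y.1.2 -> x.2 = y.2 -> x = y.
Proof.
case: x => -[x1 x2] x3; case: y => -[y1 y2] y3 /= + + e2 e3.
rewrite /slope_plane/= e2 e3 => ex ey; congr (_, _, _).
by move: ex; rewrite -ey => /addIr/addIr.
Qed.

Lemma slope_plane_affine x y s : E x -> E y -> E ((1 - s) *: x + s *: y).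
Proof.
rewrite /slope_plane/= => ex ey.
transitivity ((1 - s) * (x.1.1 + b * x.1.2 + c * x.2) +
  s * (y.1.1 + b * y.1.2 + c * y.2)).
  by rewrite /GRing.scale/=; ring.
by rewrite ex ey; ring.
Qed.

Definition lift_plane (y z : R) : E3 R := (t - b * y - c * z, y, z).

Lemma lift_planeP y z : E (lift_plane y z).
Proof. by rewrite /slope_plane/=; ring. Qed.

(** Interior relatively to the plane, in the coordinates y and z. *)
Definition inner (x : E3 R) := E x /\ exists2 d : R, 0 < d &
  forall y, E y -> `|y.1.2 - x.1.2| < d -> `|y.2 - x.2| < d -> C y.

Lemma innerW x : inner x -> C x.
Proof. by move=> [Ex [d d0 dC]]; apply: dC => //; rewrite subrr normr0. Qed.

Let clC : closed C.
Proof. by apply: compact_closed => //; exact: norm_hausdorff. Qed.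

Lemma inner_not_boundary x : inner x -> ~ rel_boundary E C x.
Proof.
move=> [Ex [d d0 dC]] [_ /(_ _ (nbhsx_ballx x d d0))] [y [[Ey nCy]]].
rewrite ball_E3 => -[_ [xy1 xy2]]; apply: nCy; apply: dC => //.
  by rewrite distrC.
by rewrite distrC.
Qed.

Lemma boundary_sub : rel_boundary E C `<=` C.
Proof. by move=> x [+ _]; rewrite -(closure_id _).1. Qed.

Lemma not_inner_boundary x : C x -> ~ inner x -> rel_boundary E C x.
Proof.
move=> Cx nix; split; first exact: subset_closure.
move=> B /nbhs_ballP[e /= e0 eB].
pose d := e / (1 + `|b| + `|c|).
have s0 : 0 < 1 + `|b| + `|c| by rewrite -addrA ltr_pwDl// addr_ge0.
have d0 : 0 < d by rewrite divr_gt0.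
apply: contrapT => h; apply: nix; split; first exact: CE.
exists d => // y Ey y2 y3; apply: contrapT => nCy; apply: h; exists y; split => //.
apply: eB; rewrite ball_E3.
have de : d * (1 + `|b| + `|c|) = e by rewrite divfK// gt_eqF.
have b0 : 0 <= `|b| by []. have c0 : 0 <= `|c| by [].
have dle : d <= e by rewrite -de; nra.
split; last by split; rewrite distrC; apply: lt_le_trans dle.
have -> : x.1.1 - y.1.1 = b * (y.1.2 - x.1.2) + c * (y.2 - x.2).
  have := CE Cx; rewrite /slope_plane/= => ex.
  by move: Ey; rewrite /slope_plane/= -ex => ey; lra.
apply: (le_lt_trans (ler_normD _ _)); rewrite !normrM.
have : `|b| * `|y.1.2 - x.1.2| <= `|b| * d by rewrite ler_wpM2l// ltW.
have : `|c| * `|y.2 - x.2| <= `|c| * d by rewrite ler_wpM2l// ltW.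
by rewrite -de; nra.
Qed.

(** Shrinking C towards one of its points maps neighbourhoods of o to
   neighbourhoods. *)
Lemma inner_segment o x s : inner o -> C x -> 0 <= s < 1 ->
  inner ((1 - s) *: o + s *: x).
Proof.
move=> [Eo [d d0 dC]] Cx /andP[s0 s1].
have s1' : 0 < 1 - s by rewrite subr_gt0.
have sN : 1 - s != 0 by rewrite gt_eqF.
split; first by apply: slope_plane_affine => //; exact: CE.
exists ((1 - s) * d); first by rewrite mulr_gt0.
move=> y Ey y2 y3.
pose y' : E3 R := (1 - s)^-1 *: (y - s *: x).
have Ey' : E y'.
  have -> : y' = (1 - (1 - s)^-1) *: x + (1 - s)^-1 *: y.
    rewrite /y' scalerBr scalerA addrC; congr (_ + _).
    by rewrite -scaleNr; congr (_ *: _); field.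
  by apply: slope_plane_affine => //; exact: CE.
have near_o (u v w : R) : `|u - ((1 - s) * w + s * v)| < (1 - s) * d ->
    `|(1 - s)^-1 * (u - s * v) - w| < d.
  move=> h; rewrite -(ltr_pM2l s1'); apply: le_lt_trans h.
  rewrite -{1}(gtr0_norm s1') -normrM le_eqVlt; apply/orP; left; apply/eqP.
  by congr `|_|; field.
have Cy' : C y' by apply: dC => //; exact: near_o.
have -> : y = (1 - s) *: y' + s *: x by rewrite /y' scalerA divff// scale1r subrK.
by apply: convC => //; rewrite s0/= ltW.
Qed.

Lemma height_affine (n : R) x y s :
  height n ((1 - s) *: x + s *: y) = (1 - s) * height n x + s * height n y.
Proof. by rewrite /height/= /GRing.scale/=; ring. Qed.

Lemma slope_plane_height_inj (n : R) x y : E x -> E y ->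
  height n x = height n y -> x.1.2 = y.1.2 -> x = y.
Proof.
move=> Ex Ey h e; apply: slope_plane_inj => //.
by move: h; rewrite /height e => /addIr.
Qed.

Let inner_side n w x y : inner w -> rel_boundary E C x -> rel_boundary E C y ->
  height n x = height n w -> height n y = height n w -> x <> y ->
  (x.1.2 - w.1.2) * (y.1.2 - w.1.2) < 0.
Proof.
move=> iw bx by_ hx hy xy.
have Cx := boundary_sub bx; have Cy := boundary_sub by_.
have Ex := CE Cx; have Ey := CE Cy; have Ew := CE (innerW iw).
have nx : x.1.2 != w.1.2.
  apply/eqP => e; apply: (inner_not_boundary iw).
  by rewrite -(slope_plane_height_inj Ex Ew hx e).
have ny : y.1.2 != w.1.2.
  apply/eqP => e; apply: (inner_not_boundary iw).
  by rewrite -(slope_plane_height_inj Ey Ew hy e).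
have nxy : x.1.2 != y.1.2.
  by apply/eqP => e; apply: xy; apply: (slope_plane_height_inj (n := n)) => //; rewrite hx.
(* if u is nearer to w than v on the same side, it is an inner point *)
have key u v : C u -> C v -> rel_boundary E C u -> height n u = height n w ->
    height n v = height n w -> 0 <= (u.1.2 - w.1.2) / (v.1.2 - w.1.2) < 1 ->
    v.1.2 - w.1.2 != 0 -> False.
  move=> Cu Cv bu hu hv s01 vw; apply: (inner_not_boundary _ bu).
  suff -> : u = (1 - (u.1.2 - w.1.2) / (v.1.2 - w.1.2)) *: w +
      ((u.1.2 - w.1.2) / (v.1.2 - w.1.2)) *: v by exact: inner_segment.
  apply: (slope_plane_height_inj (n := n)); first exact: CE.
  - by apply: slope_plane_affine => //; exact: CE.
  - by rewrite height_affine hu hv; ring.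
  - by rewrite /= /GRing.scale/=; field.
have xw0 : x.1.2 - w.1.2 != 0 by rewrite subr_eq0.
have yw0 : y.1.2 - w.1.2 != 0 by rewrite subr_eq0.
have axy : x.1.2 - w.1.2 != y.1.2 - w.1.2 by rewrite (inj_eq (addIr _)).
rewrite ltNge; apply/negP => p0.
have [h|h] := same_sign_ratio xw0 yw0 axy p0.
  exact: (key x y).
exact: (key y x).
Qed.

(** A line of the plane passing through an inner point of C meets the boundary
   at most twice: once on each side of that point. *)
Lemma boundary_line_lt3 (n : R) o q1 q2 x1 x2 x3 : inner o ->
  C q1 -> C q2 -> height n q1 < height n x1 -> height n x1 < height n q2 ->
  rel_boundary E C x1 -> rel_boundary E C x2 -> rel_boundary E C x3 ->
  height n x2 = height n x1 -> height n x3 = height n x1 ->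
  x1 <> x2 -> x2 <> x3 -> x1 <> x3 -> False.
Proof.
move=> io Cq1 Cq2 h1 h2 b1 b2 b3 e2 e3 d12 d23 d13.
have [w iw hw] : exists2 w, inner w & height n w = height n x1.
  set k := height n x1 in h1 h2 *.
  have mix q : C q -> 0 <= (height n o - k) / (height n o - height n q) < 1 ->
      height n o - height n q != 0 -> exists2 w, inner w & height n w = k.
    move=> Cq s01 nq; exists ((1 - (height n o - k) / (height n o - height n q)) *: o +
      ((height n o - k) / (height n o - height n q)) *: q).
      exact: inner_segment.
    by rewrite height_affine; field.
  have [ok|ok|ok] := ltgtP (height n o) k; last by exists o.
  - have [s01 nq] := between_ratio (or_introl (conj ok h2)); exact: (mix q2).
  - have [s01 nq] := between_ratio (or_intror (conj h1 ok)); exact: (mix q1).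
have p12 := inner_side iw b1 b2 (esym hw) (etrans e2 (esym hw)) d12.
have p23 := inner_side iw b2 b3 (etrans e2 (esym hw)) (etrans e3 (esym hw)) d23.
have p13 := inner_side iw b1 b3 (esym hw) (etrans e3 (esym hw)) d13.
have neg3 (u v r : R) : u * v < 0 -> v * r < 0 -> u * r < 0 -> False.
  move=> uv vr ur; have := sqr_ge0 (u * v * r).
  have -> : (u * v * r) ^+ 2 = (u * v) * (v * r) * (u * r) by ring.
  by apply/negP; rewrite -ltNge pmulr_rlt0// nmulr_rgt0.
exact: neg3 p12 p23 p13.
Qed.

(** Moving along the third coordinate changes the height. *)
Lemma inner_height_not_max (n : R) x : inner x ->
  exists2 y, C y & height n x < height n y.
Proof.
move=> [Ex [d d0 dC]].
exists (lift_plane x.1.2 (x.2 + d / 2)).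
  apply: dC; first exact: lift_planeP.
    by rewrite /= subrr normr0.
  by rewrite /= addrC addKr ger0_norm ?divr_ge0 ?ltW// ltr_pdivrMr// mulr_natr mulr2n ltrDl.
by rewrite /height/= ltrD2r ltrDl divr_gt0.
Qed.

Lemma inner_height_not_min (n : R) x : inner x ->
  exists2 y, C y & height n y < height n x.
Proof.
move=> [Ex [d d0 dC]].
exists (lift_plane x.1.2 (x.2 - d / 2)).
  apply: dC; first exact: lift_planeP.
    by rewrite /= subrr normr0.
  rewrite /= addrC addKr normrN ger0_norm ?divr_ge0 ?ltW//.
  by rewrite ltr_pdivrMr// mulr_natr mulr2n ltrDl.
by rewrite /height/= ltrD2r gtrDl oppr_lt0 divr_gt0.
Qed.

Lemma continuous_height (n : R) : continuous (@height R n : E3 R -> R).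
Proof.
move=> x; apply: continuousB; first exact: cvg_snd.
apply: continuousM; first exact: cst_continuous.
apply: (@continuous_comp _ _ _ (fst : E3 R -> _) snd); first exact: cvg_fst.
exact: cvg_snd.
Qed.

Lemma height_max (n : R) : C !=set0 ->
  exists2 x, C x & forall y, C y -> height n y <= height n x.
Proof.
move=> C0.
have cf : {within C, continuous (@height R n)}.
  by apply: continuous_subspaceT; exact: continuous_height.
have [x /[!inE] Cx xM] := compact_EVT_max C0 cC cf.
by exists x => // y Cy; apply: xM; rewrite inE.
Qed.

Lemma height_min (n : R) : C !=set0 ->
  exists2 x, C x & forall y, C y -> height n x <= height n y.
Proof.
move=> C0.
have cf : {within C, continuous (@height R n)}.
  by apply: continuous_subspaceT; exact: continuous_height.
have [x /[!inE] Cx xM] := compact_EVT_min C0 cC cf.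
by exists x => // y Cy; apply: xM; rewrite inE.
Qed.

Lemma height_image (n : R) x y : C x -> C y ->
  (forall z, C z -> height n x <= height n z) ->
  (forall z, C z -> height n z <= height n y) ->
  height n @` C = `[height n x, height n y]%classic.
Proof.
move=> Cx Cy xm yM; apply/seteqP; split => k /=.
  by move=> [z Cz <-]; rewrite in_itv/= xm ?yM.
rewrite in_itv/= => /andP[xk ky].
have [xy|] := ltP (height n x) (height n y); last first.
  by move=> yx; exists x => //; apply/eqP; rewrite eq_le xk (le_trans ky).
have yx0 : 0 < height n y - height n x by rewrite subr_gt0.
exists ((1 - (k - height n x) / (height n y - height n x)) *: x +
  ((k - height n x) / (height n y - height n x)) *: y).
  apply: convC => //; rewrite ler_pdivlMr// mul0r subr_ge0 xk/=.
  by rewrite ler_pdivrMr// mul1r lerD2r.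
by rewrite height_affine; field; rewrite gt_eqF.
Qed.

End planar_convex.

(** * Polygons inscribed in the boundary *)

Section closed_walk.
Context {R : realDomainType}.

Lemma ler_sum_dist (h : nat -> R) (i j : nat) : (i <= j)%N ->
  `|h j - h i| <= \sum_(i <= l < j) `|h l.+1 - h l|.
Proof. by move=> ij; rewrite -telescope_sumr//; exact: ler_norm_sum. Qed.

(** A closed walk passes twice over every gap between two of its values. *)
Lemma closed_walk_ge2 (h : nat -> R) (m i j : nat) : h m = h 0%N ->
  (i <= m)%N -> (j <= m)%N ->
  2 * `|h j - h i| <= \sum_(0 <= l < m) `|h l.+1 - h l|.
Proof.
move=> hm; wlog ij : i j / (i <= j)%N => [hw im jm|im jm].
  have [ij|/ltnW ji] := leqP i j; first exact: hw.
  by rewrite distrC; exact: hw.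
rewrite (big_cat_nat (n := i))//= (big_cat_nat (m := i) (n := j))//=.
have h1 := ler_sum_dist h (leq0n i).
have h2 := ler_sum_dist h ij.
have h3 := ler_sum_dist h jm.
have h4 : `|h j - h i| <= `|h i - h 0%N| + `|h m - h j|.
  apply: le_trans (ler_distD (h 0%N) _ _) _.
  by rewrite hm addrC (distrC (h 0%N)) (distrC (h j)).
lra.
Qed.

End closed_walk.

Section itv_partition_points.
Context {R : realType}.
Variable s : seq R.
Hypothesis hs : itv_partition 0 1 s.

Definition partition_point (i : nat) : R := nth 0 (0 :: s) i.
Local Notation p := partition_point.
Local Notation m := (size s).

Lemma partition_point0 : p 0 = 0. Proof. by []. Qed.

Lemma partition_point_last : p m = 1.
Proof. by case: hs => _ /eqP <-; rewrite /p (last_nth 0). Qed.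

Lemma partition_point_lt i j : (i < j)%N -> (j <= m)%N -> p i < p j.
Proof.
move=> ij jm; have hsort : sorted <%O (0 :: s) by case: hs.
by rewrite (lt_sorted_ltn_nth 0 hsort) ?inE/= ?ltnS// (leq_trans (ltnW ij)).
Qed.

Lemma partition_point_le i j : (i <= j)%N -> (j <= m)%N -> p i <= p j.
Proof.
by rewrite leq_eqVlt => /predU1P[->//|ij jm]; rewrite ltW// partition_point_lt.
Qed.

Lemma partition_point_itv i : (i <= m)%N -> 0 <= p i <= 1.
Proof.
by move=> im; rewrite -{1}partition_point0 -partition_point_last !partition_point_le.
Qed.

End itv_partition_points.

Section boundary_length.
Context {R : realType}.
Local Notation M := (measurableTypeR R).
Local Notation mu := (@lebesgue_measure R).
Variables (b c t : R) (C : set (E3 R)).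
Local Notation E := (slope_plane b c t).
Hypotheses (CE : C `<=` E) (cC : compact C).
Hypothesis convC : forall x y s, C x -> C y -> 0 <= s <= 1 ->
  C ((1 - s) *: x + s *: y).

Lemma integral_edge (x y : E3 R) : E x -> E y ->
  (\int[mu]_n (chord_density b c n * `|height n x - height n y|)%:E =
   (2 * enorm (x - y))%:E)%E.
Proof.
move=> Ex Ey.
transitivity (\int[mu]_n (chord_density b c n *
    `|(x.2 - y.2) - n * (x.1.2 - y.1.2)|)%:E)%E.
  by apply: eq_integral => n _; congr (_ * `|_|)%:E; rewrite /height; ring.
rewrite integral_chord; congr (2 * Num.sqrt _)%:E; rewrite /dot/=.
have -> : x.1.1 - y.1.1 = - (b * (x.1.2 - y.1.2) + c * (x.2 - y.2)).
  by move: Ex; rewrite /slope_plane/= -Ey; lra.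
by rewrite mulrNN -!expr2.
Qed.

Let clC : closed C.
Proof. by apply: compact_closed => //; exact: norm_hausdorff. Qed.

Lemma height_imageP (n k : R) :
  (height n @` C) k <-> exists y, C (lift_plane b c t y (n * y + k)).
Proof.
split => [[x Cx <-]|[y Cy]].
  exists x.1.2; suff -> : lift_plane b c t x.1.2 (n * x.1.2 + height n x) = x by [].
  apply: (slope_plane_inj (b := b) (c := c) (t := t)) => //=.
  - exact: lift_planeP.
  - exact: CE.
  - by rewrite /height; ring.
by exists (lift_plane b c t y (n * y + k)) => //; rewrite /height/=; ring.
Qed.

Lemma measurable_height_image (n : R) : measurable (height n @` C : set M).
Proof.
have [->|C0] := eqVneq C set0; first by rewrite image_set0; exact: measurable0.
move/set0P in C0.
have [x Cx xm] := height_min cC n C0; have [y Cy yM] := height_max cC n C0.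
rewrite (height_image convC Cx Cy xm yM); exact: measurable_itv.
Qed.

Lemma measurable_width :
  measurable_fun setT (fun n : M => mu (height n @` C : set M)).
Proof.
pose q (z : M * M) (y : R) : E3 R := lift_plane b c t y (z.1 * y + z.2).
have mq : measurable [set z | exists y, C (q z y)].
  apply: measurable_meets => //.
    by move=> y; rewrite /q /lift_plane; mfun.
  move=> z y; rewrite /q /lift_plane.
  by apply: (@continuous_E3 R R y (fun y => t - b * y - c * (z.1 * y + z.2)) id
    (fun y => z.1 * y + z.2)); apply: differentiable_continuous;
    apply/derivable1_diffP; apply: ex_derive.
have := @measurable_fun_integral _ _ M M R mu
  (fun n k => (\1_[set z | exists y, C (q z y)] (n, k))%:E).
have -> : (fun n : M => \int[mu]_k (\1_[set z | exists y, C (q z y)] (n, k))%:E)%E =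
    (fun n : M => mu (height n @` C : set M)).
  apply/funext => n.
  transitivity (\int[mu]_k (\1_(height n @` C : set M) k)%:E)%E; last first.
    by rewrite integral_indic ?setIT//; exact: measurable_height_image.
  apply: eq_integral => k _; congr (_%:E); rewrite !indicE; congr (_%:R).
  by congr nat_of_bool; apply/idP/idP; rewrite !inE => /height_imageP.
apply; last by move=> x y; rewrite lee_fin.
apply/measurable_EFinP; apply: (measurableT_comp (measurable_indic mq)).
by mfun.
Qed.

Lemma measurable_chord_density : measurable_fun setT (fun n : M => chord_density b c n : M).
Proof.
rewrite /chord_density; apply: measurable_funM; first exact: measurable_cst.
by apply: measurable_gnomonic_weight; mfun.
Qed.

Section parametrized.
Variable f : R -> E3 R.
Hypothesis bf : boundary_param E C f.
Variable o : E3 R.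
Hypothesis io : inner b c t C o.

Let cf : {within `[0, 1], continuous f}. Proof. by case: bf. Qed.
Let f01 : f 0 = f 1. Proof. by case: bf. Qed.
Let finj : {in `[0, 1[ &, injective f}. Proof. by case: bf. Qed.
Let fim : f @` `[0, 1] = rel_boundary E C. Proof. by case: bf. Qed.

Let fb x : 0 <= x <= 1 -> rel_boundary E C (f x).
Proof. by move=> x01; rewrite -fim; exists x => //=; rewrite in_itv. Qed.

Let fC x : 0 <= x <= 1 -> C (f x).
Proof. by move=> x01; apply: (boundary_sub cC); exact: fb. Qed.

Let fE x : 0 <= x <= 1 -> E (f x).
Proof. by move=> x01; apply: CE; exact: fC. Qed.

Let cg (n : R) : {within `[0, 1], continuous (height n \o f)}.
Proof.
apply/subspace_continuousP => x xA; apply: (@cvg_comp _ _ _ f (height n)).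
  by move/subspace_continuousP: cf; apply.
exact: continuous_height.
Qed.

Section polygon.
Variable s : seq R.
Hypothesis hs : itv_partition 0 1 s.
Local Notation p := (partition_point s).
Local Notation m := (size s).

Local Notation V n i := (height n (f (p i))).

Let measurable_edge i : measurable_fun setT
  (fun n : M => (chord_density b c n * `|V n i.+1 - V n i|)%:E).
Proof.
apply/measurable_EFinP; apply: measurable_funM; first exact: measurable_chord_density.
by rewrite /height; mfun.
Qed.

Lemma integral_polygon :
  ((2 * polygon_length f 0 s)%:E =
   \int[mu]_n (chord_density b c n * \sum_(0 <= i < m) `|V n i.+1 - V n i|)%:E)%E.
Proof.
transitivity (\int[mu]_n \sum_(i <- index_iota 0 m)
    (chord_density b c n * `|V n i.+1 - V n i|)%:E)%E; last first.
  by apply: eq_integral => n _; rewrite sumEFin mulr_sumr.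
rewrite ge0_integral_sum; last 3 first.
- exact: measurableT.
- by move=> i; exact: measurable_edge.
- by move=> i n _; rewrite lee_fin mulr_ge0// chord_density_ge0.
rewrite /polygon_length mulr_sumr -sumEFin.
rewrite [LHS]big_nat [RHS]big_nat; apply: eq_bigr => i /andP[_ im].
rewrite -integral_edge.
- by apply: eq_integral => n _.
- by apply: fE; exact: partition_point_itv.
- by apply: fE; apply: partition_point_itv => //; exact: ltnW.
Qed.

(** Intermediate values: an edge that crosses a level spans an arc reaching it. *)
Let crossing (n k : R) (i : nat) : (i < m)%N ->
  Num.min (V n i) (V n i.+1) < k < Num.max (V n i) (V n i.+1) ->
  exists2 x, p i < x < p i.+1 & height n (f x) = k.
Proof.
move=> im /andP[kmin kmax].
have pp : p i < p i.+1 by exact: partition_point_lt.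
have /andP[p0 _] := partition_point_itv hs (ltnW im).
have /andP[_ p1] := partition_point_itv hs im.
have cgp : {within `[p i, p i.+1], continuous (height n \o f)}.
  have sub : `[p i, p i.+1]%classic `<=` `[0, 1]%classic.
    move=> x /=; rewrite !in_itv/= => /andP[px xp].
    by rewrite (le_trans p0 px) (le_trans xp p1).
  by apply: (continuous_subspaceW sub); exact: cg.
have kk : Num.min ((height n \o f) (p i)) ((height n \o f) (p i.+1)) <= k <=
    Num.max ((height n \o f) (p i)) ((height n \o f) (p i.+1)).
  by rewrite (ltW kmin) (ltW kmax).
have [x] := IVT (ltW pp) cgp kk.
rewrite in_itv/= => /andP[px xp] xk; exists x => //.
have ki : V n i != k.
  apply/eqP => e; move: kmin kmax; rewrite gt_min lt_max e ltxx /= => h1 h2.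
  by move: (lt_trans h1 h2); rewrite ltxx.
have ki1 : V n i.+1 != k.
  apply/eqP => e; move: kmin kmax; rewrite gt_min lt_max e ltxx !orbF => h1 h2.
  by move: (lt_trans h1 h2); rewrite ltxx.
rewrite !lt_neqAle px xp !andbT; apply/andP; split.
  by apply: contraNneq ki => pix; rewrite -xk pix.
by apply: contraNneq ki1 => pix; rewrite -xk pix.
Qed.

Variables (n : R) (xm xM : E3 R).
Hypotheses (Cxm : C xm) (CxM : C xM).
Hypothesis xmP : forall z, C z -> height n xm <= height n z.
Hypothesis xMP : forall z, C z -> height n z <= height n xM.

Let A (i : nat) : set M :=
  `]Num.min (V n i) (V n i.+1), Num.max (V n i) (V n i.+1)[%classic.

(** A level strictly between the extreme heights is crossed by at most two
    edges of an inscribed polygon, for each crossing edge spans an arc of the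
    boundary which reaches that level. *)
Let crossing_le2 (k : R) : \sum_(0 <= i < m) \1_(A i) k <=
  2 * \1_(`]height n xm, height n xM[%classic : set M) k :> R.
Proof.
have VC i : (i <= m)%N -> C (f (p i)) by move=> im; apply: fC; exact: partition_point_itv.
have AP i : (k \in A i) =
    (Num.min (V n i) (V n i.+1) < k < Num.max (V n i) (V n i.+1)).
  by apply/idP/idP; rewrite inE /A /= in_itv.
rewrite big_mkord.
have -> : \sum_(i < m) \1_(A i) k = #|[set i : 'I_m | k \in A i]%SET|%:R :> R.
  rewrite -sum1_card natr_sum [RHS]big_mkcond/=; apply: eq_bigr => i _.
  by rewrite indicE finset.inE; case: ifP.
have [->|] := eqVneq [set i : 'I_m | k \in A i]%SET finset.set0.
  by rewrite cards0 mulr_ge0.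
case/finset.set0Pn => i0; rewrite finset.inE => i0k.
have k_itv : height n xm < k < height n xM.
  move: i0k; rewrite AP gt_min lt_max => /andP[/orP h1 /orP h2].
  apply/andP; split.
    by case: h1 => h; apply: le_lt_trans h; apply: xmP; apply: VC => //; exact: ltnW.
  by case: h2 => h; apply: lt_le_trans h _; apply: xMP; apply: VC => //; exact: ltnW.
rewrite indicE mem_set/=; last by rewrite in_itv.
rewrite mulr1 ler_nat leqNgt; apply/negP => /card_gt2P[i1 [i2 [i3]]].
rewrite !finset.inE => -[[h1 h2 h3] [d12 d23 d31]].
have cr i : k \in A i -> (i < m)%N -> exists2 x, p i < x < p i.+1 & height n (f x) = k.
  by rewrite AP => ki im; exact: crossing.
have [x1 px1 hx1] := cr i1 h1 (ltn_ord i1).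
have [x2 px2 hx2] := cr i2 h2 (ltn_ord i2).
have [x3 px3 hx3] := cr i3 h3 (ltn_ord i3).
have in01 (i : 'I_m) x : p i < x < p i.+1 -> 0 <= x < 1.
  move=> /andP[px xp]; apply/andP; split.
    have /andP[p0 _] := partition_point_itv hs (ltnW (ltn_ord i)).
    by rewrite (le_trans p0)// ltW.
  have /andP[_ p1] := partition_point_itv hs (ltn_ord i).
  exact: lt_le_trans xp p1.
have dist (i j : 'I_m) x y : i != j -> p i < x < p i.+1 -> p j < y < p j.+1 ->
    f x <> f y.
  move=> ij px py fxy.
  have xy : x = y.
    by apply: finj fxy; rewrite in_itv/=; [exact: in01 px|exact: in01 py].
  subst y; move: px py => /andP[px1' px2'] /andP[py1 py2].
  have [lij|lji|/val_inj eij] := ltngtP i j.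
  - have := partition_point_le hs lij (ltnW (ltn_ord j)) => h.
    by move: (lt_trans px2' (le_lt_trans h py1)); rewrite ltxx.
  - have := partition_point_le hs lji (ltnW (ltn_ord i)) => h.
    by move: (lt_trans py2 (le_lt_trans h px1')); rewrite ltxx.
  - by rewrite eij eqxx in ij.
have bx (i : 'I_m) x : p i < x < p i.+1 -> rel_boundary E C (f x).
  by move=> /in01/andP[x0 x1']; apply: fb; rewrite x0 ltW.
have /andP[k1 k2] := k_itv.
apply: (boundary_line_lt3 (n := n) CE cC convC io Cxm CxM) (bx _ _ px1) (bx _ _ px2)
  (bx _ _ px3) _ _ _ _ _; rewrite ?hx1 ?hx2 ?hx3//.
- exact: dist px1 px2.
- exact: dist px2 px3.
- by apply: dist px1 px3; rewrite eq_sym.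
Qed.

(** The variation of the heights of the vertices is the integral over k of the
   number of edges that cross the level k. *)
Lemma polygon_height_le :
  \sum_(0 <= i < m) `|V n i.+1 - V n i| <= 2 * (height n xM - height n xm).
Proof.
have mu_oo (x y : R) : x <= y ->
    (\int[mu]_k (\1_(`]x, y[%classic : set M) k)%:E = (y - x)%:E)%E.
  move=> xy; transitivity (mu `]x, y[%classic).
    rewrite integral_indic; [by rewrite setIT|exact: measurableT|exact: measurable_itv].
  rewrite lebesgue_measure_itv/= lte_fin -EFinB; case: ltP => // yx.
  have -> : x = y by apply/eqP; rewrite eq_le xy yx.
  by rewrite subrr.
have muA i : (\int[mu]_k (\1_(A i) k)%:E = `|V n i.+1 - V n i|%:E)%E.
  rewrite /A; have [h|h] := leP (V n i) (V n i.+1).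
    by rewrite mu_oo// ger0_norm ?subr_ge0.
  by rewrite (mu_oo _ _ (ltW h)) ltr0_norm ?subr_lt0//; congr EFin; ring.
rewrite -lee_fin -sumEFin.
under eq_bigr do rewrite -muA.
rewrite -ge0_integral_sum; last 3 first.
- exact: measurableT.
- move=> i; apply/measurable_EFinP; apply: measurable_indic; exact: measurable_itv.
- by move=> i k _; rewrite lee_fin.
have -> : ((2 * (height n xM - height n xm))%:E =
   \int[mu]_k (2 * \1_(`]height n xm, height n xM[%classic : set M) k)%:E)%E.
  under eq_integral do rewrite EFinM.
  rewrite ge0_integralZl//; last first.
  - by apply/measurable_EFinP; apply: measurable_indic; exact: measurable_itv.
  by rewrite mu_oo ?xmP// EFinM.
apply: ge0_le_integral.
- exact: measurableT.
- by move=> k _; apply: sume_ge0 => i _; rewrite lee_fin.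
- apply: emeasurable_sum => i.
  by apply/measurable_EFinP; apply: measurable_indic; exact: measurable_itv.
- apply/measurable_EFinP; apply: measurable_funM; first exact: measurable_cst.
  by apply: measurable_indic; exact: measurable_itv.
- by move=> k _; rewrite sumEFin lee_fin; exact: crossing_le2.
Qed.

(** The extreme heights of C are reached on its boundary, hence almost reached
   at vertices, and the closed polygon travels twice between these. *)
Lemma polygon_height_ge (e : R) :
  (forall x, 0 <= x <= 1 -> exists2 i, (i <= m)%N & ball (f x) e (f (p i))) ->
  2 * (height n xM - height n xm) <=
  \sum_(0 <= i < m) `|V n i.+1 - V n i| + 4 * e * (1 + `|n|).
Proof.
move=> near_f.
have bm : rel_boundary E C xm.
  apply: not_inner_boundary => // /(inner_height_not_min n)[y /xmP hy].
  by rewrite ltNge hy.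
have bM : rel_boundary E C xM.
  apply: not_inner_boundary => // /(inner_height_not_max n)[y /xMP hy].
  by rewrite ltNge hy.
have approx x : rel_boundary E C x ->
    exists2 i, (i <= m)%N & `|height n x - V n i| <= e * (1 + `|n|).
  rewrite -fim => -[y /=]; rewrite in_itv/= => /near_f[i im] + <-.
  rewrite ball_E3 => -[_ [h1 h2]]; exists i => //; rewrite /height.
  set u := f y in h1 h2 *; set v := f (p i) in h1 h2 *.
  have -> : u.2 - n * u.1.2 - (v.2 - n * v.1.2) = (u.2 - v.2) - n * (u.1.2 - v.1.2).
    by ring.
  apply: (le_trans (ler_normB _ _)); rewrite normrM mulrDr mulr1 lerD//.
    exact: ltW.
  by rewrite mulrC ler_wpM2r// ltW.
have [i im hi] := approx _ bM; have [j jm hj] := approx _ bm.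
have Vm : V n m = V n 0%N.
  by rewrite partition_point_last// partition_point0 f01.
have := @closed_walk_ge2 _ (fun l => V n l) m j i Vm jm im.
have := ler_norm (V n i - V n j).
move: hi hj; rewrite !ler_norml => /andP[hi1 hi2] /andP[hj1 hj2].
lra.
Qed.

End polygon.
End parametrized.
End boundary_length.

(** * The length of the boundary curve *)

Section fine_partition.
Import finmap.

(** Only finitely many of the neighbourhoods given by continuity are needed to
   cover [0, 1]; their centres are the partition points. *)
Lemma exists_fine_partition (R : realType) (f : R -> E3 R) (e : R) :
  {within `[0, 1], continuous f} -> 0 < e ->
  exists2 s : seq R, itv_partition 0 1 s & forall x, 0 <= x <= 1 ->
    exists2 i, (i <= size s)%N & ball (f x) e (f (partition_point s i)).
Proof.
move=> cf e0.
have /choice[d dP] : forall x : R, exists d : R, 0 < d /\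
    (0 <= x <= 1 -> forall y, 0 <= y <= 1 -> ball x d y -> ball (f x) e (f y)).
  move=> x; have [x01|x01] := boolP (0 <= x <= 1); last by exists 1.
  have /subspace_continuousP/(_ x) := cf.
  rewrite /= in_itv/= => /(_ x01) /(_ _ (nbhsx_ballx (f x) e e0)).
  move=> /nbhs_ballP[d /= d0 dP]; exists d; split => // _ y y01 xy.
  by apply: dP => //=; rewrite in_itv.
have cI : cover_compact (`[0, 1]%classic : set R).
  by rewrite -compact_cover; exact: segment_compact.
have [D' D'sub D'cov] : finite_subset_cover (`[0, 1]%classic : set R)
    (fun x : R => ball x (d x)) (`[0, 1]%classic : set R).
  apply: cI => [x _|x x01]; first by apply: ball_open; case: (dP x).
  by exists x => //; apply: ballxx; case: (dP x).
have D'01 x : x \in D' -> 0 <= x <= 1.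
  by move=> /D'sub /set_mem/=; rewrite in_itv.
pose s := sort <=%O (undup (1 :: [seq x <- (D' : seq R) | 0 < x])).
have sP x : (x \in s) = (x == 1) || (x \in D') && (0 < x).
  by rewrite /s mem_sort mem_undup in_cons mem_filter andbC.
have s_sorted : sorted <%O s by rewrite sort_lt_sorted undup_uniq.
have s1 : 1 \in s by rewrite sP eqxx.
have sle x : x \in s -> x <= 1.
  by rewrite sP => /orP[/eqP->//|/andP[/D'01/andP[]]].
have hs : itv_partition 0 1 s.
  split.
    rewrite lt_path_sortedE s_sorted andbT; apply/allP => x; rewrite sP.
    by move=> /orP[/eqP->//|/andP[_ ->]].
  have s0 : (0 < size s)%N by case: (s) s1.
  have last_s : last 0 s = nth 0 s (size s).-1 by rewrite nth_last.
  rewrite last_s eq_le; apply/andP; split.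
    by apply: sle; rewrite mem_nth// prednK.
  rewrite -[leLHS](nth_index 0 s1).
  have h := lt_sorted_leq_nth 0 s_sorted.
  rewrite h ?inE ?index_mem ?prednK//.
  by rewrite -ltnS prednK// index_mem.
exists s => // x x01.
have [y /= yD' yx] : cover [set` D'] (fun x : R => ball x (d x)) x.
  by apply: D'cov; rewrite /= in_itv.
have xy : ball (f y) e (f x).
  by case: (dP y) => _; apply => //; exact: D'01.
have [y0|y0] := ltP 0 y.
  have ys : y \in s by rewrite sP yD' y0 orbT.
  exists (index y s).+1; first by rewrite index_mem.
  by rewrite /partition_point/= nth_index//; exact: ball_sym.
exists 0%N => //; rewrite partition_point0.
have -> : 0 = y by have /andP[y0' _] := D'01 _ yD'; apply/eqP; rewrite eq_le y0 y0'.
exact: ball_sym.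
Qed.

End fine_partition.

Section curve_length.
Context {R : realType}.
Local Notation M := (measurableTypeR R).
Local Notation mu := (@lebesgue_measure R).
Variables (b c t : R) (C : set (E3 R)).
Local Notation E := (slope_plane b c t).
Hypotheses (CE : C `<=` E) (cC : compact C).
Hypothesis convC : forall x y s, C x -> C y -> 0 <= s <= 1 ->
  C ((1 - s) *: x + s *: y).

Lemma height_image_measure (n : R) : C !=set0 -> exists xm xM : E3 R,
  [/\ C xm, C xM, forall z, C z -> height n xm <= height n z,
      forall z, C z -> height n z <= height n xM &
      mu (height n @` C : set M) = (height n xM - height n xm)%:E].
Proof.
move=> C0; have [xm Cm mP] := height_min cC n C0; have [xM CM MP] := height_max cC n C0.
exists xm, xM; split => //.
rewrite (height_image convC Cm CM mP MP) lebesgue_measure_itv/= lte_fin -EFinB.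
case: ltP => // h.
have -> : height n xM = height n xm by apply/eqP; rewrite eq_le h mP.
by rewrite subrr.
Qed.

Let dens_ge0 n : (0 <= (chord_density b c n)%:E)%E.
Proof. by rewrite lee_fin chord_density_ge0. Qed.

Let mdens : measurable_fun setT (fun n : M => (chord_density b c n)%:E).
Proof. by apply/measurable_EFinP; exact: measurable_chord_density. Qed.

(** Finiteness is what matters: it makes the errors of polygon_height_ge
   negligible after integration over n. *)
Let integral_dens_growth : (\int[mu]_n (chord_density b c n * (1 + `|n|))%:E =
  (2 * (Num.sqrt (c ^+ 2 + 1) + Num.sqrt (b ^+ 2 + 1)))%:E)%E.
Proof.
transitivity (\int[mu]_n ((chord_density b c n * `|1 - n * 0|)%:E +
    (chord_density b c n * `|0 - n * 1|)%:E))%E.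
  apply: eq_integral => n _; rewrite -EFinD; congr EFin.
  by rewrite mulr0 subr0 normr1 mulr1 sub0r normrN mulr1 mulrDr mulr1.
rewrite ge0_integralD; last 5 first.
- exact: measurableT.
- by move=> n _; rewrite lee_fin mulr_ge0// chord_density_ge0.
- apply/measurable_EFinP; apply: measurable_funM; first exact: measurable_chord_density.
  by mfun.
- by move=> n _; rewrite lee_fin mulr_ge0// chord_density_ge0.
- apply/measurable_EFinP; apply: measurable_funM; first exact: measurable_chord_density.
  by mfun.
rewrite !integral_chord -EFinD; congr EFin; rewrite mulrDr.
by congr (2 * Num.sqrt _ + 2 * Num.sqrt _); ring.
Qed.

(** Integrating the bounds on the heights of inscribed polygons over n: the
   length of every polygon is at most the right-hand side, and that of a fine
   polygon is as close to it as desired. *)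
Lemma curve_length_boundary (f : R -> E3 R) (o : E3 R) :
  boundary_param E C f -> inner b c t C o ->
  curve_length f 0 1 =
  (\int[mu]_n ((chord_density b c n)%:E * mu (height n @` C : set M)))%E.
Proof.
move=> bf io.
have C0 : C !=set0 by exists o; apply: innerW io.
have mw := measurable_width CE cC convC.
have mdw : measurable_fun setT
    (fun n : M => (chord_density b c n)%:E * mu (height n @` C : set M))%E.
  exact: emeasurable_funM.
have dw0 n : (0 <= (chord_density b c n)%:E * mu (height n @` C : set M))%E.
  by rewrite mule_ge0.
have twice : (2%:E * \int[mu]_n ((chord_density b c n)%:E * mu (height n @` C : set M)) =
    \int[mu]_n (2%:E * ((chord_density b c n)%:E * mu (height n @` C : set M))))%E.
  by rewrite ge0_integralZl.
have mpoly (s : seq R) : measurable_fun setT (fun n : M =>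
    (chord_density b c n * \sum_(0 <= i < size s)
      `|height n (f (partition_point s i.+1)) - height n (f (partition_point s i))|)%:E).
  apply/measurable_EFinP; apply: measurable_funM; first exact: measurable_chord_density.
  by apply: measurable_sum => i; rewrite /height; mfun.
apply/eqP; rewrite eq_le; apply/andP; split.
  apply: ge_ereal_sup => _ [s hs <-].
  rewrite -(@lee_pmul2l _ 2%:E)// twice -EFinM (integral_polygon CE cC bf hs).
  apply: ge0_le_integral.
  - exact: measurableT.
  - by move=> n _; rewrite lee_fin mulr_ge0 ?chord_density_ge0//; apply: sumr_ge0.
  - exact: mpoly.
  - by apply: emeasurable_funM => //; exact: measurable_cst.
  - move=> n _; have [xm [xM [Cm CM mP MP ->]]] := height_image_measure n C0.
    rewrite -!EFinM lee_fin mulrCA ler_wpM2l ?chord_density_ge0//.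
    exact: (polygon_height_le CE cC convC bf io hs Cm CM mP MP).
apply/lee_addgt0Pr => e e0.
pose k0 := Num.sqrt (c ^+ 2 + 1) + Num.sqrt (b ^+ 2 + 1).
have k00 : 0 < k0.
  by rewrite addr_gt0// sqrtr_gt0 ltr_wpDl// sqr_ge0.
have d0 : 0 < e / (4 * k0) by rewrite divr_gt0// mulr_gt0.
have cf : {within `[0, 1], continuous f} by case: bf.
have [s hs near_f] := exists_fine_partition cf d0.
apply: (@le_trans _ _ ((polygon_length f 0 s)%:E + e%:E)%E); last first.
  by rewrite leeD2r//; apply: ereal_sup_ubound; exists s.
rewrite -(@lee_pmul2l _ 2%:E)// twice.
have -> : (2%:E * ((polygon_length f 0 s)%:E + e%:E) =
    (2 * polygon_length f 0 s)%:E + (2 * e)%:E)%E.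
  by rewrite -EFinD -EFinM mulrDr.
rewrite (integral_polygon CE cC bf hs).
have -> : (2 * e)%:E = (\int[mu]_n ((4 * (e / (4 * k0)))%:E *
    (chord_density b c n * (1 + `|n|))%:E))%E.
  rewrite ge0_integralZl; last 4 first.
  - exact: measurableT.
  - apply/measurable_EFinP; apply: measurable_funM; first exact: measurable_chord_density.
    by mfun.
  - by move=> n _; rewrite lee_fin mulr_ge0 ?chord_density_ge0// addr_ge0.
  - by rewrite lee_fin mulr_ge0// ltW.
  rewrite integral_dens_growth -EFinM -/k0; congr EFin; field.
  by rewrite gt_eqF.
rewrite -ge0_integralD; last 5 first.
- exact: measurableT.
- by move=> n _; rewrite lee_fin mulr_ge0 ?chord_density_ge0//; apply: sumr_ge0.
- exact: mpoly.
- move=> n _; apply: mule_ge0; rewrite lee_fin.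
    by rewrite mulr_ge0// ltW.
  by rewrite mulr_ge0 ?chord_density_ge0// addr_ge0.
- apply: emeasurable_funM; first exact: measurable_cst.
  apply/measurable_EFinP; apply: measurable_funM; first exact: measurable_chord_density.
  by mfun.
apply: ge0_le_integral.
- exact: measurableT.
- by move=> n _; rewrite mule_ge0.
- by apply: emeasurable_funM => //; exact: measurable_cst.
- apply: emeasurable_funD; first exact: mpoly.
  apply: emeasurable_funM; first exact: measurable_cst.
  apply/measurable_EFinP; apply: measurable_funM; first exact: measurable_chord_density.
  by mfun.
- move=> n _; have [xm [xM [Cm CM mP MP ->]]] := height_image_measure n C0.
  have h := polygon_height_ge CE bf hs Cm CM mP MP near_f.
  rewrite -!EFinM -EFinD lee_fin mulrCA [X in _ <= _ + X]mulrCA -mulrDr.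
  by rewrite ler_wpM2l ?chord_density_ge0.
Qed.

End curve_length.

(** * Polar parametrization of the boundary *)

Section angles.
Context {R : realType}.

Lemma cos_sin_inj (x y : R) : 0 <= x < 2 * pi -> 0 <= y < 2 * pi ->
  cos x = cos y -> sin x = sin y -> x = y.
Proof.
wlog xy : x y / x <= y => [hw x2 y2 cxy sxy|/andP[x0 x2] /andP[y0 y2] cxy sxy].
  have [xy|/ltW yx] := leP x y; first exact: hw.
  by apply/esym; apply: hw.
apply/eqP; rewrite eq_le xy/= leNgt; apply/negP => xy'.
pose h := (y - x) / 2.
have h0 : 0 < sin h by apply: sin_gt0_pi; rewrite /h; lra.
have : cos (h + h) = 1.
  have -> : h + h = y - x by rewrite /h; field.
  by rewrite cosB -cxy -sxy -!expr2 cos2Dsin2.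
rewrite cosD -!expr2 cos2sin2 => e.
have : 0 < sin h ^+ 2 by rewrite exprn_gt0.
lra.
Qed.

Lemma exists_angle (x y : R) : x ^+ 2 + y ^+ 2 = 1 ->
  exists2 a, 0 <= a <= 2 * pi & cos a = x /\ sin a = y.
Proof.
move=> xy1.
have x1 : -1 <= x <= 1.
  have h : x ^+ 2 <= 1 by rewrite -xy1 lerDl sqr_ge0.
  by rewrite -ler_norml -(@expr_le1 _ 2)// -normrX ger0_norm ?sqr_ge0.
have a0 := acos_ge0 x1; have api := acos_lepi x1; have pi0 := @pi_gt0 R.
have ca : cos (acos x) = x by apply: acosK; rewrite in_itv.
have sa : sin (acos x) = `|y|.
  by rewrite sin_acos// -sqrtr_sqr; congr Num.sqrt; lra.
have [y0|y0] := leP 0 y.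
  exists (acos x); last by rewrite ca sa ger0_norm.
  by rewrite a0/=; lra.
exists (2 * pi - acos x); first by apply/andP; split; lra.
have e : 2 * pi - acos x = - acos x + pi *+ 2 by rewrite mulr2n; ring.
rewrite e (cosD2pi (- acos x)) (sinD2pi (- acos x)) cosN sinN ca sa; split => //.
by rewrite ltr0_norm// opprK.
Qed.

End angles.

Section radial.
Context {R : realType}.
Variables (b c t : R) (C : set (E3 R)).
Local Notation E := (slope_plane b c t).
Hypotheses (CE : C `<=` E) (cC : compact C).
Hypothesis convC : forall x y s, C x -> C y -> 0 <= s <= 1 ->
  C ((1 - s) *: x + s *: y).
Variable o : E3 R.
Hypothesis io : inner b c t C o.

Let clC : closed C.
Proof. by apply: compact_closed => //; exact: norm_hausdorff. Qed.

Let Co : C o. Proof. exact: innerW io. Qed.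
Let Eo : E o. Proof. exact: CE. Qed.

Let ray (a r : R) : E3 R :=
  (o.1.1 - r * (b * cos a + c * sin a), o.1.2 + r * cos a, o.2 + r * sin a).

Let rayE a r : E (ray a r).
Proof. by have := Eo; rewrite /slope_plane/= => <-; ring. Qed.

Let ray0 a : ray a 0 = o.
Proof. by rewrite /ray !mul0r subr0 !addr0 -!surjective_pairing. Qed.

Let ray_conv a r s : ray a (s * r) = (1 - s) *: o + s *: ray a r.
Proof.
apply: (slope_plane_inj (b := b) (c := c) (t := t)) => //=.
- by apply: slope_plane_affine => //; exact: rayE.
- by rewrite /GRing.scale/=; ring.
- by rewrite /GRing.scale/=; ring.
Qed.

Let continuous_ray_r a : continuous (ray a).
Proof.
move=> r; apply: (@continuous_E3 R R r (fun r => o.1.1 - r * (b * cos a + c * sin a))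
  (fun r => o.1.2 + r * cos a) (fun r => o.2 + r * sin a));
  by apply: differentiable_continuous; apply/derivable1_diffP; apply: ex_derive.
Qed.

Let continuous_ray_a r : continuous (ray^~ r).
Proof.
move=> a; apply: (@continuous_E3 R R a (fun a => o.1.1 - r * (b * cos a + c * sin a))
  (fun a => o.1.2 + r * cos a) (fun a => o.2 + r * sin a));
  by apply: differentiable_continuous; apply/derivable1_diffP; apply: ex_derive.
Qed.

Let C_bounded : exists N : R, forall x, C x -> `|x.1.2 - o.1.2| <= N /\ `|x.2 - o.2| <= N.
Proof.
have [N [_ hN]] := compact_bounded cC.
exists (N + 1 + (N + 1)) => x Cx.
have h (y : E3 R) : C y -> `|y.1.2| <= N + 1 /\ `|y.2| <= N + 1.
  move=> Cy; have : `|y| <= N + 1 by apply: (hN (N + 1)) => //; rewrite ltrDl.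
  by rewrite !ge_max => /andP[/andP[]].
have [hx1 hx2] := h x Cx; have [ho1 ho2] := h o Co.
by split; apply: (le_trans (ler_normB _ _)); exact: lerD.
Qed.

Let exists_rho a : exists rho : R, [/\ 0 <= rho, C (ray a rho) &
  forall r, 0 <= r -> C (ray a r) -> r <= rho].
Proof.
have [N hN] := C_bounded.
have bnd r : 0 <= r -> C (ray a r) -> r <= 2 * N.
  move=> r0 /hN[]; rewrite /= !(addrC _ (r * _)) !addrK !normrM (ger0_norm r0) => h1 h2.
  have N0 : 0 <= N by apply: le_trans h1; rewrite mulr_ge0.
  have cs : 1 <= `|cos a| + `|sin a|.
    rewrite -(cos2Dsin2 a) -(real_normK (num_real (cos a))) -(real_normK (num_real (sin a))).
    rewrite lerD// expr2 ler_piMl//; [exact: cos_max|exact: sin_max].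
  apply: (@le_trans _ _ (r * (`|cos a| + `|sin a|))); first by rewrite ler_peMr.
  by rewrite mulrDr mulr2n mulrDl mul1r lerD.
pose T := `[0, 2 * N]%classic `&` ray a @^-1` C.
have cT : compact T.
  apply: (@subclosed_compact _ _ `[0, 2 * N]%classic).
  - apply: closedI; first exact: itv_closed.
    by apply: closed_comp => // x _; exact: continuous_ray_r.
  - exact: segment_compact.
  - by move=> x [].
have T0 : T !=set0.
  exists 0; split; last by rewrite /= ray0.
  rewrite /= in_itv/= lexx/=; apply: bnd => //.
  by rewrite ray0.
have cid : {within T, continuous (id : R -> R)}.
  by apply: continuous_subspaceT => x; exact: cvg_id.
have [rho /set_mem[/=]] := compact_EVT_max T0 cT cid.
rewrite in_itv/= => /andP[rho0 _] Crho rhoM; exists rho; split => // r r0 Cr.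
by apply: rhoM; apply/mem_set; split => //=; rewrite in_itv/= r0 bnd.
Qed.

(** Distance at which the ray of angle a leaves C. *)
Let rho (a : R) : R := sval (cid (exists_rho a)).

Let rho_ge0 a : 0 <= rho a. Proof. by case: (svalP (cid (exists_rho a))). Qed.

Let C_rho a : C (ray a (rho a)). Proof. by case: (svalP (cid (exists_rho a))). Qed.

Let rho_max a r : 0 <= r -> C (ray a r) -> r <= rho a.
Proof. by case: (svalP (cid (exists_rho a))) => _ _; apply. Qed.

Let inner_near x : inner b c t C x -> exists2 d : R, 0 < d &
  forall y, E y -> ball x d y -> C y.
Proof.
move=> [Ex [d d0 dC]]; exists d => // y Ey; rewrite ball_E3 => -[_ [h1 h2]].
by apply: dC => //; rewrite distrC.
Qed.

Let inner_ray_succ a r : inner b c t C (ray a r) -> exists2 e : R, 0 < e & C (ray a (r + e)).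
Proof.
move=> /inner_near[d d0 dC].
have := @continuous_ray_r a r _ (nbhsx_ballx (ray a r) d d0).
move=> /nbhs_ballP[e /= e0 he]; exists (e / 2); first by rewrite divr_gt0.
apply: dC; first exact: rayE.
apply: he; rewrite /ball/= opprD addrA subrr sub0r normrN gtr0_norm ?divr_gt0//.
by rewrite ltr_pdivrMr// mulr_natr mulr2n ltrDl.
Qed.

Let rho_gt0 a : 0 < rho a.
Proof.
have [e e0 Ce] : exists2 e : R, 0 < e & C (ray a (0 + e)).
  by apply: inner_ray_succ; rewrite ray0.
by apply: lt_le_trans (rho_max _ Ce); rewrite add0r// ltW.
Qed.

Let inner_ray a r : 0 <= r < rho a -> inner b c t C (ray a r).
Proof.
move=> /andP[r0 rrho]; have rN : rho a != 0 by rewrite gt_eqF.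
have -> : r = r / rho a * rho a by rewrite divfK.
rewrite ray_conv; apply: inner_segment => //.
by rewrite divr_ge0 ?rho_ge0//= ltr_pdivrMr// mul1r.
Qed.

Let C_ray a r : 0 <= r <= rho a -> C (ray a r).
Proof.
move=> /andP[r0]; rewrite le_eqVlt => /predU1P[->//|h].
by apply: innerW (inner_ray _); rewrite r0.
Qed.

Let boundary_ray a : rel_boundary E C (ray a (rho a)).
Proof.
apply: not_inner_boundary => // /inner_ray_succ[e e0 Ce].
have := rho_max (addr_ge0 (rho_ge0 a) (ltW e0)) Ce.
by rewrite gerDl leNgt e0.
Qed.

Let boundary_is_ray x : rel_boundary E C x ->
  exists2 a, 0 <= a <= 2 * pi & x = ray a (rho a).
Proof.
move=> bx; have Cx : C x by exact: boundary_sub bx.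
have Ex := CE Cx.
pose u := x.1.2 - o.1.2; pose v := x.2 - o.2; pose r := Num.sqrt (u ^+ 2 + v ^+ 2).
have uv0 : 0 < u ^+ 2 + v ^+ 2.
  rewrite lt_neqAle addr_ge0 ?sqr_ge0// andbT eq_sym paddr_eq0 ?sqr_ge0//.
  rewrite !sqrf_eq0; apply/negP => /andP[/eqP u0 /eqP v0].
  apply: (inner_not_boundary io).
  suff -> : o = x by [].
  apply: (slope_plane_inj (b := b) (c := c) (t := t)) => //.
    by apply/eqP; rewrite eq_sym -subr_eq0; apply/eqP.
  by apply/eqP; rewrite eq_sym -subr_eq0; apply/eqP.
have r0 : 0 < r by rewrite sqrtr_gt0.
have rN : r != 0 by rewrite gt_eqF.
have r2 : r ^+ 2 = u ^+ 2 + v ^+ 2 by rewrite sqr_sqrtr// ltW.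
have [a a2 [ca sa]] : exists2 a, 0 <= a <= 2 * pi & cos a = u / r /\ sin a = v / r.
  by apply: exists_angle; rewrite !expr_div_n -mulrDl -r2 divff// expf_neq0.
have xr : x = ray a r.
  apply: (slope_plane_inj (b := b) (c := c) (t := t)) => //=.
  - by rewrite ca mulrCA divff// mulr1 /u addrC subrK.
  - by rewrite sa mulrCA divff// mulr1 /v addrC subrK.
exists a => //; rewrite {1}xr; congr ray; apply/eqP; rewrite eq_le.
have rrho : r <= rho a by apply: rho_max; [exact: ltW|rewrite -xr].
rewrite rrho /= leNgt; apply/negP => h; apply: (inner_not_boundary _ bx).
by rewrite xr; apply: inner_ray; rewrite ltW.
Qed.

(** Slightly before the exit point the ray is at an inner point of C, and
   slightly after it is in the open complement of C; both persist for nearby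
   angles. *)
Let continuous_rho : continuous rho.
Proof.
move=> a; apply/cvgrPdist_le => e e0.
have [low_in low0] : inner b c t C (ray a (Num.max 0 (rho a - e))) /\
    0 <= Num.max 0 (rho a - e).
  by split; [apply: inner_ray|]; rewrite le_max lexx//= gt_max rho_gt0 ltrBlDl ltrDr.
have [d d0 dC] := inner_near low_in.
have nup : (~` C) (ray a (rho a + e)).
  move=> /(rho_max (addr_ge0 (rho_ge0 a) (ltW e0))).
  by rewrite gerDl leNgt e0.
near=> a'.
have h1 : Num.max 0 (rho a - e) <= rho a'.
  apply: rho_max => //; apply: dC; first exact: rayE.
  near: a'; exact: (@continuous_ray_a _ a _ (nbhsx_ballx _ d d0)).
have h2 : ~ C (ray a' (rho a + e)).
  near: a'; apply: (@continuous_ray_a (rho a + e) a (~` C)).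
  by apply: open_nbhs_nbhs; split => //; exact: closed_openC.
have h3 : rho a' <= rho a + e.
  rewrite leNgt; apply/negP => h; apply: h2; apply: C_ray.
  by rewrite addr_ge0 ?rho_ge0 ?(ltW e0)// ltW.
move: h1; rewrite ge_max => /andP[_ h1].
by rewrite ler_norml; apply/andP; split; lra.
Unshelve. all: by end_near. Qed.

Let ray_inj a a' r r' : 0 < r -> 0 < r' -> 0 <= a < 2 * pi -> 0 <= a' < 2 * pi ->
  ray a r = ray a' r' -> a = a'.
Proof.
move=> r0 r'0 a2 a'2 e.
have e1 : r * cos a = r' * cos a'.
  by have := congr1 (fun x : E3 R => x.1.2) e => /= /addrI.
have e2 : r * sin a = r' * sin a'.
  by have := congr1 (fun x : E3 R => x.2) e => /= /addrI.
have rr : r = r'.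
  apply/eqP; rewrite -(@eqrXn2 _ 2)// ?ltW//; apply/eqP.
  rewrite -[LHS]mulr1 -(cos2Dsin2 a) -[RHS]mulr1 -(cos2Dsin2 a') !mulrDr -!exprMn.
  by rewrite e1 e2.
have rN : r != 0 by rewrite gt_eqF.
apply: cos_sin_inj => //; first by apply: (mulfI rN); rewrite e1 rr.
by apply: (mulfI rN); rewrite e2 rr.
Qed.

(** Each ray from the inner point o leaves C at a single boundary point, which
   depends continuously on the angle. *)
Lemma exists_boundary_param : boundary_param E C !=set0.
Proof.
have pi0 := @pi_gt0 R.
have ray2pi r : ray (2 * pi) r = ray 0 r.
  by rewrite /ray mulr_natl cos2pi sin2pi cos0 sin0.
exists (fun s => ray (2 * pi * s) (rho (2 * pi * s))); split.
- apply: continuous_subspaceT => s.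
  have ca : {for s, continuous (fun s : R => 2 * pi * s)}.
    by apply: differentiable_continuous; apply/derivable1_diffP; apply: ex_derive.
  have cr : {for s, continuous (fun s : R => rho (2 * pi * s))}.
    by apply: (continuous_comp ca); exact: continuous_rho.
  have cc : {for s, continuous (fun s : R => cos (2 * pi * s))}.
    by apply: (continuous_comp ca); exact: continuous_cos.
  have cs : {for s, continuous (fun s : R => sin (2 * pi * s))}.
    by apply: (continuous_comp ca); exact: continuous_sin.
  apply: (@continuous_E3 R R s
    (fun s => o.1.1 - rho (2 * pi * s) * (b * cos (2 * pi * s) + c * sin (2 * pi * s)))
    (fun s => o.1.2 + rho (2 * pi * s) * cos (2 * pi * s))
    (fun s => o.2 + rho (2 * pi * s) * sin (2 * pi * s))).
  + apply: continuousB; first exact: cst_continuous.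
    apply: continuousM; first exact: cr.
    by apply: continuousD; apply: continuousM => //; exact: cst_continuous.
  + by apply: continuousD; [exact: cst_continuous|apply: continuousM].
  + by apply: continuousD; [exact: cst_continuous|apply: continuousM].
- rewrite mulr0 mulr1 ray2pi; congr ray; apply/eqP; rewrite eq_le.
  by apply/andP; split; apply: rho_max => //; [rewrite ray2pi|rewrite -ray2pi].
- move=> s s'; rewrite !in_itv/= => /andP[s0 s1] /andP[s'0 s'1] e.
  have pp : 0 < 2 * pi :> R by rewrite mulr_gt0.
  apply: (mulfI (lt0r_neq0 pp)); apply: ray_inj e => //.
    by rewrite mulr_ge0 ?(ltW pp)//= gtr_pMr.
  by rewrite mulr_ge0 ?(ltW pp)//= gtr_pMr.
- apply/seteqP; split => x /=; first by move=> [s _ <-]; exact: boundary_ray.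
  move=> /boundary_is_ray[a /andP[a0 a2] ->].
  have pp : 2 * pi != 0 :> R by rewrite mulf_neq0// gt_eqF.
  exists (a / (2 * pi)); last by rewrite mulrCA divff// mulr1.
  have pp0 : 0 < 2 * pi :> R by rewrite mulr_gt0.
  by rewrite in_itv/= ler_pdivlMr// mul0r a0/= ler_pdivrMr// mul1r.
Qed.

End radial.

(** * The perimeter *)

Section flat_dichotomy.
Context {R : realType}.
Variables (b c t : R) (C : set (E3 R)).
Local Notation E := (slope_plane b c t).
Hypotheses (CE : C `<=` E) (cC : compact C).
Hypothesis convC : forall x y s, C x -> C y -> 0 <= s <= 1 ->
  C ((1 - s) *: x + s *: y).

(** Twice the signed area of the triangle projected on the last two
   coordinates. *)
Let area (x y z : E3 R) : R :=
  (y.1.2 - x.1.2) * (z.2 - x.2) - (y.2 - x.2) * (z.1.2 - x.1.2).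

Let conv3 x y z r s : C x -> C y -> C z -> 0 <= r -> 0 <= s -> r + s <= 1 ->
  C ((1 - r - s) *: x + r *: y + s *: z).
Proof.
move=> Cx Cy Cz r0 s0 rs1.
have [rs0|rs0] := eqVneq (r + s) 0.
  have r00 : r = 0 by lra.
  have s00 : s = 0 by lra.
  by rewrite r00 s00 !scale0r !addr0 !subr0 scale1r.
have -> : (1 - r - s) *: x + r *: y + s *: z =
    (1 - (r + s)) *: x + (r + s) *: ((1 - s / (r + s)) *: y + (s / (r + s)) *: z).
  have e1 : 1 - (r + s) = 1 - r - s by ring.
  have e2 : (r + s) * (1 - s / (r + s)) = r by field.
  have e3 : (r + s) * (s / (r + s)) = s by field.
  by rewrite scalerDr !scalerA e1 e2 e3 addrA.
apply: convC => //; last by rewrite rs1 addr_ge0.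
have rsp : 0 < r + s by rewrite lt_neqAle eq_sym rs0 addr_ge0.
by apply: convC => //; rewrite ler_pdivlMr// mul0r s0/= ler_pdivrMr// mul1r lerDr.
Qed.

(** Barycentric coordinates are affine, with slopes at most S / |area|, and equal
   1 / 3 at the barycentre: they remain non-negative nearby. *)
Let triangle_inner x y z : C x -> C y -> C z -> area x y z != 0 ->
  inner b c t C (3^-1 *: (x + y + z)).
Proof.
move=> Cx Cy Cz A0.
have Ex := CE Cx; have Ey := CE Cy; have Ez := CE Cz.
set o := 3^-1 *: _.
have Eo : E o.
  by move: Ex Ey Ez; rewrite /slope_plane/o/= /GRing.scale/=; lra.
pose S := 1 + `|y.1.2 - x.1.2| + `|y.2 - x.2| + `|z.1.2 - x.1.2| + `|z.2 - x.2|.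
have n0 (u : R) : 0 <= `|u| by [].
have S0 : 0 < S.
  rewrite /S; have := n0 (y.1.2 - x.1.2); have := n0 (y.2 - x.2).
  have := n0 (z.1.2 - x.1.2); have := n0 (z.2 - x.2); lra.
have nA0 : 0 < `|area x y z| by rewrite normr_gt0.
split => //; exists (`|area x y z| / (6 * S)); first by rewrite divr_gt0// mulr_gt0.
move=> w Ew w1 w2.
pose r := ((w.1.2 - x.1.2) * (z.2 - x.2) - (w.2 - x.2) * (z.1.2 - x.1.2)) / area x y z.
pose s := ((y.1.2 - x.1.2) * (w.2 - x.2) - (y.2 - x.2) * (w.1.2 - x.1.2)) / area x y z.
have bound (u v : R) : `|u| + `|v| <= S ->
    `|((w.1.2 - o.1.2) * u - (w.2 - o.2) * v) / area x y z| <= 6^-1.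
  move=> uvS; rewrite normrM normfV ler_pdivrMr//.
  apply: (le_trans (ler_normB _ _)); rewrite !normrM.
  set d := `|area x y z| / (6 * S) in w1 w2.
  have d0 : 0 <= d by rewrite ltW// divr_gt0// mulr_gt0.
  have -> : 6^-1 * `|area x y z| = d * S by rewrite /d; field; rewrite gt_eqF.
  apply: (@le_trans _ _ (d * `|u| + d * `|v|)).
    by rewrite lerD// ler_wpM2r// ltW.
  by rewrite -mulrDr ler_wpM2l.
have A0' : (y.1.2 - x.1.2) * (z.2 - x.2) - (y.2 - x.2) * (z.1.2 - x.1.2) != 0 := A0.
have rE : r = 3^-1 + ((w.1.2 - o.1.2) * (z.2 - x.2) - (w.2 - o.2) * (z.1.2 - x.1.2)) / area x y z.
  by rewrite /r /o /area /= /GRing.scale/=; field.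
have sE : s = 3^-1 + ((w.1.2 - o.1.2) * (- (y.2 - x.2)) - (w.2 - o.2) * (- (y.1.2 - x.1.2))) / area x y z.
  by rewrite /s /o /area /= /GRing.scale/=; field.
have := bound (z.2 - x.2) (z.1.2 - x.1.2); have := bound (- (y.2 - x.2)) (- (y.1.2 - x.1.2)).
rewrite !normrN /S => hs hr.
have {hr} : `|r - 3^-1| <= 6^-1.
  rewrite rE addrC addKr; apply: hr.
  have := n0 (y.1.2 - x.1.2); have := n0 (y.2 - x.2); lra.
have {hs} : `|s - 3^-1| <= 6^-1.
  rewrite sE addrC addKr; apply: hs.
  have := n0 (z.1.2 - x.1.2); have := n0 (z.2 - x.2); lra.
rewrite !ler_norml => /andP[s1 s2] /andP[r1 r2].
have Cw : C ((1 - r - s) *: x + r *: y + s *: z) by apply: conv3 => //; lra.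
suff -> : w = (1 - r - s) *: x + r *: y + s *: z by [].
apply: (slope_plane_inj (b := b) (c := c) (t := t)) => //=; first exact: CE.
- by rewrite /r /s /area /GRing.scale/=; field.
- by rewrite /r /s /area /GRing.scale/=; field.
Qed.

Let collinear_segment x y : C x -> C y -> x <> y ->
  (forall z, C z -> area x y z = 0) -> exists p q, C = segment p q.
Proof.
move=> Cx Cy xy A0.
(* a slope for which the height is not constant on the line *)
have [n hn] : exists n : R, (y.2 - x.2) - n * (y.1.2 - x.1.2) != 0.
  have [y2|y2] := eqVneq (y.2 - x.2) 0; last by exists 0; rewrite mul0r subr0.
  exists 1; rewrite y2 sub0r mul1r oppr_eq0; apply/eqP => y1; apply: xy.
  apply: (slope_plane_inj (b := b) (c := c) (t := t)); [exact: CE|exact: CE| |].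
    by apply/eqP; rewrite eq_sym -subr_eq0 y1.
  by apply/eqP; rewrite eq_sym -subr_eq0 y2.
have C0 : C !=set0 by exists x.
have [p Cp pm] := height_min cC n C0; have [q Cq qM] := height_max cC n C0.
have line_inj u v : E u -> E v -> area x y u = 0 -> area x y v = 0 ->
    height n u = height n v -> u = v.
  move=> Eu Ev; rewrite /area /height => au av huv.
  have h1 : (u.1.2 - v.1.2) * ((y.2 - x.2) - n * (y.1.2 - x.1.2)) = 0.
    have : u.2 - v.2 = n * (u.1.2 - v.1.2) by lra.
    move=> e; have : (y.1.2 - x.1.2) * (u.2 - v.2) - (y.2 - x.2) * (u.1.2 - v.1.2) = 0 by lra.
    by rewrite e => e'; rewrite -[RHS]oppr0 -e'; ring.
  have u1 : u.1.2 = v.1.2.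
    by move/eqP: h1; rewrite mulf_eq0 (negbTE hn) orbF subr_eq0 => /eqP.
  apply: (slope_plane_height_inj (b := b) (c := c) (t := t) (n := n)) => //.
have area_conv s : area x y ((1 - s) *: p + s *: q) = 0.
  transitivity ((1 - s) * area x y p + s * area x y q).
    by rewrite /area/= /GRing.scale/=; ring.
  by rewrite !A0// !mulr0 addr0.
exists p, q; apply/seteqP; split => z; last first.
  by move=> [s /=]; rewrite in_itv/= => s01 <-; exact: convC.
move=> Cz.
have [pq|] := ltP (height n p) (height n q); last first.
  move=> qp; exists 0; first by rewrite /= in_itv/= lexx ler01.
  rewrite subr0 scale1r scale0r addr0; apply: line_inj; [exact: CE|exact: CE|exact: A0|exact: A0|].
  by apply/eqP; rewrite eq_le pm// (le_trans (qM _ Cz)).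
have pq0 : 0 < height n q - height n p by rewrite subr_gt0.
exists ((height n z - height n p) / (height n q - height n p)).
  by rewrite /= in_itv/= ler_pdivlMr// mul0r subr_ge0 pm//= ler_pdivrMr// mul1r lerD2r qM.
apply: line_inj; [|exact: CE| exact: area_conv|exact: A0|].
  by apply: slope_plane_affine; exact: CE.
by rewrite height_affine; field; rewrite gt_eqF.
Qed.

(** Three points of C that are not aligned make their barycentre an inner
   point. *)
Lemma segment_or_inner : C !=set0 ->
  (exists p q, C = segment p q) \/ exists o, inner b c t C o.
Proof.
move=> [x Cx].
have [[y [Cy xy]]|hx] := pselect (exists y, C y /\ x <> y); last first.
  left; exists x, x; apply/seteqP; split => z.
    move=> Cz; exists 0; first by rewrite /= in_itv/= lexx ler01.
    rewrite subr0 scale1r scale0r addr0; apply: contrapT => xz.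
    by apply: hx; exists z.
  by move=> [s _ <-]; rewrite -scalerDl subrK scale1r.
have [[z [Cz /eqP az]]|hz] := pselect (exists z, C z /\ area x y z <> 0).
  by right; exists (3^-1 *: (x + y + z)); exact: triangle_inner.
left; apply: (collinear_segment Cx Cy xy) => z Cz.
by apply: contrapT => az; apply: hz; exists z.
Qed.

End flat_dichotomy.

Section perimeter_formula.
Context {R : realType}.
Local Notation M := (measurableTypeR R).
Local Notation mu := (@lebesgue_measure R).
Variables (b c t : R) (C : set (E3 R)).
Local Notation E := (slope_plane b c t).
Hypotheses (CE : C `<=` E) (cC : compact C).
Hypothesis convC : forall x y s, C x -> C y -> 0 <= s <= 1 ->
  C ((1 - s) *: x + s *: y).

Let segment_width x y : C = segment x y ->
  ((2 * enorm (y - x))%:E =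
   \int[mu]_n ((chord_density b c n)%:E * mu (height n @` C : set M)))%E.
Proof.
move=> Cxy.
have Cx : C x.
  rewrite Cxy; exists 0; first by rewrite /= in_itv/= lexx ler01.
  by rewrite subr0 scale1r scale0r addr0.
have Cy : C y.
  rewrite Cxy; exists 1; first by rewrite /= in_itv/= lexx ler01.
  by rewrite subrr scale1r scale0r add0r.
have C0 : C !=set0 by exists x.
rewrite -(integral_edge (CE Cy) (CE Cx)); apply: eq_integral => n _.
have [xm [xM [Cm CM mP MP ->]]] := height_image_measure cC convC n C0.
rewrite -EFinM; congr (_ * _)%:E.
have seg z : C z -> exists2 s, 0 <= s <= 1 &
    height n z = (1 - s) * height n x + s * height n y.
  rewrite {1}Cxy => -[s /=]; rewrite in_itv/= => s01 <-.
  by exists s => //; exact: height_affine.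
have [s1 s101 e1] := seg _ Cm; have [s2 s201 e2] := seg _ CM.
have := mP _ Cx; have := mP _ Cy; have := MP _ Cx; have := MP _ Cy.
rewrite e1 e2; move: s101 s201 => /andP[? ?] /andP[? ?].
set hx := height n x; set hy := height n y => h1 h2 h3 h4.
have [h|h] := leP hx hy.
  by rewrite ger0_norm ?subr_ge0//; apply/eqP; rewrite eq_le; apply/andP; split; nra.
rewrite ltr0_norm ?subr_lt0// opprB; apply/eqP; rewrite eq_le; apply/andP; split; nra.
Qed.

(** Cauchy's formula, the width of C in each direction being measured by its
   image under the height. In each case of the definition, all members of the
   set under the infimum are equal to the integral. *)
Lemma perimeterE : perimeter E C =
  (\int[mu]_n ((chord_density b c n)%:E * mu (height n @` C : set M)))%E.
Proof.
rewrite /perimeter; case: pselect => [C0|C0] /=.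
  rewrite C0 integral0_eq// => n _; rewrite image_set0.
  by rewrite measure0 mule0.
set I := (X in _ = X).
case: pselect => [[p [q Cpq]]|nseg] /=.
  rewrite (_ : [set _ | _ in _] = [set I]) ?ereal_inf1//.
  apply/seteqP; split => x /=.
    by move=> [[p' q'] /= Cpq' <-]; rewrite (segment_width Cpq').
  by move=> ->; exists (p, q) => //=; rewrite (segment_width Cpq).
have CN0 : C !=set0 by apply/set0P/eqP.
have [|[z iz]] := segment_or_inner CE cC convC CN0; first by [].
have [f0 bf0] := exists_boundary_param CE cC convC iz.
rewrite (_ : [set _ | _ in _] = [set I]) ?ereal_inf1//.
apply/seteqP; split => x /=.
  by move=> [f bf <-]; rewrite (curve_length_boundary CE cC convC bf iz).
by move=> ->; exists f0 => //; rewrite (curve_length_boundary CE cC convC bf0 iz).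
Qed.

End perimeter_formula.

(** * Null sets and the area of the sphere *)

Section null_set.
Local Open Scope ereal_scope.
Context d (T : measurableType d) (R : realType).
Variable mu : {measure set T -> \bar R}.

Import HBNNSimple.

(** Removing a null set does not change the integral of a non-negative
   function, be it measurable or not: the integral is a supremum over simple
   functions below it, and these can be cut off on the null set. *)
Lemma ge0_integral_setD_null (D N : set T) (f : T -> \bar R) :
  measurable N -> mu N = 0 -> (forall x, 0 <= f x) ->
  \int[mu]_(x in D `\` N) f x = \int[mu]_(x in D) f x.
Proof.
move=> mN N0 f0; rewrite !ge0_integralE//.
apply/eqP; rewrite eq_le; apply/andP; split; apply: ge_ereal_sup => _ [h /= hf <-].
  apply: ereal_sup_ubound; exists h => //= x; apply: le_trans (hf x) _.
  rewrite !patchE in_setD; case: (x \in D) => //=.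
  by case: (x \in N).
have mNC : measurable (~` N) by exact: measurableC.
apply: ereal_sup_ubound; exists (proj_nnsfun h mNC) => [x /=|].
  have := hf x; rewrite !patchE in_setD mindicE in_setC.
  by case: (x \in N) => /=; rewrite ?mulr0 ?mulr1 ?andbT ?andbF.
rewrite -!integralT_nnsfun.
rewrite [RHS](@ge0_negligible_integral _ _ _ mu setT N)//; last 2 first.
- exact/measurable_EFinP.
- by move=> x _; rewrite lee_fin.
rewrite setTD [RHS]integral_mkcond; apply: eq_integral => x _.
by rewrite patchE /= mindicE; case: ifP => _; rewrite ?mulr1 ?mulr0.
Qed.

End null_set.

Section sphere_area.
Local Open Scope ereal_scope.
Context {R : realType}.
Local Notation M := (measurableTypeR R).
Local Notation mu := (@lebesgue_measure R).

Lemma sphere_area : @sphere_measure R setT = (4 * pi)%:E.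
Proof.
have pi0 := @pi_gt0 R.
transitivity (\int[@sphere_measure R]_u (cst 1 u)).
  by rewrite integral_cst// mul1e.
rewrite integral_sphere_measure; [|exact: measurable_cst|by []].
have cosI : \int[mu]_(p in `[(- (pi / 2))%R, (pi / 2)%R]) (`|cos p|)%:E = 2%:E.
  transitivity (\int[mu]_(p in `[(- (pi / 2))%R, (pi / 2)%R]) (cos p)%:E).
    apply: eq_integral => p /[!inE]/=; rewrite in_itv/= => hp.
    by rewrite ger0_norm// cos_ge0_pihalf.
  rewrite (@continuous_FTC2 _ _ (@sin R)).
  - by rewrite sinN sin_pihalf -EFinB; congr EFin; ring.
  - by lra.
  - by apply: continuous_subspaceT => x; exact: continuous_cos.
  - split.
    + by move=> x _; exact: derivable_sin.
    + by apply: cvg_at_right_filter; exact: continuous_sin.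
    + by apply: cvg_at_left_filter; exact: continuous_sin.
  - by move=> x _; rewrite derive1E; apply: derive_val.
transitivity (\int[mu]_(f in `[0%R, (2 * pi)%R]) (cst 2%:E f)).
  apply: eq_integral => f _ /=; rewrite -cosI; apply: eq_integral => p _.
  by rewrite mule1.
rewrite integral_cst; last exact: measurable_itv.
transitivity (2%:E * mu `[0%R, (2 * pi)%R]%classic); first by [].
rewrite lebesgue_measure_itv/= lte_fin mulr_gt0// -EFinB -EFinM.
by congr EFin; ring.
Qed.

Let sphere_measure_fin : fin_num_fun (@sphere_measure R).
Proof.
move=> A mA; rewrite ge0_fin_numE//.
apply: (@le_lt_trans _ _ (@sphere_measure R setT)).
  by apply: le_measure; rewrite ?inE.
by rewrite sphere_area ltry.
Qed.

HB.instance Definition _ := @Measure_isFinite.Build _ _ _ (@sphere_measure R)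
  sphere_measure_fin.

(** The central projection covers half of the sphere. *)
Lemma integral_gnomonic_weight :
  \int[mu]_p \int[mu]_n (gnomonic_weight p n)%:E = (2 * pi)%:E :> \bar R.
Proof.
have mw : measurable_fun setT (fun z : M * M => (gnomonic_weight z.1 z.2)%:E).
  by apply/measurable_EFinP; apply: measurable_gnomonic_weight; mfun.
have w0 p n : 0 <= (gnomonic_weight p n)%:E :> \bar R.
  by rewrite lee_fin gnomonic_weight_ge0.
have mwp p : measurable_fun setT (fun n : M => (gnomonic_weight p n)%:E).
  by apply/measurable_EFinP; apply: measurable_gnomonic_weight; mfun.
have := @integral_gnomonic_x R (cst 1) (measurable_cst _) (fun=> lee01).
rewrite integral_cst// mul1e; rewrite [X in X = _ -> _]sphere_area.
have -> : \int[mu]_p \int[mu]_n ((gnomonic_weight p n)%:E *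
    (cst 1 (gnomonic_x p n) + cst 1 (- gnomonic_x p n)%R)) =
    2%:E * \int[mu]_p \int[mu]_n (gnomonic_weight p n)%:E.
  rewrite -ge0_integralZl//; last 2 first.
  - exact: (@measurable_fun_integral _ _ _ _ _ mu _ mw w0).
  - by move=> p _; exact: integral_ge0.
  apply: eq_integral => p _; rewrite -ge0_integralZl//.
  by apply: eq_integral => n _; rewrite /= muleC -EFinD.
move=> e; set I := (X in X = _); rewrite -/I in e.
have -> : I = (2^-1)%:E * (2%:E * I) by rewrite muleA -EFinM mulVf// mul1e.
by rewrite -e -EFinM; congr EFin; field.
Qed.

End sphere_area.

(** * Lines that meet K *)

Section crofton.
Local Open Scope ereal_scope.
Context {R : realType}.
Local Notation M := (measurableTypeR R).
Local Notation mu := (@lebesgue_measure R).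
Local Notation mu2 := (@lebesgue2 R).
Local Notation mu3 := (@lebesgue3 R).
Variable K : set (E3 R).
Hypothesis cK : compact K.
Hypothesis convK : forall (x y : E3 R) (s : R), K x -> K y -> (0 <= s <= 1)%R ->
  K ((1 - s) *: x + s *: y)%R.

Let clK : closed K.
Proof. by apply: compact_closed => //; exact: norm_hausdorff. Qed.

Let line_point (z : E3 R * (M * M)) (s : R) : E3 R :=
  (z.1.1.1 + s * z.2.1, z.1.1.2 + s, z.1.2 + s * z.2.2)%R.

(** Pairs of a point and a direction (p, 1, n) whose line meets K. *)
Let hit : set (E3 R * (M * M)) := [set z | exists s, K (line_point z s)].

Let measurable_hit : measurable hit.
Proof.
apply: measurable_meets => //.
  by move=> s; rewrite /line_point; mfun.
move=> z s; apply: (@continuous_E3 R R s (fun s => z.1.1.1 + s * z.2.1)%R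
  (fun s => z.1.1.2 + s)%R (fun s => z.1.2 + s * z.2.2)%R);
  by apply: differentiable_continuous; apply/derivable1_diffP; apply: ex_derive.
Qed.

(** Including the density of directions in X makes the functions m and Q below
   plain Lebesgue integrals. *)
Let X (z : E3 R * (M * M)) : \bar R := (gnomonic_weight z.2.1 z.2.2 * \1_hit z)%:E.

Let X0 z : 0 <= X z.
Proof. by rewrite lee_fin mulr_ge0 ?gnomonic_weight_ge0. Qed.

Let mX : measurable_fun setT X.
Proof.
apply/measurable_EFinP; apply: measurable_funM; last exact: measurable_indic.
by apply: measurable_gnomonic_weight; mfun.
Qed.

Let indic_eq d1 d2 (T1 : measurableType d1) (T2 : measurableType d2)
    (A : set T1) (B : set T2) x y : (A x <-> B y) -> \1_A x = \1_B y :> R.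
Proof.
by move=> AB; rewrite !indicE; congr (_%:R); congr nat_of_bool;
  apply/idP/idP; rewrite !inE => /AB.
Qed.

Let Xinv (x y z p n : R) :
  X ((x - y * p, 0, z - y * n)%R, (p, n)) = X ((x, y, z), (p, n)).
Proof.
rewrite /X /=; congr (_ * _)%:E; apply: indic_eq; split => -[s Ks].
  exists (s - y)%R; move: Ks; rewrite /line_point/=.
  by congr (K (_, _, _)); ring.
exists (s + y)%R; move: Ks; rewrite /line_point/=.
by congr (K (_, _, _)); ring.
Qed.

(** * Lines of a plane *)

(** Integral of X over the lines of the plane x + b * y + c * z = t. *)
Let Q (b c t : R) : \bar R :=
  \int[mu]_n \int[mu]_k X ((t - c * k, 0, k)%R, ((- b - c * n)%R, n)).

Let Q0 b c t : 0 <= Q b c t.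
Proof. by apply: integral_ge0 => n _; apply: integral_ge0. Qed.

Let mQ d (T : measurableType d) (b c t : T -> M) :
  measurable_fun setT b -> measurable_fun setT c -> measurable_fun setT t ->
  measurable_fun setT (fun z => Q (b z) (c z) (t z)).
Proof.
move=> mb mc mt.
apply: (@measurable_fun_integral _ _ _ _ _ mu (fun z n =>
  \int[mu]_k X ((t z - c z * k, 0, k)%R, ((- b z - c z * n)%R, n)))).
  apply: (@measurable_fun_integral _ _ _ _ _ mu (fun (z : T * M) k =>
    X ((t z.1 - c z.1 * k, 0, k)%R, ((- b z.1 - c z.1 * z.2)%R, z.2)))).
    apply: (measurableT_comp mX).
    have mb' : measurable_fun setT (fun z : T * M * M => b z.1.1).
      by apply: (measurableT_comp mb); mfun.
    have mc' : measurable_fun setT (fun z : T * M * M => c z.1.1).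
      by apply: (measurableT_comp mc); mfun.
    have mt' : measurable_fun setT (fun z : T * M * M => t z.1.1).
      by apply: (measurableT_comp mt); mfun.
    by mfun.
  by move=> z k; exact: X0.
by move=> z n; apply: integral_ge0.
Qed.

Let closed_slope_plane (b c t : R) : closed (slope_plane b c t).
Proof.
pose l (x : E3 R) : R := (x.1.1 + b * x.1.2 + c * x.2)%R.
have cl : continuous l.
  move=> x; apply: (@continuousD _ _ _ (fun x : E3 R => (x.1.1 : R) + b * x.1.2)%R
    (fun x : E3 R => c * x.2)%R).
    apply: (@continuousD _ _ _ (fun x : E3 R => x.1.1 : R) (fun x : E3 R => b * x.1.2)%R).
  - by apply: (@continuous_comp _ _ _ (fst : E3 R -> _) fst); [exact: cvg_fst|exact: cvg_fst].
  - apply: continuousM; first exact: cst_continuous.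
    by apply: (@continuous_comp _ _ _ (fst : E3 R -> _) snd); [exact: cvg_fst|exact: cvg_snd].
  - apply: continuousM; first exact: cst_continuous.
    exact: cvg_snd.
have -> : slope_plane b c t = l @^-1` [set t] by [].
by apply: closed_comp => [x _|]; [exact: cl|exact: closed_eq].
Qed.

Let perimeter_section (b c t : R) :
  perimeter (slope_plane b c t) (K `&` slope_plane b c t) =
  (1 + b ^+ 2 + c ^+ 2)%:E * Q b c t.
Proof.
set C := K `&` _.
have CE : C `<=` slope_plane b c t by move=> x [].
have cC : compact C.
  apply: (@subclosed_compact _ _ K) => //; last by move=> x [].
  by apply: closedI.
have convC x y (s : R) : C x -> C y -> (0 <= s <= 1)%R -> C ((1 - s) *: x + s *: y)%R.
  move=> [Kx Ex] [Ky Ey] s01; split; first exact: convK.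
  exact: slope_plane_affine.
rewrite (perimeterE CE cC convC).
have mw := measurable_width CE cC convC.
have mgw : measurable_fun setT (fun n : M => (gnomonic_weight (- b - c * n) n)%:E).
  by apply/measurable_EFinP; apply: measurable_gnomonic_weight; mfun.
have gw0 n : 0 <= (gnomonic_weight (- b - c * n) n)%:E :> \bar R.
  by rewrite lee_fin gnomonic_weight_ge0.
rewrite -[RHS]ge0_integralZl; last 4 first.
- exact: measurableT.
- apply: (@measurable_fun_integral _ _ _ _ _ mu (fun n k =>
    X ((t - c * k, 0, k)%R, ((- b - c * n)%R, n)))).
    by apply: (measurableT_comp mX); mfun.
  by move=> n k; exact: X0.
- by move=> n _; apply: integral_ge0.
- by rewrite lee_fin !addr_ge0// sqr_ge0.
apply: eq_integral => n _; rewrite /chord_density EFinM -muleA.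
apply: (congr1 (fun u => (1 + b ^+ 2 + c ^+ 2)%:E * u)).
transitivity ((gnomonic_weight (- b - c * n) n)%:E *
    \int[mu]_k (\1_(height n @` C : set M) k)%:E).
  apply: (congr1 (fun u => _ * u)).
  rewrite integral_indic; [by rewrite setIT|exact: measurableT|].
  exact: (measurable_height_image cC convC).
rewrite -ge0_integralZl; last 4 first.
- exact: measurableT.
- apply/measurable_EFinP; apply: measurable_indic.
  exact: (measurable_height_image cC convC).
- by move=> k _; rewrite lee_fin.
- exact: gw0.
apply: eq_integral => k _; rewrite -EFinM /X/=; congr (_ * _)%:E.
apply: indic_eq; rewrite (height_imageP CE); split => -[s].
  move=> [Ks _]; exists s; move: Ks; rewrite /lift_plane /line_point/=.
  by congr (K (_, _, _)); ring.
move=> Ks; exists s; split; last exact: lift_planeP.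
by move: Ks; rewrite /lift_plane /line_point/=; congr (K (_, _, _)); ring.
Qed.

(** * Lines through a point *)

Let m (P : E3 R) : \bar R := \int[mu]_p \int[mu]_n X (P, (p, n)).

Let mm : measurable_fun setT m.
Proof.
apply: (@measurable_fun_integral _ _ _ _ _ mu (fun P p => \int[mu]_n X (P, (p, n)))).
  apply: (@measurable_fun_integral _ _ _ _ _ mu (fun (z : E3 R * M) n => X (z.1, (z.2, n)))).
    by apply: (measurableT_comp mX); mfun.
  by move=> z n; exact: X0.
by move=> P p; apply: integral_ge0.
Qed.

Let m0 P : 0 <= m P.
Proof. by apply: integral_ge0 => p _; apply: integral_ge0. Qed.

Let m_in P : K P -> m P = (2 * pi)%:E.
Proof.
move=> KP; rewrite -integral_gnomonic_weight /m.
apply: eq_integral => p _; apply: eq_integral => n _.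
rewrite /X/= indicE mem_set ?mulr1//; exists 0%R; rewrite /line_point/=.
by rewrite !mul0r !addr0 -!surjective_pairing.
Qed.

Let measurable_enorm : measurable_fun setT (@enorm R : E3 R -> M).
Proof. by rewrite /enorm /dot; mfun. Qed.

Let measurable_unit_sphere : measurable (@unit_sphere R).
Proof.
rewrite -[X in measurable X]setTI.
exact: (measurable_enorm measurableT (measurable_set1 (1%R : R))).
Qed.

Let measurable_solid_angle P : measurable (solid_angle K P).
Proof.
have -> : solid_angle K P = @unit_sphere R `&`
    [set u | exists2 t, (0 <= t)%R & K (P + t *: u)%R] by [].
apply: measurableI => //.
have -> : [set u : E3 R | exists2 t, (0 <= t)%R & K (P + t *: u)%R] =
    [set u | exists2 t, (0 <= t)%R &
      K (P.1.1 + t * u.1.1, P.1.2 + t * u.1.2, P.2 + t * u.2)%R] by [].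
apply: measurable_meets_ray => //; first by move=> t; mfun.
move=> u t; apply: (@continuous_E3 R R t (fun t => P.1.1 + t * u.1.1)%R
  (fun t => P.1.2 + t * u.1.2)%R (fun t => P.2 + t * u.2)%R);
  by apply: differentiable_continuous; apply/derivable1_diffP; apply: ex_derive.
Qed.

Let unit_gnomonic_y p n : unit_sphere (gnomonic_y p n : E3 R).
Proof.
rewrite /unit_sphere/= /enorm /dot/=.
set W := hyp3 p n; have W0 : W != 0%R by exact: hyp3_neq0.
have -> : (W^-1 * p * (W^-1 * p) + W^-1 * W^-1 + W^-1 * n * (W^-1 * n) = 1)%R.
  transitivity ((1 + p ^+ 2 + n ^+ 2) / W ^+ 2)%R; first by field.
  by rewrite hyp3_sqr divff// -hyp3_sqr expf_neq0.
by rewrite sqrtr1.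
Qed.

Let unit_sphereN (u : E3 R) : unit_sphere u -> unit_sphere (- u)%R.
Proof.
by rewrite /unit_sphere/= /enorm /dot/= !mulrNN.
Qed.

(** Each unit vector of the solid angle spans a line that meets K, and by
   convexity its opposite is not in the solid angle. *)
Let m_out P : ~ K P -> m P = sphere_measure (solid_angle K P).
Proof.
move=> nKP.
have mS := measurable_solid_angle P.
transitivity (\int[@sphere_measure R]_u (\1_(solid_angle K P) u)%:E); last first.
  by rewrite integral_indic// setIT.
rewrite integral_gnomonic_y; last 2 first.
- by apply/measurable_EFinP; apply: measurable_indic.
- by move=> z; rewrite lee_fin.
apply: eq_integral => p _; apply: eq_integral => n _.
rewrite /X/= EFinM; congr (_ * _).
set W := hyp3 p n; have W0 : (0 < W)%R by exact: hyp3_gt0.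
have WN : W != 0%R by rewrite gt_eqF.
have pos (s : R) : (P + s *: gnomonic_y p n)%R = line_point (P, (p, n)) (s / W).
  rewrite /line_point /gnomonic_y -/W /=.
  by congr (_, _, _); rewrite /= /GRing.scale/=; ring.
have neg (s : R) : (P + s *: - gnomonic_y p n)%R = line_point (P, (p, n)) (- (s / W)).
  by rewrite scalerN -scaleNr pos mulNr.
rewrite !indicE.
have excl : (exists2 s, (0 <= s)%R & K (line_point (P, (p, n)) s)) ->
    (exists2 s, (0 <= s)%R & K (line_point (P, (p, n)) (- s))) -> False.
  move=> [s s0 Ks] [r r0 Kr]; apply: nKP.
  have [sr0|sr0] := eqVneq (s + r)%R 0%R.
    have s00 : s = 0%R by lra.
    move: Ks; rewrite s00 /line_point/= !mul0r !addr0.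
    by rewrite -!surjective_pairing.
  have srp : (0 < s + r)%R by rewrite lt_neqAle eq_sym sr0 addr_ge0.
  have := convK Ks Kr (s := (s / (s + r))%R).
  rewrite ler_pdivlMr// mul0r s0 ler_pdivrMr// mul1r lerDl r0 => /(_ isT).
  have eqE3 (x y : E3 R) : x.1.1 = y.1.1 -> x.1.2 = y.1.2 -> x.2 = y.2 -> x = y.
    by case: x => -[? ?] ?; case: y => -[? ?] ? /= -> -> ->.
  suff -> : ((1 - s / (s + r)) *: line_point (P, (p, n)) s +
    (s / (s + r)) *: line_point (P, (p, n)) (- r))%R = P by [].
  by apply: eqE3; rewrite /= /GRing.scale/=; field.
have [h|h] := pselect (hit (P, (p, n))).
  rewrite (mem_set h); case: h => s Ks.
  have [s0|/ltW s0] := leP 0%R s.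
    rewrite mem_set; last first.
      split; first exact: unit_gnomonic_y.
      by exists (s * W)%R; [rewrite mulr_ge0// ltW|rewrite pos mulfK].
    rewrite memNset ?adde0// => -[_ [r r0]]; rewrite neg => Kr.
    apply: excl; first by exists s.
    by exists (r / W)%R => //; rewrite divr_ge0// ltW.
  rewrite memNset; last first.
    move=> [_ [r r0]]; rewrite pos => Kr.
    apply: excl; first by exists (r / W)%R => //; rewrite divr_ge0// ltW.
    by exists (- s)%R; rewrite ?oppr_ge0// opprK.
  rewrite mem_set ?add0e//; split; first exact: unit_sphereN (unit_gnomonic_y p n).
  exists (- s * W)%R; first by rewrite mulr_ge0 ?oppr_ge0// ltW.
  by rewrite neg mulfK// opprK.
rewrite (memNset h) memNset; last first.
  by move=> [_ [r r0]]; rewrite pos => Kr; apply: h; exists (r / W)%R.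
rewrite memNset ?adde0//.
by move=> [_ [r r0]]; rewrite neg => Kr; apply: h; exists (- (r / W))%R.
Qed.

Let sqr_ge0e (x : \bar R) : 0 <= x ^+ 2.
Proof.
by case: x => [r| |]; rewrite expe2 /= ?mulyy ?mulNyNy// -EFinM lee_fin -expr2 sqr_ge0.
Qed.

Let integral_m_sqr : \int[mu3]_P (m P) ^+ 2 =
  \int[mu3]_(P in ~` K) (sphere_measure (solid_angle K P)) ^+ 2 +
  (4 * pi ^+ 2)%:E * mu3 K.
Proof.
have mK : measurable K by exact: closed_measurable_E3.
have mKC : measurable (~` K) by exact: measurableC.
have mm2 : measurable_fun setT (fun P => (m P) ^+ 2).
  have -> : (fun P => (m P) ^+ 2) = (fun P => m P * m P) by apply/funext => P; rewrite expe2.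
  exact: emeasurable_funM.
rewrite -(setvU K) ge0_integral_setU; last 5 first.
- exact: mKC.
- exact: mK.
- by rewrite setvU.
- by move=> P _; exact: sqr_ge0e.
- by apply/disj_setPS => P [].
congr (_ + _).
  by apply: eq_integral => P /[!inE] nKP; rewrite m_out.
transitivity (\int[mu3]_(P in K) (cst (4 * pi ^+ 2)%:E P)).
  apply: eq_integral => P /[!inE] KP; rewrite m_in// expe2 -EFinM /=.
  by congr EFin; ring.
by rewrite integral_cst.
Qed.

(** * Integration over the planes *)

Let unit_gnomonic_x p n : unit_sphere (gnomonic_x p n : E3 R).
Proof.
rewrite /unit_sphere/= /enorm /dot/=.
set W := hyp3 p n; have W0 : W != 0%R by exact: hyp3_neq0.
have -> : (W^-1 * W^-1 + W^-1 * p * (W^-1 * p) + W^-1 * n * (W^-1 * n) = 1)%R.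
  transitivity ((1 + p ^+ 2 + n ^+ 2) / W ^+ 2)%R; first by field.
  by rewrite hyp3_sqr divff// -hyp3_sqr expf_neq0.
by rewrite sqrtr1.
Qed.

(** G is a measurable function that agrees with F off the null set of planes
   parallel to the x-axis, which the chart x + b * y + c * z = t misses. *)
Let F (z : E3 R * M) : \bar R :=
  (perimeter (plane z.1 z.2) (K `&` plane z.1 z.2)) ^+ 2.

Let S (b c t : R) : \bar R := ((1 + b ^+ 2 + c ^+ 2)%:E * Q b c t) ^+ 2.

Let G (z : E3 R * M) : \bar R :=
  S (z.1.1.2 / z.1.1.1)%R (z.1.2 / z.1.1.1)%R (z.2 / z.1.1.1)%R.

Let S0 b c t : 0 <= S b c t. Proof. exact: sqr_ge0e. Qed.

Let mQ2 d (T : measurableType d) (b c t : T -> M) :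
  measurable_fun setT b -> measurable_fun setT c -> measurable_fun setT t ->
  measurable_fun setT (fun z => (Q (b z) (c z) (t z)) ^+ 2).
Proof.
move=> mb mc mt.
have -> : (fun z => (Q (b z) (c z) (t z)) ^+ 2) =
    (fun z => Q (b z) (c z) (t z) * Q (b z) (c z) (t z)).
  by apply/funext => z; rewrite expe2.
by apply: emeasurable_funM; exact: mQ.
Qed.

Let SE b c t : S b c t = ((1 + b ^+ 2 + c ^+ 2) ^+ 2)%:E * (Q b c t) ^+ 2.
Proof. by rewrite /S !expe2 muleACA -EFinM -expr2. Qed.

Let mS d (T : measurableType d) (b c t : T -> M) :
  measurable_fun setT b -> measurable_fun setT c -> measurable_fun setT t ->
  measurable_fun setT (fun z => S (b z) (c z) (t z)).
Proof.
move=> mb mc mt.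
have -> : (fun z => S (b z) (c z) (t z)) = (fun z =>
    ((1 + b z ^+ 2 + c z ^+ 2) ^+ 2)%:E * (Q (b z) (c z) (t z)) ^+ 2).
  by apply/funext => z; rewrite SE.
by apply: emeasurable_funM; [mfun|exact: mQ2].
Qed.

Let mG : measurable_fun setT G.
Proof. by apply: mS; mfun. Qed.

Let FG z : z.1.1.1 <> 0%R -> F z = G z.
Proof.
move=> /eqP u0; rewrite /F /G /S.
have -> : plane z.1 z.2 =
    slope_plane (z.1.1.2 / z.1.1.1) (z.1.2 / z.1.1.1) (z.2 / z.1.1.1).
  apply/seteqP; split => x; rewrite /plane /slope_plane/= /dot => e.
    by rewrite -e; field.
  have -> : z.2 = (z.2 / z.1.1.1 * z.1.1.1)%R by rewrite divfK.
  by rewrite -e; field.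
by rewrite perimeter_section.
Qed.

Let D : set (E3 R * M) := @unit_sphere R `*` setT.
Let N : set (E3 R * M) := [set u : E3 R | u.1.1 = 0%R] `*` setT.

Let measurable_D : measurable D.
Proof. exact: measurableX. Qed.

Let measurable_vertical : measurable [set u : E3 R | u.1.1 = 0%R].
Proof.
have m11 : measurable_fun setT (fun u : E3 R => u.1.1) by mfun.
rewrite -[X in measurable X]setTI.
exact: (m11 measurableT _ (measurable_set1 (0%R : R))).
Qed.

Let vertical_null : @sphere_measure R [set u : E3 R | u.1.1 = 0%R] = 0.
Proof.
transitivity (\int[@sphere_measure R]_u (\1_[set u : E3 R | u.1.1 = 0%R] u)%:E).
  by rewrite integral_indic// setIT.
rewrite integral_gnomonic_x; last 2 first.
- by apply/measurable_EFinP; apply: measurable_indic.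
- by move=> z; rewrite lee_fin.
rewrite integral0_eq// => p _; rewrite integral0_eq// => n _.
have W0 : (hyp3 p n)^-1%R != 0%R by rewrite invr_eq0 hyp3_neq0.
rewrite !indicE memNset; last by move=> /= /eqP; rewrite (negbTE W0).
rewrite memNset; last by move=> /= /eqP; rewrite oppr_eq0 (negbTE W0).
by rewrite adde0 mule0.
Qed.

Let measurable_N : measurable N.
Proof. exact: measurableX. Qed.

Let N_null : @plane_measure R N = 0.
Proof.
rewrite /plane_measure /mscale/= product_measure1E//.
by rewrite [X in _ * (X * _)]vertical_null mul0e mule0.
Qed.

Let GE (u : E3 R) (t b c : R) : u.1.1 != 0%R -> u.1.2 = (u.1.1 * b)%R ->
  u.2 = (u.1.1 * c)%R -> G (u, t) = S b c (t / u.1.1)%R.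
Proof.
move=> u0 ub uc; rewrite /G /=.
have -> : (u.1.2 / u.1.1)%R = b by rewrite ub mulrAC divff// mul1r.
by have -> : (u.2 / u.1.1)%R = c by rewrite uc mulrAC divff// mul1r.
Qed.

(** With W the length of (1, b, c), the chart has density W ^ - 3 for the normal
   and W ^ - 1 for the distance to the origin, and the squared perimeter is
   W ^ 4 times the square of Q: all powers of W cancel. The two opposite normals
   of a plane give equal contributions, which the factor 1 / 2 in the measure
   of planes compensates. *)
Let lhs_chart : \int[@plane_measure R]_(z in D) F z =
  \int[mu]_b \int[mu]_c \int[mu]_t (Q b c t) ^+ 2.
Proof.
have G0 z : 0 <= G z by exact: S0.
have F0 z : 0 <= F z by exact: sqr_ge0e.
rewrite -(ge0_integral_setD_null D measurable_N N_null F0).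
transitivity (\int[@plane_measure R]_(z in D `\` N) G z).
  apply: eq_integral => z /[!inE] -[_ nN]; apply: FG => u0.
  by apply: nN.
rewrite (ge0_integral_setD_null D measurable_N N_null G0).
rewrite integral_mkcond.
have mGD : measurable_fun setT (G \_ D).
  by apply/(measurable_restrictT _ measurable_D); exact: measurable_funTS.
have GD0 z : 0 <= (G \_ D) z by rewrite patchE; case: ifP.
rewrite /plane_measure ge0_integral_mscale; [|exact: measurableT|exact: mGD|by []].
have -> : \int[(@sphere_measure R \x mu)]_z (G \_ D) z =
    \int[@sphere_measure R]_u \int[mu]_t (G \_ D) (u, t).
  exact: (@fubini_tonelli1 _ _ _ _ _ (@sphere_measure R) mu _ mGD GD0).
rewrite integral_gnomonic_x; last 2 first.
- exact: (@measurable_fun_fubini_tonelli_F _ _ _ _ _ mu _ mGD GD0).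
- by move=> u; apply: integral_ge0.
have key b c : (gnomonic_weight b c)%:E *
    (\int[mu]_t (G \_ D) (gnomonic_x b c, t) +
     \int[mu]_t (G \_ D) ((- gnomonic_x b c)%R, t)) =
    2%:E * \int[mu]_t (Q b c t) ^+ 2.
  set W := hyp3 b c; have W0 : (0 < W)%R by exact: hyp3_gt0.
  have WN : W != 0%R by rewrite gt_eqF.
  have IS : \int[mu]_t S b c t = (W ^+ 4)%:E * \int[mu]_t (Q b c t) ^+ 2.
    rewrite -ge0_integralZl; last 4 first.
    - exact: measurableT.
    - by apply: mQ2; mfun.
    - by move=> t _; exact: sqr_ge0e.
    - by rewrite lee_fin exprn_ge0// ltW.
    apply: eq_integral => t _; rewrite SE; congr (_%:E * _).
    by rewrite -hyp3_sqr -/W -exprM.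
  have chart (s : R) : s != 0%R -> \int[mu]_t S b c (t / s)%R = `|s|%:E * \int[mu]_t S b c t.
    move=> s0.
    have mSt : measurable_fun setT (fun t : M => S b c t) by apply: mS; mfun.
    have sV0 : s^-1%R != 0%R by rewrite invr_eq0.
    have e := @ge0_integral_affine R 0%R s^-1%R (fun t => S b c t) sV0 mSt (S0 b c).
    transitivity (`|s|%:E * (`|s^-1|%:E * \int[mu]_t S b c (0 + s^-1 * t)%R)).
      rewrite muleA -EFinM normfV divff ?normr_eq0// mul1e.
      by apply: eq_integral => t _; rewrite add0r mulrC.
    by apply: (congr1 (fun u => `|s|%:E * u)); exact: esym e.
  have e1 : \int[mu]_t (G \_ D) (gnomonic_x b c, t) = `|W^-1%R|%:E * \int[mu]_t S b c t.
    rewrite -chart; last by rewrite invr_eq0.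
    apply: eq_integral => t _; rewrite patchE mem_set; last first.
      by split => //; exact: unit_gnomonic_x.
    by apply: (@GE (gnomonic_x b c) t b c); rewrite /= ?invr_eq0.
  have e2 : \int[mu]_t (G \_ D) ((- gnomonic_x b c)%R, t) =
      `|W^-1%R|%:E * \int[mu]_t S b c t.
    rewrite -normrN -chart; last by rewrite oppr_eq0 invr_eq0.
    apply: eq_integral => t _; rewrite patchE mem_set; last first.
      by split => //; exact/unit_sphereN/unit_gnomonic_x.
    by apply: (@GE (- gnomonic_x b c)%R t b c); rewrite /= ?oppr_eq0 ?invr_eq0// mulNr.
  transitivity ((gnomonic_weight b c)%:E *
    (`|W^-1%R|%:E * \int[mu]_t S b c t + `|W^-1%R|%:E * \int[mu]_t S b c t)).
    exact: (congr2 (fun u v => (gnomonic_weight b c)%:E * (u + v)) e1 e2).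
  rewrite IS gtr0_norm ?invr_gt0// -ge0_muleDl ?lee_fin ?invr_ge0 ?ltW//.
  rewrite -EFinD !muleA -!EFinM; apply: (congr1 (fun u => u%:E * _)).
  by rewrite /gnomonic_weight -/W; field.
have mQ3 : measurable_fun setT (fun z : M * M => \int[mu]_t (Q z.1 z.2 t) ^+ 2).
  apply: (@measurable_fun_integral _ _ _ _ _ mu (fun (z : M * M) t => (Q z.1 z.2 t) ^+ 2)).
    by apply: mQ2; mfun.
  by move=> z t; exact: sqr_ge0e.
have Q30 b c : 0 <= \int[mu]_t (Q b c t) ^+ 2.
  by apply: integral_ge0 => t _; exact: sqr_ge0e.
have mQ3b b : measurable_fun setT (fun c : M => \int[mu]_t (Q b c t) ^+ 2).
  apply: (@measurable_fun_integral _ _ _ _ _ mu (fun (c : M) t => (Q b c t) ^+ 2)).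
    by apply: mQ2; mfun.
  by move=> z t; exact: sqr_ge0e.
transitivity ((2^-1)%:E *
    (2%:E * \int[mu]_b \int[mu]_c \int[mu]_t (Q b c t) ^+ 2)); last first.
  by rewrite muleA -EFinM mulVf// mul1e.
congr (_ * _).
rewrite -ge0_integralZl; last 4 first.
- exact: measurableT.
- exact: (@measurable_fun_integral _ _ _ _ _ mu _ mQ3 Q30).
- by move=> b _; apply: integral_ge0.
- by [].
apply: eq_integral => b _.
rewrite -ge0_integralZl; last 4 first.
- exact: measurableT.
- exact: mQ3b.
- by move=> c _.
- by [].
by apply: eq_integral => c _; exact: key.
Qed.

Lemma integral_perimeter_sqr :
  \int[@plane_measure R]_(z in @unit_sphere R `*` setT)
     (perimeter (plane z.1 z.2) (K `&` plane z.1 z.2)) ^+ 2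
  = \int[mu3]_(P in ~` K) (sphere_measure (solid_angle K P)) ^+ 2
    + (4 * pi ^+ 2)%:E * mu3 K.
Proof.
rewrite -integral_m_sqr -(integral_line_pairs mX X0 Xinv) [LHS]lhs_chart.
rewrite (@tonelli_lebesgue2 _ (fun b c => \int[mu]_t (Q b c t) ^+ 2))//.
- apply: (@measurable_fun_integral _ _ _ _ _ mu (fun (z : M * M) t => (Q z.1 z.2 t) ^+ 2)).
    by apply: mQ2; mfun.
  by move=> z t; exact: sqr_ge0e.
- by move=> b c; apply: integral_ge0 => t _; exact: sqr_ge0e.
Qed.

End crofton.

Local Open Scope ereal_scope.

Theorem theorem1p3 (R : realType) (K : set (E3 R))
    (K_compact : compact K)
    (K_convex : convex_set (K : set (convex_lmodType (E3 R)))) :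
  \int[@plane_measure R]_(z in @unit_sphere R `*` setT)
     (perimeter (plane z.1 z.2) (K `&` plane z.1 z.2)) ^+ 2
  = \int[@lebesgue3 R]_(P in ~` K) (sphere_measure (solid_angle K P)) ^+ 2
    + (4 * pi ^+ 2)%:E * lebesgue3 K.
Proof.
apply: integral_perimeter_sqr => // x y s Kx Ky /andP[s0 s1].
have s01 : (0 <= 1 - s <= 1)%R by rewrite subr_ge0 s1 gerBl.
have := K_convex x y (Itv01 (proj1 (andP s01)) (proj2 (andP s01))).
rewrite !inE => /(_ Kx Ky).
by rewrite /conv/= /unstable.onem subKr.
Qed.
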